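(* Let $(\mathcal X,Q,\pi)$ be a non-linear Markov triple and assume that $\mathrm{Ric}(\mathcal X,Q,\pi)\ge\lambda$ for some $\lambda>0$. Then the following hold. (i) There exists a unique stationary point $\pi^*\in\mathcal P(\mathcal X)$ for the evolution $\dot\mu_t=\mu_tQ(\mu_t)$ (i.e. a unique $\pi^*\in\mathcal P(\mathcal X)$ with $\pi^*Q(\pi^* )=0$), and it is the unique minimizer of $\mathcal F$ on $\mathcal P(\mathcal X)$. Set $\mathcal F_*(\mu):=\mathcal F(\mu)-\mathcal F(\pi^* )$. (ii) The modified logarithmic Sobolev inequality with constant $\lambda$ holds: for all $\mu\in\mathcal P(\mathcal X)$, $$\mathcal F_*(\mu)\le\frac1{2\lambda}\,\mathcal I(\mu).$$ (iii) For any solution $(\mu_t)_{t\ge0}$ in $\mathcal P(\mathcal X)$ of $\dot\mu_t=\mu_tQ(\mu_t)$ and all $t\geq 0$, $$\mathcal F_*(\mu_t)\le e^{-2\lambda t}\,\mathcal F_*(\mu_0).$$ (iv) The entropy-transport inequality with constant $\lambda$ holds: for all $\mu\in\mathcal P(\mathcal X)$, $$\mathcal W(\mu,\pi^* )\le\sqrt{\frac2\lambda\,\mathcal F_*(\mu)}.$$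
   Context: $\mathcal X$ is a finite set, $\mathcal P(\mathcal X)$ is the set of probability vectors $\mu=(\mu_x)_{x\in\mathcal X}$, and $\mathcal P_*(\mathcal X)$ the subset of those with $\mu_x>0$ for all $x$. **Non-linear Markov triple** $(\mathcal X,Q,\pi)$. Let $K:\mathcal P(\mathcal X)\times\mathcal X\to\mathbb R$ be such that each $K_x:\mathcal P(\mathcal X)\to\mathbb R$ is twice continuously differentiable (regarded as defined on a neighbourhood of $\mathcal P(\mathcal X)$ in $\mathbb R^{\mathcal X}$ so that partial derivatives make sense). Put $$U(\mu)=\sum_{x}\mu_xK_x(\mu),\quad H_x(\mu)=\frac{\partial}{\partial\mu_x}U(\mu),\quad \pi_x(\mu)=\frac1{Z(\mu)}e^{-H_x(\mu)},$$ with $Z(\mu)$ normalizing $\pi(\mu)$ to a probability measure. For each $\mu\in\mathcal P(\mathcal X)$, $Q(\mu)\in\mathbb R^{\mathcal X\times\mathcal X}$ is a rate matrix ($Q_{xy}(\mu)\ge0$ for $x\ne y$, $Q_{xx}(\mu)=-\sum_{y\ne x}Q_{xy}(\mu)$) of an irreducible Markov chain which is reversible with respect to $\pi(\mu)$: $\pi_x(\mu)Q_{xy}(\mu)=\pi_y(\mu)Q_{yx}(\mu)$ for all $x,y$. For all $x,y$ the map $\mu\mapsto Q_{xy}(\mu)$ is Lipschitz on $\mathcal P(\mathcal X)$. **Free energy:** $\mathcal F(\mu)=\sum_x\mu_x\log\mu_x+U(\mu)$ with $0\log0=0$. **Evolution:** $\dot\mu_t=\mu_tQ(\mu_t)$,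 i.e. $\dot\mu_t(y)=\sum_x\mu_t(x)Q_{xy}(\mu_t)$. **Fisher information:** for $\mu\in\mathcal P_*(\mathcal X)$, $\mathcal I(\mu)=\frac12\sum_{x\ne y}\Theta\big(\mu_xQ_{xy}(\mu),\mu_yQ_{yx}(\mu)\big)$, where $\Theta(a,b)=(a-b)(\log a-\log b)$ and $\Theta(0,0)=0$; $\mathcal I(\mu)=+\infty$ for $\mu\notin\mathcal P_*(\mathcal X)$. **Distance $\mathcal W$.** Let $\Lambda(a,b)=\int_0^1a^{1-s}b^s\,ds$ be the logarithmic mean and $\Lambda(\mu)_{xy}=\Lambda(\mu_xQ_{xy}(\mu),\mu_yQ_{yx}(\mu))$ for $x\ne y$ (diagonal values are irrelevant). For $\psi\in\mathbb R^{\mathcal X}$ let $\nabla\psi_{xy}=\psi_y-\psi_x$; for $\Psi\in\mathbb R^{\mathcal X\times\mathcal X}$ let $(\nabla\cdot\Psi)_x=\frac12\sum_y(\Psi_{xy}-\Psi_{yx})$; $\cdot$ between matrices is the entrywise product. The action is $\mathcal A(\mu,\psi)=\frac12\sum_{x,y}(\psi_y-\psi_x)^2\Lambda(\mu)_{xy}$. $\mathrm{CE}$ is the set of curves $(\mu_t,\psi_t)_{t\in[0,1]}$ with $t\mapsto\mu_t\in\mathcal P(\mathcal X)$ continuous, $t\mapsto\psi_t\in\mathbb R^{\mathcal X}$ measurable and integrable, satisfying the continuity equation $\dot\mu_t+\nabla\cdot(\Lambda(\mu_t)\cdot\nabla\psi_t)=0$ in the distributional sense. For $\mu_0,\mu_1\in\mathcal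 P(\mathcal X)$, $\mathcal W(\mu_0,\mu_1)=\inf\big(\int_0^1\mathcal A(\mu_t,\psi_t)\,dt\big)^{1/2}$ over all $(\mu,\psi)\in\mathrm{CE}$ connecting $\mu_0$ to $\mu_1$. A $\mathcal W$-geodesic is a curve $(\mu_t)_{t\in[0,1]}$ with $\mathcal W(\mu_s,\mu_t)=|s-t|\mathcal W(\mu_0,\mu_1)$. **Curvature:** $\mathrm{Ric}(\mathcal X,Q,\pi)\ge\kappa$ means that for every $\mathcal W$-geodesic $(\mu_t)_{t\in[0,1]}$ in $\mathcal P(\mathcal X)$ and all $t\in[0,1]$, $$\mathcal F(\mu_t)\le(1-t)\mathcal F(\mu_0)+t\mathcal F(\mu_1)-\frac\kappa2t(1-t)\mathcal W(\mu_0,\mu_1)^2.$$ *)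

(* Defs.v *)
From HB Require Import structures.
From mathcomp Require Import all_boot all_order all_algebra.
From mathcomp Require Import all_classical all_reals all_analysis.

Set Implicit Arguments.
Unset Strict Implicit.
Unset Printing Implicit Defensive.

Import Order.TTheory GRing.Theory Num.Theory.
Import numFieldNormedType.Exports.

Local Open Scope classical_set_scope.
Local Open Scope ring_scope.

(* The finite nonempty state space is enumerated as 'I_n.+1 (it has to be
   nonempty, for otherwise there is no probability vector at all).  Probability
   vectors are row vectors, so that mu Q is [mu *m Q].  Functions of mu are total
   on 'rV[R]_n.+1, but only their values on the simplex -- for K, on a
   neighbourhood of it -- are constrained. *)

Section NonlinearMarkovTriple.
Variables (R : realType) (n : nat).

Definition simplex : set 'rV[R]_n.+1 :=
  [set mu | (forall x, 0 <= mu 0 x) /\ \sum_x mu 0 x = 1].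

Definition partial (x : 'I_n.+1) (f : 'rV[R]_n.+1 -> R) : 'rV[R]_n.+1 -> R :=
  'D_(delta_mx 0 x : 'rV[R]_n.+1) f.

Definition C2_on (O : set 'rV[R]_n.+1) (f : 'rV[R]_n.+1 -> R) : Prop :=
  forall p, O p ->
    {for p, continuous f} /\
    forall x, [/\ derivable f p (delta_mx 0 x),
      {for p, continuous (partial x f)} &
      forall y, derivable (partial x f) p (delta_mx 0 y) /\
        {for p, continuous (partial y (partial x f))}].

Section Potential.
Variable K : 'rV[R]_n.+1 -> 'I_n.+1 -> R.

Definition potential (mu : 'rV[R]_n.+1) : R := \sum_x mu 0 x * K mu x.

Definition hamiltonian (mu : 'rV[R]_n.+1) (x : 'I_n.+1) : R :=
  partial x potential mu.

Definition partition_function (mu : 'rV[R]_n.+1) : R :=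
  \sum_x expR (- hamiltonian mu x).

Definition gibbs (mu : 'rV[R]_n.+1) (x : 'I_n.+1) : R :=
  (partition_function mu)^-1 * expR (- hamiltonian mu x).

(* The library's [ln 0 = 0] gives 0 log 0 = 0. *)
Definition free_energy (mu : 'rV[R]_n.+1) : R :=
  \sum_x mu 0 x * ln (mu 0 x) + potential mu.

End Potential.

Definition rate_matrix (q : 'M[R]_n.+1) : Prop :=
  (forall x y, x != y -> 0 <= q x y) /\
  (forall x, q x x = - \sum_(y | y != x) q x y).

Definition irreducible_rates (q : 'M[R]_n.+1) : Prop :=
  forall x y, connect [rel u v | 0 < q u v] x y.

Definition reversible (p : 'I_n.+1 -> R) (q : 'M[R]_n.+1) : Prop :=
  forall x y, p x * q x y = p y * q y x.

Record nonlinear_markov_triple (K : 'rV[R]_n.+1 -> 'I_n.+1 -> R)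
    (Q : 'rV[R]_n.+1 -> 'M[R]_n.+1) : Prop := NonlinearMarkovTriple {
  triple_C2 : exists O : set 'rV[R]_n.+1,
    [/\ open O, simplex `<=` O & forall x, C2_on O (fun mu => K mu x)];
  triple_rates : forall mu, simplex mu -> rate_matrix (Q mu);
  triple_irreducible : forall mu, simplex mu -> irreducible_rates (Q mu);
  triple_reversible : forall mu, simplex mu -> reversible (gibbs K mu) (Q mu);
  triple_lipschitz : forall x y, [lipschitz (Q mu x y : R) | mu in simplex]
}.

Section Dynamics.
Variable Q : 'rV[R]_n.+1 -> 'M[R]_n.+1.

Definition stationary (mu : 'rV[R]_n.+1) : Prop :=
  simplex mu /\ mu *m Q mu = 0.

(* At t = 0 only continuity is asked: since Q is continuous on the simplex, the
   one-sided derivative at 0 then exists and satisfies the equation too. *)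
Definition evolution_solution (mu : R -> 'rV[R]_n.+1) : Prop :=
  [/\ forall t : R, 0 <= t -> simplex (mu t),
      {within `[0, +oo[, continuous mu} &
      forall t : R, 0 < t -> is_derive t 1 mu (mu t *m Q (mu t))].

(* The library's [ln 0 = 0] gives Theta 0 0 = 0. *)
Definition Theta (a b : R) : R := (a - b) * (ln a - ln b).

Definition fisher_information (mu : 'rV[R]_n.+1) : \bar R :=
  if [forall x, 0 < mu 0 x] then
    (2^-1 * \sum_x \sum_(y | y != x)
       Theta (mu 0 x * Q mu x y) (mu 0 y * Q mu y x))%:E
  else +oo%E.

Definition log_mean (a b : R) : R :=
  \int[lebesgue_measure]_(s in `[0, 1]) (a `^ (1 - s) * b `^ s).

(* The diagonal entries are junk; they only occur multiplied by the diagonal of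
   a discrete gradient, which vanishes. *)
Definition Lambda (mu : 'rV[R]_n.+1) : 'M[R]_n.+1 :=
  \matrix_(x, y) log_mean (mu 0 x * Q mu x y) (mu 0 y * Q mu y x).

Definition grad (psi : 'rV[R]_n.+1) : 'M[R]_n.+1 :=
  \matrix_(x, y) (psi 0 y - psi 0 x).

Definition divergence (Psi : 'M[R]_n.+1) : 'rV[R]_n.+1 :=
  \row_x (2^-1 * \sum_y (Psi x y - Psi y x)).

Definition action (mu psi : 'rV[R]_n.+1) : R :=
  2^-1 * \sum_x \sum_y (psi 0 y - psi 0 x) ^+ 2 * Lambda mu x y.

Definition flux (mu psi : 'rV[R]_n.+1) : 'M[R]_n.+1 :=
  map2_mx *%R (Lambda mu) (grad psi).

Definition test_function (phi : R -> R) : Prop :=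
  (forall (k : nat) (t : R), derivable (derive1n k phi) t 1) /\
  exists a b : R,
    [/\ 0 < a, b < 1 & forall t : R, t \notin `[a, b] -> phi t = 0].

Definition continuity_equation (mu psi : R -> 'rV[R]_n.+1) : Prop :=
  forall phi, test_function phi -> forall x,
    \int[lebesgue_measure]_(t in `[0, 1]) (derive1 phi t * mu t 0 x) =
    \int[lebesgue_measure]_(t in `[0, 1])
       (phi t * divergence (flux (mu t) (psi t)) 0 x).

Record CE (mu psi : R -> 'rV[R]_n.+1) : Prop := MkCE {
  CE_simplex : forall t : R, t \in `[0, 1] -> simplex (mu t);
  CE_continuous : {within `[0, 1], continuous mu};
  CE_integrable : forall x,
    lebesgue_measure.-integrable `[0, 1] (fun t : R => (psi t 0 x)%:E);
  CE_equation : continuity_equation mu psi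
}.

(* Extended-real valued, the infimum of the empty set being +oo. *)
Definition Wdist (mu0 mu1 : 'rV[R]_n.+1) : \bar R :=
  ereal_inf [set w : \bar R | exists mu psi : R -> 'rV[R]_n.+1,
    [/\ CE mu psi, mu 0 = mu0, mu 1 = mu1 &
        w = sqrte (\int[lebesgue_measure]_(t in `[0%R, 1%R])
                     (action (mu t) (psi t))%:E)%E]].

Definition Wgeodesic (mu : R -> 'rV[R]_n.+1) : Prop :=
  (forall t : R, t \in `[0, 1] -> simplex (mu t)) /\
  (forall s t : R, s \in `[0, 1] -> t \in `[0, 1] ->
    Wdist (mu s) (mu t) = (`|s - t|%R%:E * Wdist (mu 0%R) (mu 1%R))%E).

Definition Ric_ge (K : 'rV[R]_n.+1 -> 'I_n.+1 -> R) (kappa : R) : Prop :=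
  forall mu, Wgeodesic mu -> forall t : R, t \in `[0, 1] ->
    ((free_energy K (mu t))%:E <=
     ((1 - t) * free_energy K (mu 0) + t * free_energy K (mu 1))%R%:E
     - (kappa / 2 * t * (1 - t))%R%:E * Wdist (mu 0%R) (mu 1%R) ^+ 2)%E.

End Dynamics.

Definition minimizer (f : 'rV[R]_n.+1 -> R) (mu : 'rV[R]_n.+1) : Prop :=
  simplex mu /\ forall nu, simplex nu -> f mu <= f nu.

End NonlinearMarkovTriple.

(* Main.v *)
Require Import Defs.
From HB Require Import structures.
From mathcomp Require Import all_boot all_order all_algebra.
From mathcomp Require Import all_classical all_reals all_analysis.
From mathcomp Require Import measurable_realfun ring lra zify.

Set Implicit Arguments.
Unset Strict Implicit.
Unset Printing Implicit Defensive.

Import Order.TTheory GRing.Theory Num.Theory.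
Import numFieldNormedType.Exports.

Local Open Scope classical_set_scope.
Local Open Scope ring_scope.

(** The Fisher information is the squared norm of the gradient of [F] for the
    metric underlying [W]: with [DF] the differential of [F] at an interior point
    [mu], reversibility gives [DF_x - DF_y = ln (mu_x Q_xy) - ln (mu_y Q_yx)], so
    the Dirichlet form of [DF] for the weights [Lambda (mu)] is [I (mu)], which
    is also the dissipation [- sum_y DF_y (mu Q)_y].  Hence an almost minimal
    curve of length [r] from [mu] lowers [F] by at most [r sqrt (I (mu)) + o(r)],
    and convexity of [F] along a geodesic from [mu] to [nu] gives
    [F mu - F nu <= w sqrt I - lam w^2 / 2 <= I / (2 lam)].  With [nu] a minimizer
    this is the modified logarithmic Sobolev inequality; since [I] vanishes at a
    stationary point, every stationary point is a minimizer, and convexity makes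
    minimizers unique.  Gronwall gives the decay, and convexity along a geodesic
    issued from the minimizer gives the entropy-transport inequality.

    The curvature bound is only about geodesics, so their existence has to be
    proved.  [W] is finite and continuous on the whole simplex: near the boundary
    one spreads the mass along the graph at polynomial rates, so that the cost of
    reaching the interior is small.  Pointwise ultrafilter limits of almost
    minimal curves are then geodesics.  For this, elements of [CE] are turned
    into solutions of an integral equation (du Bois-Reymond), for which
    restriction, reparametrization and gluing are available. *)

(** * Real analysis *)

(** The obstacle is the boundary of the simplex, where the logarithmic mean, hence the metric,
    degenerates and the entropy has infinite slope. On a straight segment leaving the boundary the
    flow across a cut stays of order one while the capacity of the cut may tend to 0. With masses of
    order [s^(2h)] at graph distance [h], the flow towards distance [h] and the geometric mean of
    the masses at distances [h - 1] and [h] are both of order [s^(2h-1)], so that their ratio, and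
    with it the potential driving the path, stays bounded down to time 0.

    Geodesics are purely metric objects here: no potential driving them and no derivative of [W] is
    ever needed. The logarithmic Sobolev inequality joins [mu] to a nearby point of a geodesic by a
    separate almost minimal curve, for which an upper bound on the weights near [mu] suffices. *)

Section AffineChange.
Variable R : realType.
Notation leb := (@lebesgue_measure R).

Let aff (c d : R) : measurableTypeR R -> measurableTypeR R := fun x => c * x + d.

Lemma measurable_affine (c d : R) : measurable_fun setT (fun x : R => c * x + d).
Proof. by apply: measurable_funD => //; exact: measurable_funM. Qed.

(** The pushforward under the affine map, rescaled by [|c|], has the right value on half-open
    intervals, and Lebesgue measure is the only measure with these values. Negative [c] is allowed
    for the sake of time reversal. *)
Lemma lebesgue_measure_affine (c d : R) (A : set R) : c != 0 -> measurable A ->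
  leb ((fun x => c * x + d) @^-1` A) = ((`|c|^-1)%:E * leb A)%E.
Proof.
move=> c0 mA.
have nc0 : 0 < `|c| by rewrite normr_gt0.
have nc1 : 0 <= `|c| by [].
pose m : {measure set (measurableTypeR R) -> \bar R} :=
  mscale (NngNum nc1) (pushforward leb (aff c d)).
have -> : leb A = m (@measurable_affine c d) A.
  apply: lebesgue_measure_unique => // _ [[a b]] _ <-.
  rewrite /m /= /mscale /pushforward/= lebesgue_measure_itv/= lte_fin.
  case: (ltgtP c 0) c0 => // cc _.
  - have -> : pushforward leb (aff c d) `]a, b] = leb (`[(b - d) / c, (a - d) / c[%classic).
      congr (leb _); apply/seteqP; split => x /=; rewrite !in_itv/= /aff.
        by rewrite ler_ndivrMr// ltr_ndivlMr// mulrC ltrBlDr lerBrDr andbC.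
      by rewrite ler_ndivrMr// ltr_ndivlMr// mulrC ltrBlDr lerBrDr andbC.
    rewrite lebesgue_measure_itv/= lte_fin ltr_nM2r ?invr_lt0// ltrD2r.
    case: ifPn => ab; last by rewrite mule0.
    rewrite -!EFinD -EFinM; congr EFin; rewrite ltr0_norm//.
    by field; rewrite lt_eqF.
  - have -> : pushforward leb (aff c d) `]a, b] = leb (`](a - d) / c, (b - d) / c]%classic).
      by congr (leb _); apply/seteqP; split => x /=; rewrite !in_itv/= /aff;
        rewrite ler_pdivlMr// ltr_pdivrMr// mulrC ltrBlDr lerBrDr.
    rewrite lebesgue_measure_itv/= lte_fin ltr_pM2r ?invr_gt0// ltrD2r.
    case: ifPn => ab; last by rewrite mule0.
    rewrite -!EFinD -EFinM; congr EFin; rewrite gtr0_norm//.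
    by field; rewrite gt_eqF.
by rewrite /m /= /mscale /pushforward/= muleA -EFinM mulVf ?gt_eqF// mul1e.
Qed.

Lemma ge0_integral_affine (c d : R) (D : set R) (f : R -> \bar R) : c != 0 ->
  measurable D -> measurable_fun D f -> (forall x, D x -> (0 <= f x)%E) ->
  (\int[leb]_(x in (fun x => c * x + d)%R @^-1` D) f (c * x + d)%R =
   (`|c|^-1)%:E * \int[leb]_(x in D) f x)%E.
Proof.
move=> c0 mD mf f0.
have ic0 : 0 <= `|c|^-1 by rewrite invr_ge0.
transitivity (\int[pushforward leb (aff c d)]_(y in D) f y)%E.
  rewrite ge0_integral_pushforward//; first exact: measurable_affine.
  by move=> x; rewrite inE; exact: f0.
transitivity (\int[mscale (NngNum ic0) leb]_(y in D) f y)%E.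
  apply: eq_measure_integral; first exact: measurable_affine.
  by move=> maff A mA _; exact: lebesgue_measure_affine.
by rewrite ge0_integral_mscale.
Qed.

Lemma integrable_affine (c d : R) (D : set R) (f : R -> R) : c != 0 ->
  measurable D -> leb.-integrable D (EFin \o f) ->
  leb.-integrable ((fun x => c * x + d) @^-1` D) (fun x => (f (c * x + d))%:E).
Proof.
move=> c0 mD /integrableP[/measurable_EFinP mf fi]; apply/integrableP; split.
  apply/measurable_EFinP; apply: (measurable_comp _ _ mf) => //.
    by move=> _ [x Dx <-].
  by apply: measurable_funTS; exact: measurable_affine.
under eq_integral do rewrite abse_EFin.
rewrite (ge0_integral_affine d (f := fun x => `|f x|%:E))//.
  by rewrite lte_mul_pinfty.
by apply/measurable_EFinP; exact: measurableT_comp.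
Qed.

Lemma integral_affine (c d : R) (D : set R) (f : R -> R) : c != 0 ->
  measurable D -> leb.-integrable D (EFin \o f) ->
  (\int[leb]_(x in (fun x => c * x + d)%R @^-1` D) (f (c * x + d)%R)%:E =
  (`|c|^-1)%:E * \int[leb]_(x in D) (f x)%:E)%E.
Proof.
move=> c0 mD fi; have mf := measurable_int _ fi.
rewrite [in LHS]integralE [in RHS]integralE.
rewrite muleBr//; last first.
  by apply: fin_num_adde_defr; exact: integrable_pos_fin_num.
rewrite -(ge0_integral_affine d c0 mD (measurable_funepos mf))//.
rewrite -(ge0_integral_affine d c0 mD (measurable_funeneg mf))//.
by congr (_ - _)%E; apply: eq_integral => x _; rewrite (funeposE, funenegE)
  /= ?(funeposE, funenegE).
Qed.

Lemma Rintegral_affine (c d : R) (D : set R) (f : R -> R) : c != 0 ->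
  measurable D -> leb.-integrable D (EFin \o f) ->
  \int[leb]_(x in (fun x => c * x + d) @^-1` D) f (c * x + d) =
  `|c|^-1 * \int[leb]_(x in D) f x.
Proof.
move=> c0 mD fi; rewrite /Rintegral integral_affine// fineM//.
exact: integrable_fin_num.
Qed.

End AffineChange.

(** * The fundamental theorem of calculus and integration by parts *)

Section RealTools.
Variable R : realType.
Notation leb := (@lebesgue_measure R).

Lemma continuous_integrable_itv (f : R -> R) (a b : R) :
  continuous f -> leb.-integrable `[a, b] (EFin \o f).
Proof.
move=> cf; apply: continuous_compact_integrable; first exact: segment_compact.
by apply: continuous_subspaceT.
Qed.

Lemma FTC_everywhere (F f : R -> R) (a b : R) : a <= b -> continuous f ->
  (forall t : R, is_derive t 1 F (f t)) ->
  \int[leb]_(t in `[a, b]) f t = F b - F a.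
Proof.
rewrite le_eqVlt => /predU1P[<- _ _|ab cf dF].
  by rewrite set_itv1 Rintegral_set1 subrr.
rewrite /Rintegral (@continuous_FTC2 _ f F)//.
- by apply: continuous_subspaceT.
- have cF : continuous F.
    by move=> t; apply: differentiable_continuous; apply/derivable1_diffP;
      case: (dF t).
  split.
  + by move=> t _; case: (dF t).
  + exact: cvg_at_right_filter (cF a).
  + exact: cvg_at_left_filter (cF b).
- by move=> t _; rewrite derive1E; apply: derive_val.
Qed.

Section IntegrationByParts.
Variables (h k H : R -> R).
Hypothesis ch : continuous h.
Hypothesis dH : forall t : R, is_derive t 1 H (h t).
Hypothesis ik : leb.-integrable `[0, 1] (EFin \o k).

Let I : set R := `[0, 1].
(** The product [h(t) k(s)] on the triangle [s <= t] of the unit square, extended by zero so that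
    Fubini applies on the whole plane. *)
Let FF (z : R * R) : R := (h \_ I) z.1 * ((k \_ I) z.2 * \1_[set w : R * R | w.2 <= w.1] z).

Let IE x : I x = (0 <= x <= 1) :> Prop. Proof. by rewrite /I /= in_itv. Qed.

Let mI : measurable I. Proof. exact: measurable_itv. Qed.

Let mle : measurable [set w : R * R | w.2 <= w.1].
Proof.
have : measurable_fun setT (fun w : R * R => w.2 <= w.1).
  by apply: measurable_fun_ler.
by move=> /(_ measurableT [set true]); rewrite setTI; exact.
Qed.

Let mhI : measurable_fun setT (h \_ I).
Proof.
apply/(measurable_restrictT _ mI); apply: measurable_funTS.
exact: continuous_measurable_fun.
Qed.

Let mkI : measurable_fun setT (k \_ I).
Proof.
by apply/(measurable_restrictT _ mI)/measurable_EFinP; exact: measurable_int ik.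
Qed.

Let mFF : measurable_fun setT (EFin \o FF).
Proof.
apply/measurable_EFinP; apply: measurable_funM.
  exact: (measurableT_comp mhI).
apply: measurable_funM; first exact: (measurableT_comp mkI).
exact: measurable_indic.
Qed.

Let FFI1 x y : FF (x, y) = (h \_ I) x * (k \_ (I `&` `]-oo, x])) y.
Proof.
rewrite /FF /= !patchE indicE in_setI; congr (_ * _).
have -> : ((x, y) \in [set w : R * R | w.2 <= w.1]) = (y \in `]-oo, x]%classic).
  by apply/idP/idP; rewrite !inE /=.
by case: (y \in I) => /=; case: (y \in _) => /=; rewrite ?mulr1 ?mulr0.
Qed.

Let FFI2 x y : FF (x, y) = (k \_ I) y * (h \_ (I `&` `[y, +oo[)) x.
Proof.
rewrite /FF /= !patchE indicE in_setI.
have -> : ((x, y) \in [set w : R * R | w.2 <= w.1]) = (x \in `[y, +oo[%classic).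
  by apply/idP/idP; rewrite !inE /= in_itv /= andbT.
case: (y \in I) => /=; case: (x \in I) => /=; case: (x \in _) => /=;
  by rewrite ?(mulr1, mulr0, mul0r)// mulrC.
Qed.

Let II x : I x -> I `&` `]-oo, x] = `[0, x]%classic.
Proof.
rewrite IE => /andP[x0 x1]; apply/seteqP; split => y /=; rewrite IE !in_itv/= ?andbT.
  by move=> [/andP[-> _] ->].
by move=> /andP[-> yx]; rewrite yx (le_trans yx x1).
Qed.

Let II2 x : I x -> I `&` `[x, +oo[ = `[x, 1]%classic.
Proof.
rewrite IE => /andP[x0 x1]; apply/seteqP; split => y /=; rewrite IE !in_itv/= ?andbT.
  by move=> [/andP[_ ->] ->].
by move=> /andP[xy y1]; rewrite xy y1 (le_trans x0 xy).
Qed.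

Let inner1 x : (\int[leb]_y (FF (x, y))%:E =
  ((fun t => h t * \int[leb]_(s in `[0%R, t]) k s)%R \_ I x)%:E)%E.
Proof.
under eq_integral do rewrite FFI1.
rewrite !patchE; case: ifPn => xI; last first.
  by under eq_integral do rewrite mul0r; rewrite integral0.
have Ix : I x by rewrite inE in xI.
have ikx : leb.-integrable `[0, x] (EFin \o k).
  by apply: integrableS ik => //; rewrite -II//; apply: subIsetl.
have ikx' : leb.-integrable setT (EFin \o (k \_ `[0, x])).
  by rewrite -restrict_EFin; exact: (integrable_mkcond _ _).1 ikx.
under eq_integral do rewrite II// EFinM.
rewrite integralZl//= EFinM; congr (_ * _)%E.
rewrite /Rintegral fineK; last exact: integrable_fin_num.
by rewrite [RHS]integral_mkcond restrict_EFin.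
Qed.

Let inner2 y : (\int[leb]_x (FF (x, y))%:E =
  ((fun t => k t * (H 1 - H t))%R \_ I y)%:E)%E.
Proof.
under eq_integral do rewrite FFI2.
rewrite !patchE; case: ifPn => yI; last first.
  by under eq_integral do rewrite mul0r; rewrite integral0.
have Iy : I y by rewrite inE in yI.
have y1 : y <= 1 by move: Iy; rewrite IE => /andP[].
have ihy : leb.-integrable `[y, 1] (EFin \o h).
  exact: continuous_integrable_itv.
have ihy' : leb.-integrable setT (EFin \o (h \_ `[y, 1])).
  by rewrite -restrict_EFin; exact: (integrable_mkcond _ _).1 ihy.
under eq_integral do rewrite II2// EFinM.
rewrite integralZl//= EFinM; congr (_ * _)%E.
rewrite -(FTC_everywhere y1 ch dH) /Rintegral fineK; last exact: integrable_fin_num.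
by rewrite [RHS]integral_mkcond restrict_EFin.
Qed.

Let iFF : ((leb \x leb)%E).-integrable setT (EFin \o FF).
Proof.
apply/integrable12ltyP => //=.
have ihI : leb.-integrable setT (EFin \o (h \_ I)).
  rewrite -restrict_EFin; apply: (integrable_mkcond _ _).1 => //.
  exact: continuous_integrable_itv.
have ikI : leb.-integrable setT (EFin \o (k \_ I)).
  by rewrite -restrict_EFin; apply: (integrable_mkcond _ _).1.
have /integrableP[_ hlt] := ihI; have /integrableP[_ klt] := ikI.
have k0 : (0 <= \int[leb]_y `|((k \_ I) y)%:E|)%E by exact: integral_ge0.
pose C := fine (\int[leb]_y `|((k \_ I) y)%:E|)%E.
have CE : (\int[leb]_y `|((k \_ I) y)%:E|)%E = C%:E.
  by rewrite /C fineK// ge0_fin_numE.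
have mabs : measurable_fun setT (fun z => `|(FF z)%:E|%E) by exact: measurableT_comp.
apply: (@le_lt_trans _ _ (\int[leb]_x (C%:E * `|((h \_ I) x)%:E|))%E).
  apply: ge0_le_integral => //.
  - by move=> x _; exact: integral_ge0.
  - have abs0 z : (0 <= `|(FF z)%:E|)%E by [].
    have Fm := @measurable_fun_fubini_tonelli_F _ _ (measurableTypeR R) (measurableTypeR R) R leb _ mabs abs0.
    exact Fm.
  - by apply: measurable_funeM; apply: measurableT_comp => //; exact: measurable_int ihI.
  move=> x _; rewrite -CE muleC -ge0_integralZl//; last first.
    by apply: measurableT_comp => //; exact: measurable_int ikI.
  apply: ge0_le_integral => //.
  - exact (measurable_fun_pair2 x mabs).
  - by apply: measurable_funeM; apply: measurableT_comp => //; exact: measurable_int ikI.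
  move=> y _; rewrite /FF/= -EFinM lee_fin !normrM ler_wpM2l// ler_piMr//.
  by rewrite indicE; case: (_ \in _); rewrite ?normr1 ?normr0.
rewrite ge0_integralZl//; last 2 first.
  - by apply: measurableT_comp => //; exact: measurable_int ihI.
  - by rewrite -CE.
by rewrite lte_mul_pinfty// -CE.
Qed.

(** [k] is only integrable, so its primitive need not be differentiable everywhere. Both sides are
    iterated integrals of [FF], in the two orders of integration. *)
Lemma Rintegration_by_parts_primitive :
  \int[leb]_(t in `[0, 1]) (h t * \int[leb]_(s in `[0, t]) k s) =
  \int[leb]_(t in `[0, 1]) (k t * (H 1 - H t)).
Proof.
have := Fubini iFF; rewrite /= => E.
rewrite /Rintegral integral_mkcond [in RHS]integral_mkcond; congr fine.
transitivity (\int[leb]_x \int[leb]_y (FF (x, y))%:E)%E.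
  by apply: eq_integral => x _; rewrite inner1 restrict_EFin.
by rewrite E; apply: eq_integral => x _; rewrite inner2 restrict_EFin.
Qed.

End IntegrationByParts.
End RealTools.

(** * Functions flat at the origin *)

Section Bump.
Variable R : realType.
Notation leb := (@lebesgue_measure R).

(* The derivative of [p (1/x) exp (- 1/x)] is again of this form. *)
Definition flat (p : {poly R}) (x : R) : R :=
  if 0 < x then p.[x^-1] * expR (- x^-1) else 0.

(** Each monomial [y^i] is at most [i! * expR y], by the exponential series. *)
Lemma horner_le_expR (p : {poly R}) :
  exists2 C, 0 <= C & forall y, 0 <= y -> `|p.[y]| <= C * expR y.
Proof.
elim/poly_ind: p => [|p c _].
  by exists 0 => // y _; rewrite horner0 normr0 mul0r.
move: (p * 'X + c%:P) => {p c} p.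
exists (\sum_(i < size p) `|p`_i| * i`!%:R) => [|y y0].
  by apply: sumr_ge0 => i _; rewrite mulr_ge0.
rewrite horner_coef mulr_suml (le_trans (ler_norm_sum _ _ _))//.
apply: ler_sum => -[i /= _] _.
rewrite normrM -mulrA ler_wpM2l// ger0_norm ?exprn_ge0//.
case: i => [|i].
  by rewrite expr0 fact0 mul1r; apply: le_trans (expR_ge1Dx _); rewrite lerDl.
rewrite mulrC -ler_pdivrMr ?ltr0n ?fact_gt0//.
by apply: le_trans (expR_ge1Dxn i y0); rewrite lerDr.
Qed.

(** The bound on [p * 'X^2] at [1 / x] leaves a factor [x^2], which forces derivative 0 at the
    origin. *)
Lemma flat_quadratic p :
  exists2 C, 0 <= C & forall x, `|flat p x| <= C * x ^+ 2.
Proof.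
have [C C0 hC] := horner_le_expR (p * 'X ^+ 2).
exists C => // x; rewrite /flat; case: ifPn => x0; last first.
  by rewrite normr0 mulr_ge0// sqr_ge0.
have y0 : 0 <= x^-1 by rewrite invr_ge0 ltW.
have := hC _ y0; rewrite hornerM hornerXn !normrM expRN.
rewrite [`|(expR _)^-1|]ger0_norm ?invr_ge0 ?expR_ge0// [`|x^-1|]ger0_norm//.
by rewrite -expr2 exprVn ler_pdivrMr ?exprn_gt0// ler_pdivrMr ?expR_gt0// mulrAC.
Qed.

Lemma is_derive_flat p (x : R) :
  is_derive x 1 (flat p) (flat ('X ^+ 2 * (p - p^`())) x).
Proof.
case: (ltgtP x 0) => x0.
- rewrite [X in is_derive _ _ _ X]/flat ifN -?leNgt ?ltW//.
  apply: near_eq_is_derive (is_derive_cst _ _ _); near=> y.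
  by rewrite /flat ifN// -leNgt ltW//; near: y; exact: lt_nbhsl.
- pose g y := p.[y^-1] * expR (- y^-1).
  apply: (@near_eq_is_derive _ _ _ g).
    by near=> y; rewrite /flat ifT//; near: y; exact: lt_nbhsr.
  have dV : is_derive x 1 (fun y : R => y^-1) (- x ^- 2).
    have := is_deriveV (f := id) (lt0r_neq0 x0) (is_derive_id x 1).
    by rewrite /GRing.scale/= mulr1.
  have dp : is_derive x 1 (fun y => p.[y^-1]) (p^`().[x^-1] * (- x ^- 2)).
    exact: is_derive1_comp.
  have de : is_derive x 1 (fun y => expR (- y^-1)) (expR (- x^-1) * (x ^- 2)).
    apply: (@is_derive1_comp _ expR (fun y => - y^-1)).
    by rewrite -[X in is_derive _ _ _ X]opprK; exact: is_deriveN.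
  apply: (is_derive_eq (is_deriveM dp de)).
  have scaleE (a b : R) : a *: (b : R^o) = a * b by [].
  rewrite /flat x0 !scaleE !hornerE exprVn /=; ring.
- rewrite x0 [X in is_derive _ _ _ X]/flat ltxx.
  have [C C0 hC] := flat_quadratic p.
  (* At the origin the slope [flat p z / z] is bounded by [C * |z|], hence tends to 0. *)
  apply/is_derive1_caratheodory; exists (fun z => flat p z / z).
  have f0 : flat p 0 = 0 by rewrite /flat ltxx.
  split => [z||]; last by rewrite f0 mul0r.
    rewrite f0 !subr0; have [->|z0] := eqVneq z 0; first by rewrite f0 mulr0.
    by rewrite divfK.
  suff : flat p z / z @[z --> (0:R)] --> (0:R) by rewrite /prop_for /continuous_at f0 mul0r.
  have : C * `|z| @[z --> (0:R)] --> 0.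
    rewrite -[X in _ --> X](mulr0 C); apply: cvgMr.
    by rewrite -[X in _ --> X](normr0 R); apply: cvg_norm.
  move=> /cvgrPdist_le hl; apply/cvgrPdist_le => e e0.
  apply: filterS (hl e e0) => z; rewrite !sub0r !normrN => hz.
  have [->|z0] := eqVneq z 0; first by rewrite f0 mul0r normr0 ltW.
  apply: le_trans hz; rewrite [leRHS]ger0_norm ?mulr_ge0// normrM normfV ler_pdivrMr ?normr_gt0//.
  by rewrite -mulrA -expr2 real_normK ?num_real.
Unshelve. all: by end_near. Qed.

End Bump.

(** * Smooth bumps and averages against them *)

Section DuBoisReymond.
Variable R : realType.
Notation leb := (@lebesgue_measure R).

(** A syntactic class closed under derivation: derivability to every order then follows by a plain
    induction, without Leibniz formulas for iterated derivatives. *)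
Inductive smooth_expr : (R -> R) -> Prop :=
| SmoothFlat p : smooth_expr (flat p)
| SmoothCst c : smooth_expr (fun=> c)
| SmoothD f g : smooth_expr f -> smooth_expr g -> smooth_expr (fun x => f x + g x)
| SmoothM f g : smooth_expr f -> smooth_expr g -> smooth_expr (fun x => f x * g x)
| SmoothA f a b : smooth_expr f -> smooth_expr (fun x => f (a * x + b)).

Lemma smooth_expr_derive f : smooth_expr f ->
  exists2 g, smooth_expr g & forall t : R, is_derive t 1 f (g t).
Proof.
elim=> {f} [p|c|f g _ [f' sf df] _ [g' sg dg]|f g hf [f' sf df] hg [g' sg dg]|f a b _ [f' sf df]].
- by exists (flat ('X ^+ 2 * (p - p^`()))) => [|t]; [exact: SmoothFlat|exact: is_derive_flat].
- by exists (fun=> 0) => [|t]; [exact: SmoothCst|exact: is_derive_cst].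
- by exists (fun x => f' x + g' x) => [|t]; [exact: SmoothD|exact: is_deriveD].
- exists (fun x => f x * g' x + g x * f' x) => [|t]; last exact: is_deriveM.
  by apply: SmoothD; apply: SmoothM.
- exists (fun x => f' (a * x + b) * a) => [|t].
    by apply: SmoothM; [exact: SmoothA|exact: SmoothCst].
  have daff : is_derive t 1 (fun x : R => a * x + b) a.
    have := is_deriveD (is_deriveZ a (is_derive_id t (1 : R))) (is_derive_cst b t 1).
    by rewrite /GRing.scale/= mulr1 addr0.
  exact: (@is_derive1_comp _ f _ t _ _ (df _) daff).
Qed.

Lemma smooth_expr_derivable f : smooth_expr f ->
  forall k (t : R), derivable (derive1n k f) t 1.
Proof.
move=> sf k; suff : smooth_expr (derive1n k f).
  by move=> /smooth_expr_derive[g _ dg] t; case: (dg t).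
elim: k => // k /smooth_expr_derive[g sg dg]; rewrite derive1nS.
suff -> : derive1 (derive1n k f) = g by [].
by apply/funext => t; rewrite derive1E; apply: derive_val.
Qed.

Lemma smooth_expr_continuous f : smooth_expr f -> continuous f.
Proof.
move=> /smooth_expr_derive[g _ dg] t; apply: differentiable_continuous.
by apply/derivable1_diffP; case: (dg t).
Qed.

(** A bump on []a, b[]; the arguments are spelled [1 * x - a] and [-1 * x + b] so as to be instances
    of [SmoothA]. *)
Definition cbump (a b x : R) : R := flat 1 (1 * x - a) * flat 1 (-1 * x + b).

Lemma cbump_smooth a b : smooth_expr (cbump a b).
Proof. by apply: SmoothM; apply: SmoothA; exact: SmoothFlat. Qed.

Lemma flat1_ge0 (x : R) : 0 <= flat 1 x.
Proof. by rewrite /flat; case: ifP => // _; rewrite hornerC mul1r expR_ge0. Qed.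

Lemma cbump_ge0 a b x : 0 <= cbump a b x.
Proof. by rewrite mulr_ge0 ?flat1_ge0. Qed.

Lemma cbump_out a b x : x \notin `]a, b[ -> cbump a b x = 0.
Proof.
rewrite in_itv/= negb_and -!leNgt /cbump /flat !mul1r mulN1r => /orP[xa|bx].
  by rewrite ifN ?mul0r// -leNgt subr_le0.
by rewrite [X in _ * X]ifN ?mulr0// -leNgt addrC subr_le0.
Qed.

Lemma flat1_le (x y : R) : x <= y -> flat 1 x <= flat 1 y.
Proof.
move=> xy; rewrite {1}/flat; case: ifPn => x0; last exact: flat1_ge0.
rewrite /flat (lt_le_trans x0 xy) !hornerC !mul1r ler_expR lerN2 lef_pV2//.
by rewrite posrE (lt_le_trans x0 xy).
Qed.

Lemma cbump_integral_gt0 (a b : R) : 0 <= a -> a < b -> b <= 1 ->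
  0 < \int[leb]_(x in `[0, 1]) cbump a b x.
Proof.
(* On the middle third both factors of the bump are at least [flat 1 w], which is positive. *)
move=> a0 ab b1; pose w := (b - a) / 3.
have w0 : 0 < w by rewrite divr_gt0// subr_gt0.
pose J : set R := `[a + w, b - w]%classic.
have cb := smooth_expr_continuous (cbump_smooth a b).
apply: (@lt_le_trans _ _ (\int[leb]_(x in J) (flat 1 w * flat 1 w))).
  rewrite Rintegral_cst//; last exact: measurable_itv.
  rewrite /J /= lebesgue_measure_itv/= lte_fin.
  have wE : b - w - (a + w) = w by rewrite /w; field.
  have -> : a + w < b - w by rewrite -subr_gt0 wE.
  have fw : 0 < flat 1 w by rewrite /flat w0 hornerC mul1r expR_gt0.
  rewrite -EFinB wE /=.
  by apply: mulr_gt0 => //; exact: mulr_gt0.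
have mI : measurable (`[0, 1]%classic : set (measurableTypeR R)) by exact: measurable_itv.
have mJ : measurable (J : set (measurableTypeR R)) by exact: measurable_itv.
have JI : J `<=` `[0, 1].
  move=> x; rewrite /J /= !in_itv/= => /andP[x1 x2]; apply/andP; split.
    by apply: le_trans x1; rewrite addr_ge0// ltW.
  by apply: le_trans x2 _; rewrite (le_trans _ b1)// gerBl ltW.
apply: (@le_trans _ _ (\int[leb]_(x in J) cbump a b x)).
  apply: le_Rintegral => //.
  - exact: (continuous_integrable_itv _ _ (@cst_continuous _ _ _)).
  - exact: continuous_integrable_itv.
  move=> x; rewrite /J /= in_itv/= => /andP[x1 x2].
  rewrite /cbump mul1r mulN1r ler_pM ?flat1_ge0// flat1_le//.
    by rewrite lerBrDr addrC.
  by rewrite addrC lerBrDr addrC -lerBrDr.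
rewrite /Rintegral fine_le//.
- by apply: integrable_fin_num => //; exact: continuous_integrable_itv.
- by apply: integrable_fin_num => //; exact: continuous_integrable_itv.
apply: ge0_subset_integral => //.
- apply/measurable_EFinP; apply: measurable_funTS; exact: continuous_measurable_fun.
- by move=> x _; rewrite lee_fin cbump_ge0.
Qed.

Lemma cbump_average (F : R -> R) (s c d e : R) : 0 <= c -> c < d -> d <= 1 ->
  {within `[0, 1], continuous F} ->
  (forall x, x \in `[c, d] -> `|F x - F s| <= e) ->
  `|(\int[leb]_(x in `[0, 1]) cbump c d x)^-1 *
    \int[leb]_(x in `[0, 1]) (cbump c d x * F x) - F s| <= e.
Proof.
move=> c0 cd d1 cF hF; set A := \int[leb]_(x in _) cbump c d x.
have A0 : 0 < A by exact: cbump_integral_gt0.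
have cb := smooth_expr_continuous (cbump_smooth c d).
have mI : measurable (`[0, 1]%classic : set (measurableTypeR R)) by exact: measurable_itv.
have ib : leb.-integrable `[0, 1] (EFin \o cbump c d) by exact: continuous_integrable_itv.
have ibF : leb.-integrable `[0, 1] (EFin \o (fun x => cbump c d x * F x)).
  apply: continuous_compact_integrable; first exact: segment_compact.
  move=> x; apply: cvgM; last exact: cF.
  exact: (continuous_subspaceT cb).
have -> : A^-1 * \int[leb]_(x in `[0, 1]) (cbump c d x * F x) - F s =
    A^-1 * \int[leb]_(x in `[0, 1]) (cbump c d x * F x - cbump c d x * F s).
  rewrite RintegralB//; last first.
    apply: continuous_integrable_itv => x; apply: cvgMl; exact: cb.
  by rewrite RintegralZr// mulrBr mulrA mulVf ?gt_eqF// mul1r.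
rewrite normrM gtr0_norm ?invr_gt0// mulrC ler_pdivrMr//.
have ibB : leb.-integrable `[0, 1]
    (EFin \o (fun x => cbump c d x * F x - cbump c d x * F s)).
  have := integrableB mI ibF (integrableZr mI (F s) ib).
  by apply: eq_integrable => // x _ /=; rewrite EFinB EFinM.
apply: (le_trans (le_normr_Rintegral mI ibB)).
rewrite mulrC -RintegralZr//; apply: le_Rintegral => //.
- exact: (integrable_norm ibB).
- have := integrableZr mI e ib.
  by apply: eq_integrable => // x _ /=; rewrite EFinM.
move=> x _; rewrite -mulrBr normrM ger0_norm ?cbump_ge0//.
have [xcd|xcd] := boolP (x \in `]c, d[); last by rewrite cbump_out ?mul0r.
by rewrite ler_wpM2l ?cbump_ge0// hF//; apply: subset_itv_oo_cc.
Qed.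

End DuBoisReymond.

(** * From the distributional to the integral form of an equation *)

Section WeakStrong.
Variable R : realType.
Notation leb := (@lebesgue_measure R).

Lemma Rintegral_eq0 (D : set R) (f : R -> R) :
  (forall x, D x -> f x = 0) -> \int[leb]_(x in D) f x = 0.
Proof.
move=> f0; rewrite /Rintegral (eq_integral (cst 0%E)) ?integral0// => x.
by rewrite inE => /f0 ->.
Qed.

Lemma integrable_mulr (D : set (measurableTypeR R)) (f : R -> R) (r : R) :
  measurable D -> leb.-integrable D (EFin \o f) ->
  leb.-integrable D (EFin \o (fun x => r * f x)).
Proof.
by move=> mD /(integrableZl mD r); apply: eq_integrable.
Qed.

Lemma integrable_continuousM (g F : R -> R) : continuous g ->
  {within `[0, 1], continuous F} ->
  leb.-integrable `[0, 1] (EFin \o (fun x => g x * F x)).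
Proof.
move=> cg cF; apply: continuous_compact_integrable; first exact: segment_compact.
have cg' : {within `[0, 1], continuous g} by exact: continuous_subspaceT.
by move=> x; apply: cvgM; [exact: cg'|exact: cF].
Qed.

(** Zero mean makes the primitive vanish to the right of the support of [h]. To the left it vanishes
    because [h] does, or because [[0, x]] is empty when [x < 0]. *)
Lemma primitive_test_function (h : R -> R) (a b : R) :
  smooth_expr h -> 0 < a -> a <= b -> b < 1 ->
  (forall t, t \notin `[a, b] -> h t = 0) ->
  \int[leb]_(t in `[0, 1]) h t = 0 ->
  exists2 phi : R -> R, test_function phi & derive1 phi = h.
Proof.
move=> sh a0 ab b1 h0 ih; pose phi x := \int[leb]_(t in `[0, x]) h t.
have ch := smooth_expr_continuous sh.
have phil x : x < a -> phi x = 0.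
  move=> xa; apply: Rintegral_eq0 => t /=; rewrite in_itv/= => /andP[_ tx].
  by apply: h0; rewrite in_itv/= negb_and -ltNge (le_lt_trans tx xa).
have phir x : b < x -> phi x = 0.
  have itail u v : b <= u -> \int[leb]_(t in `]u, v]) h t = 0.
    move=> bu; apply: Rintegral_eq0 => t /=; rewrite in_itv/= => /andP[ut _].
    by apply: h0; rewrite in_itv/= negb_and -!ltNge (le_lt_trans bu ut) orbT.
  move=> bx; rewrite /phi; have [x1|/ltW x1] := leP x 1.
    have := @Rintegral_itvB _ h (BLeft 0) (BRight 1) x (continuous_integrable_itv _ _ ch).
    rewrite ih !bnd_simp itail ?(ltW bx)// => /(_ _ _)/eqP.
    by rewrite sub0r oppr_eq0 => /(_ _ _)/eqP ->//; rewrite ?x1// ltW// (lt_trans a0)// (le_lt_trans ab).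
  have := @Rintegral_itvB _ h (BLeft 0) (BRight x) 1 (continuous_integrable_itv _ _ ch).
  by rewrite ih !bnd_simp itail ?(ltW b1)// subr0; apply; rewrite ?x1.
have dphi (x : R) : is_derive x 1 phi (h x).
  have [xa|ax] := ltP x a.
    rewrite h0; last by rewrite in_itv/= negb_and -ltNge xa.
    apply: near_eq_is_derive (is_derive_cst _ _ _); near=> y.
    by rewrite phil//; near: y; exact: lt_nbhsl.
  have x0 : 0 < x by exact: lt_le_trans ax.
  have xx1 : x < x + 1 by rewrite ltrDl.
  have [dx <-] := continuous_FTC1_closed xx1 (continuous_integrable_itv _ _ ch) x0 (ch x).
  by rewrite derive1E; exact: DeriveDef.
have d1 : derive1 phi = h by apply/funext => x; rewrite derive1E; apply: derive_val.
exists phi => //; split => [[|k] t|].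
- by rewrite derive1n0; case: (dphi t).
- by rewrite derive1Sn d1; exact: smooth_expr_derivable.
exists (a / 2), ((b + 1) / 2); split; [lra|lra|move=> t].
rewrite in_itv/= negb_and -!ltNge => /orP[ta|bt].
  by apply: phil; lra.
by apply: phir; lra.
Unshelve. all: by end_near. Qed.

(** The interval [[c, d]] need not contain [s]: bumps have to be supported in the open unit
    interval, while [s] may be an endpoint. *)
Lemma within_continuous_itv_approx (F : R -> R) (s e : R) :
  {within `[0, 1], continuous F} -> s \in `[0, 1] -> 0 < e ->
  exists c d : R, [/\ 0 < c, c < d, d < 1 & forall x : R, x \in `[c, d] -> `|F x - F s| <= e].
Proof.
move=> /subspace_continuousP cF; rewrite in_itv/= => /andP[s0 s1] e0.
have := cF s; rewrite /= in_itv/= s0 s1 => /(_ isT) /cvgrPdist_le /(_ e e0).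
rewrite /within /= => /nbhs_ballP [d /= d0 hd].
pose lo := Num.max 0 (s - d); pose hi := Num.min 1 (s + d).
have lohi : lo < hi.
  rewrite /lo /hi gt_max !lt_min; apply/andP; split; apply/andP; split; lra.
have [lo0 lod] : 0 <= lo /\ s - d <= lo by rewrite /lo !le_max !lexx orbT.
have [hi0 hid] : hi <= 1 /\ hi <= s + d by rewrite /hi !ge_min !lexx orbT.
exists ((2 * lo + hi) / 3), ((lo + 2 * hi) / 3); split; [lra|lra|lra|move=> x].
rewrite in_itv/= => /andP[x1 x2]; rewrite distrC; apply: hd.
  by rewrite /ball /= ltr_norml; apply/andP; split; lra.
by rewrite in_itv/=; apply/andP; split; lra.
Qed.

(** The difference of two normalized bumps has zero mean, hence is the derivative of a test
    function; so the averages of [F] near [s] and near [t] agree. *)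
Lemma du_bois_reymond (F : R -> R) :
  {within `[0, 1], continuous F} ->
  (forall phi, test_function phi -> \int[leb]_(t in `[0, 1]) (derive1 phi t * F t) = 0) ->
  forall s t : R, s \in `[0, 1] -> t \in `[0, 1] -> F s = F t.
Proof.
move=> cF hF s t s01 t01; apply/eqP; rewrite -subr_eq0 -normr_le0.
apply/ler_addgt0Pl => e e0; rewrite addr0.
have e20 : 0 < e / 2 by rewrite divr_gt0.
have [c1 [d1 [c10 cd1 d11 h1]]] := within_continuous_itv_approx cF s01 e20.
have [c2 [d2 [c20 cd2 d21 h2]]] := within_continuous_itv_approx cF t01 e20.
have := cbump_average (ltW c10) cd1 (ltW d11) cF h1.
have := cbump_average (ltW c20) cd2 (ltW d21) cF h2.
have := cbump_integral_gt0 (ltW c10) cd1 (ltW d11).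
have := cbump_integral_gt0 (ltW c20) cd2 (ltW d21).
set A1 := \int[leb]_(x in _) cbump c1 d1 x; set A2 := \int[leb]_(x in _) cbump c2 d2 x.
move=> A20 A10.
have icont (g : R -> R) : continuous g -> leb.-integrable `[0, 1] (EFin \o g).
  exact: continuous_integrable_itv.
have cb1 := smooth_expr_continuous (cbump_smooth c1 d1).
have cb2 := smooth_expr_continuous (cbump_smooth c2 d2).
have icF (g : R -> R) : continuous g -> leb.-integrable `[0, 1] (EFin \o (fun x => g x * F x)).
  by move=> cg; exact: integrable_continuousM.
pose h x := A1^-1 * cbump c1 d1 x + (- A2^-1) * cbump c2 d2 x.
have sh : smooth_expr h.
  by apply: SmoothD; apply: SmoothM (SmoothCst _) (cbump_smooth _ _).
have ih : \int[leb]_(x in `[0, 1]) h x = 0.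
  rewrite /h RintegralD//; [|by apply: integrable_mulr => //; exact: icont..].
  by rewrite !RintegralZl// ?icont// mulNr !mulVf ?gt_eqF// subrr.
have [phi tphi dphi] : exists2 phi, test_function phi & derive1 phi = h.
  apply: (@primitive_test_function h (Num.min c1 c2) (Num.max d1 d2)) => //.
  - by rewrite lt_min c10.
  - by rewrite ge_min !le_max (ltW cd1).
  - by rewrite gt_max d11.
  move=> x; rewrite in_itv/= negb_and -!ltNge lt_min gt_max => xo.
  have [] : (x \notin `]c1, d1[) /\ (x \notin `]c2, d2[).
    rewrite !in_itv/= !negb_and -!leNgt.
    by case/orP: xo => /andP[/ltW -> /ltW ->]; rewrite ?orbT.
  by move=> ? ?; rewrite /h !cbump_out// !mulr0 addr0.
have mI : measurable (`[0, 1]%classic : set (measurableTypeR R)) by exact: measurable_itv.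
have := hF phi tphi; rewrite dphi.
have -> : \int[leb]_(x in `[0, 1]) (h x * F x) =
    A1^-1 * \int[leb]_(x in `[0, 1]) (cbump c1 d1 x * F x) -
    A2^-1 * \int[leb]_(x in `[0, 1]) (cbump c2 d2 x * F x).
  rewrite -!RintegralZl//; [|exact: icF..].
  rewrite -RintegralB//; [|by apply: integrable_mulr => //; exact: icF..].
  by apply: eq_Rintegral => x _; rewrite /h; ring.
set u := A1^-1 * _; set v := A2^-1 * _ => /eqP; rewrite subr_eq0 => /eqP uv hv hu.
have -> : F s - F t = (v - F t) - (u - F s) by rewrite uv; ring.
by rewrite (le_trans (ler_normB _ _))// (le_trans (lerD hv hu))// -splitr.
Qed.

Lemma integral_primitive_continuous (g : R -> R) :
  leb.-integrable `[0, 1] (EFin \o g) ->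
  {within `[0, 1], continuous (fun x => \int[leb]_(t in `[0, x]) g t)}.
Proof. exact: parameterized_integral_continuous. Qed.

Lemma test_function_primitive_parts (phi g : R -> R) : test_function phi ->
  leb.-integrable `[0, 1] (EFin \o g) ->
  \int[leb]_(t in `[0, 1]) (derive1 phi t * \int[leb]_(s in `[0, t]) g s) =
  - \int[leb]_(t in `[0, 1]) (phi t * g t).
Proof.
move=> [dphi [a [b [a0 b1 phi0]]]] ig.
have dphi1 (t : R) : is_derive t 1 phi (derive1 phi t).
  by rewrite derive1E; apply/derivableP; exact: (dphi 0).
have cphi' : continuous (derive1 phi).
  move=> t; apply: differentiable_continuous; apply/derivable1_diffP.
  exact: (dphi 1 t).
have cphi : continuous phi.
  move=> t; apply: differentiable_continuous; apply/derivable1_diffP.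
  exact: (dphi 0 t).
have mI : measurable (`[0, 1]%classic : set (measurableTypeR R)) by exact: measurable_itv.
rewrite (Rintegration_by_parts_primitive cphi' dphi1 ig) phi0; last first.
  by rewrite in_itv/= negb_and -!ltNge b1 orbT.
rewrite -mulN1r -RintegralZl//; first by apply: eq_Rintegral => t _; ring.
have : leb.-integrable `[0, 1] ((EFin \o phi) \* (EFin \o g))%E.
  apply: integrableMr => //; first by apply: measurable_funTS; exact: continuous_measurable_fun.
  have /compact_bounded : compact (phi @` `[0, 1]).
    apply: continuous_compact; last exact: segment_compact.
    exact: continuous_subspaceT.
  move=> [M [Mr hM]]; exists M; split => // x Mx y Iy; apply: (hM x Mx); by exists y.
by apply: eq_integrable => // x _ /=; rewrite EFinM.
Qed.

(** [f] plus the primitive of [g] has zero distributional derivative, hence is constant. The sign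
    makes [- g] the derivative of [f], as in the continuity equation. *)
Lemma weak_derivativeP (f g : R -> R) :
  {within `[0, 1], continuous f} -> leb.-integrable `[0, 1] (EFin \o g) ->
  (forall phi, test_function phi ->
    \int[leb]_(t in `[0, 1]) (derive1 phi t * f t) =
    \int[leb]_(t in `[0, 1]) (phi t * g t)) <->
  (forall t : R, t \in `[0, 1] -> f t = f 0 - \int[leb]_(s in `[0, t]) g s).
Proof.
move=> cf ig.
have mI : measurable (`[0, 1]%classic : set (measurableTypeR R)) by exact: measurable_itv.
pose G x := \int[leb]_(t in `[0, x]) g t.
have cG := integral_primitive_continuous ig.
have ipc phi (F : R -> R) : test_function phi -> {within `[0, 1], continuous F} ->
    leb.-integrable `[0, 1] (EFin \o (fun x => derive1 phi x * F x)).
  move=> [dphi _] cF; apply: integrable_continuousM => // t.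
  apply: differentiable_continuous; apply/derivable1_diffP; exact: (dphi 1 t).
split=> [weak t t01|strong phi tphi].
- have : f t + G t = f 0 + G 0.
    apply: (@du_bois_reymond (fun x => f x + G x)) => //.
    + by move=> x; apply: cvgD; [exact: cf|exact: cG].
    + move=> phi tphi; under eq_Rintegral do rewrite mulrDr.
      rewrite RintegralD//; [|exact: ipc..].
      by rewrite (test_function_primitive_parts tphi ig) weak// subrr.
    + by rewrite in_itv/= lexx ler01.
  rewrite {2}/G set_itv1 Rintegral_set1 addr0 => <-; rewrite /G addrK//.
- transitivity (\int[leb]_(t in `[0, 1]) (derive1 phi t * f 0 - derive1 phi t * G t)).
    by apply: eq_Rintegral => t /[!inE] t01; rewrite strong// mulrBr.
  rewrite RintegralB//; last 2 first.
    by apply: ipc => //; apply: continuous_subspaceT; exact: cst_continuous.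
    exact: ipc.
  rewrite (test_function_primitive_parts tphi ig) opprK.
  suff -> : \int[leb]_(t in `[0, 1]) (derive1 phi t * f 0) = 0 by rewrite add0r.
  move: tphi => [dphi [a [b [a0 b1 phi0]]]].
  have cphi' : continuous (derive1 phi).
    move=> t; apply: differentiable_continuous; apply/derivable1_diffP.
    exact: (dphi 1 t).
  rewrite RintegralZr//; last exact: continuous_integrable_itv.
  have dphi1 (t : R) : is_derive t 1 phi (derive1 phi t).
    by rewrite derive1E; apply/derivableP; exact: (dphi 0).
  rewrite (FTC_everywhere ler01 cphi' dphi1).
  by rewrite !phi0 ?subrr ?mul0r// in_itv/= negb_and -!ltNge ?b1 ?a0 ?orbT.
Qed.

End WeakStrong.

(** * Weights and the Dirichlet form *)

Section LogMean.
Variable R : realType.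
Notation leb := (@lebesgue_measure R).

Lemma measurable_powR2 d (T : measurableType d) (u v : T -> R) :
  measurable_fun setT u -> measurable_fun setT v ->
  measurable_fun setT (fun z => u z `^ v z).
Proof.
move=> mu mv; apply: measurable_fun_ifT.
- exact: measurable_fun_eqr.
- have -> : (fun x => (v x == 0)%:R) = (fun x => if v x == 0 then 1 else 0 : R).
    by apply/funext => x; case: eqP.
  by apply: measurable_fun_ifT => //; exact: measurable_fun_eqr.
- apply: measurableT_comp => //; apply: measurable_funM => //.
  exact: measurableT_comp.
Qed.

Let lm (a b s : R) : R := a `^ (1 - s) * b `^ s.

Let mlm a b : measurable_fun setT (lm a b).
Proof.
apply: measurable_funM; apply: measurable_powR2 => //.
exact: measurable_funB.
Qed.

Let lm_ge0 a b s : 0 <= lm a b s.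
Proof. by rewrite mulr_ge0 ?powR_ge0. Qed.

Let lm_le a b a' b' s : s \in `[0, 1] -> 0 <= a -> 0 <= b -> a <= a' -> b <= b' ->
  lm a b s <= lm a' b' s.
Proof.
rewrite in_itv/= => /andP[s0 s1] a0 b0 aa' bb'.
rewrite ler_pM ?powR_ge0// ge0_ler_powR// ?subr_ge0// nnegrE//.
  exact: le_trans aa'.
exact: le_trans bb'.
Qed.

Let lm_diag c s : 0 <= c -> lm c c s = c.
Proof. by move=> c0; rewrite /lm -powRD ?subrK ?oner_eq0// powRr1. Qed.

Let mI : measurable (`[0, 1]%classic : set (measurableTypeR R)).
Proof. exact: measurable_itv. Qed.

Let lm_bound a b s : s \in `[0, 1] -> 0 <= a -> 0 <= b -> lm a b s <= a + b.
Proof.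
move=> s01 a0 b0; rewrite -[leRHS](lm_diag s) ?addr_ge0//.
by apply: lm_le; rewrite // ?lerDl ?lerDr.
Qed.

Let ilm a b : 0 <= a -> 0 <= b -> leb.-integrable `[0, 1] (EFin \o lm a b).
Proof.
move=> a0 b0; apply: measurable_bounded_integrable => //.
- by rewrite /= lebesgue_measure_itv/= lte_fin ltr01 -EFinB ltry.
- by apply: measurable_funTS; exact: mlm.
exists (a + b); split; first exact: num_real.
move=> x abx s /= s01; rewrite ger0_norm// (le_trans _ (ltW abx))//.
exact: lm_bound.
Qed.

Let int_cst (c : R) : \int[leb]_(s in `[0, 1]) c = c.
Proof.
rewrite Rintegral_cst//.
by rewrite /= lebesgue_measure_itv/= lte_fin ltr01 -EFinB/= subr0 mulr1.
Qed.

Lemma log_mean_ge0 (a b : R) : 0 <= log_mean a b.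
Proof. by apply: Rintegral_ge0 => s _; exact: lm_ge0. Qed.

Lemma log_mean_le (a b a' b' : R) : 0 <= a -> 0 <= b -> a <= a' -> b <= b' ->
  log_mean a b <= log_mean a' b'.
Proof.
move=> a0 b0 aa' bb'; apply: le_Rintegral => //.
- exact: ilm.
- by apply: ilm; rewrite (le_trans _ aa', le_trans _ bb').
- by move=> s s01; exact: lm_le.
Qed.

Lemma log_mean_diag (c : R) : 0 <= c -> log_mean c c = c.
Proof.
move=> c0; rewrite -[RHS]int_cst; apply: eq_Rintegral => s _; exact: lm_diag.
Qed.

Lemma log_mean_le_add (a b : R) : 0 <= a -> 0 <= b -> log_mean a b <= a + b.
Proof.
move=> a0 b0; rewrite -[leRHS]log_mean_diag ?addr_ge0//.
by apply: log_mean_le; rewrite // ?lerDl ?lerDr.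
Qed.

Lemma log_meanZ (c a b : R) : 0 <= c -> 0 <= a -> 0 <= b ->
  log_mean (c * a) (c * b) = c * log_mean a b.
Proof.
move=> c0 a0 b0; rewrite /log_mean -RintegralZl//; last exact: ilm.
apply: eq_Rintegral => s _; rewrite !powRM//.
by rewrite -[in RHS](lm_diag s c0) /lm mulrACA.
Qed.

Let lm_exp a b s : 0 < a -> 0 < b -> lm a b s = expR (ln a + s * (ln b - ln a)).
Proof.
move=> a0 b0; rewrite /lm /powR !gt_eqF// -expRD; congr expR; ring.
Qed.

(** The closed form of the logarithmic mean, multiplied out so that [a = b] is no exception. The
    integrand is the exponential of an affine function. *)
Lemma log_mean_mul_lnB (a b : R) : 0 < a -> 0 < b ->
  log_mean a b * (ln a - ln b) = a - b.
Proof.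
move=> a0 b0; set r := ln b - ln a.
pose F s := expR (ln a + s * r).
have dF (s : R) : is_derive s 1 F (F s * r).
  have daff : is_derive s 1 (fun x : R => ln a + x * r) r.
    have := is_deriveD (is_derive_cst (ln a) s 1)
      (is_deriveM (is_derive_id s (1 : R)) (is_derive_cst r s 1)).
    by rewrite /GRing.scale/= mulr0 add0r add0r mulr1.
  exact: is_derive1_comp.
have cF : continuous F.
  move=> s; apply: differentiable_continuous; apply/derivable1_diffP.
  by case: (dF s).
have -> : log_mean a b = \int[leb]_(s in `[0, 1]) F s.
  by apply: eq_Rintegral => s _; exact: lm_exp.
have cFr : continuous (fun s => F s * r).
  by move=> s; apply: cvgM; [exact: cF|exact: cst_continuous].
have -> : ln a - ln b = - r by rewrite opprB.
rewrite mulrN -RintegralZr//; last exact: continuous_integrable_itv.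
rewrite (FTC_everywhere ler01 cFr dF) /F mul1r mul0r addr0.
have -> : ln a + r = ln b by rewrite /r; ring.
by rewrite !lnK ?posrE// opprB.
Qed.

(** The integrand is convex and lies above its tangent at the midpoint [1 / 2]; the integral of the
    tangent is its value there, the geometric mean. *)
Lemma sqrt_le_log_mean (a b : R) : 0 <= a -> 0 <= b -> Num.sqrt (a * b) <= log_mean a b.
Proof.
rewrite le_eqVlt => /predU1P[<- _|a0]; first by rewrite mul0r sqrtr0 log_mean_ge0.
rewrite le_eqVlt => /predU1P[<-|b0]; first by rewrite mulr0 sqrtr0 log_mean_ge0.
pose m := (ln a + ln b) / 2; pose r := ln b - ln a.
have -> : Num.sqrt (a * b) = expR m.
  rewrite -[a]lnK ?posrE// -[b in _ * b]lnK ?posrE// -expRD.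
  have -> : ln a + ln b = m *+ 2 by rewrite /m; field.
  rewrite -mulr_natl expRM_natl sqrtr_sqr ger0_norm ?expR_ge0//.
pose G s := expR m * (s + (s ^+ 2 - s) * (r / 2)).
pose g s := expR m * (1 + (s - 2^-1) * r).
have dG (s : R) : is_derive s 1 G (g s).
  pose p : {poly R} := (expR m)%:P * ('X + ('X ^+ 2 - 'X) * (r / 2)%:P).
  have -> : G = horner p by apply/funext => u; rewrite /p !hornerE /G /=; ring.
  apply: (is_derive_eq (is_derive_poly p s)).
  by rewrite /p !(derivM, derivC, derivD, derivN, derivX, derivXn) !hornerE /g /=; field.
have cg : continuous g.
  move=> s; apply: cvgM; first exact: cst_continuous.
  apply: cvgD; first exact: cst_continuous.
  apply: cvgM; last exact: cst_continuous.
  by apply: cvgB => //; exact: cst_continuous.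
have <- : \int[leb]_(s in `[0, 1]) g s = expR m.
  by rewrite (FTC_everywhere ler01 cg dG) /G; ring.
apply: le_Rintegral => //; [exact: continuous_integrable_itv|exact: ilm (ltW a0) (ltW b0)|].
move=> s _; rewrite -/(lm a b s) lm_exp//.
have -> : ln a + s * (ln b - ln a) = m + (s - 2^-1) * r by rewrite /m /r; field.
by rewrite expRD ler_wpM2l ?expR_ge0// expR_ge1Dx.
Qed.

(** By Tonelli, since the integrand is nonnegative and jointly measurable in its three variables. *)
Lemma measurable_log_mean : measurable_fun setT (fun z : R * R => log_mean z.1 z.2).
Proof.
pose f (w : (R * R) * R) : \bar R :=
  ((\1_(`[0, 1]%classic) w.2) * (w.1.1 `^ (1 - w.2) * w.1.2 `^ w.2))%:E.
have mf : measurable_fun setT f.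
  apply/measurable_EFinP; apply: measurable_funM.
    have m1 : measurable_fun setT (\1_(`[0, 1]%classic) : R -> R) by exact: measurable_indic.
    exact: (measurableT_comp m1 measurable_snd).
  apply: measurable_funM; apply: measurable_powR2.
  - exact: measurableT_comp.
  - by apply: measurable_funB => //; exact: measurable_cst.
  - exact: measurableT_comp.
  - by [].
have f0 w : (0 <= f w)%E.
  by rewrite lee_fin !mulr_ge0 ?powR_ge0// indicE; case: (_ \in _).
have := @measurable_fun_fubini_tonelli_F _ _ (R * R)%type (measurableTypeR R) R leb f mf f0.
move=> Fm.
have -> : (fun z : R * R => log_mean z.1 z.2) = fine \o fubini_F leb f.
  apply/funext => z; rewrite /log_mean /Rintegral /= /fubini_F.
  congr fine; apply: etrans; first exact: integral_mkcond.
  apply: eq_integral => s _; rewrite /f /= !patchE indicE.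
  by case: (s \in _); rewrite ?mul1r ?mul0r.
exact: measurableT_comp Fm.
Qed.

Lemma measurable_fun_log_mean d (T : measurableType d) (D : set T) (u v : T -> R) :
  measurable_fun D u -> measurable_fun D v ->
  measurable_fun D (fun t => log_mean (u t) (v t)).
Proof.
move=> mu mv mD; move: (mD).
have mu' : measurable_fun setT (u \_ D) by apply/(measurable_restrictT u mD).
have mv' : measurable_fun setT (v \_ D) by apply/(measurable_restrictT v mD).
have muv := measurableT_comp measurable_log_mean (measurable_fun_pair mu' mv').
apply: (eq_measurable_fun _ _ (measurable_funTS muv)) => t tD /=.
by rewrite !patchE tD.
Qed.

End LogMean.

(** * Green's formula and Young's inequality on a weighted graph *)

Section Graph.
Variables (R : realType) (N : nat).
Implicit Types (w : 'I_N -> 'I_N -> R) (f g : 'I_N -> R).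

Definition netflow w f (x : 'I_N) : R := \sum_y w x y * (f y - f x).

Definition dirichlet w f g : R :=
  2^-1 * \sum_x \sum_y w x y * ((f y - f x) * (g y - g x)).

Lemma green w f g : (forall x y, w x y = w y x) ->
  \sum_x g x * netflow w f x = - dirichlet w f g.
Proof.
move=> ws; rewrite /dirichlet /netflow.
pose S := \sum_x \sum_y g x * (w x y * (f y - f x)).
pose S' := \sum_x \sum_y g y * (w x y * (f x - f y)).
have SS' : S = S'.
  rewrite /S' exchange_big; apply: eq_bigr => x _; apply: eq_bigr => y _.
  by rewrite ws.
have -> : \sum_x g x * (\sum_y w x y * (f y - f x)) = S.
  by apply: eq_bigr => x _; rewrite mulr_sumr.
have -> : \sum_x \sum_y w x y * ((f y - f x) * (g y - g x)) = - (S + S').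
  rewrite -big_split/= -sumrN; apply: eq_bigr => x _.
  rewrite -big_split/= -sumrN; apply: eq_bigr => y _; ring.
by rewrite -SS'; field.
Qed.

Lemma sum_netflow w f : (forall x y, w x y = w y x) -> \sum_x netflow w f x = 0.
Proof.
move=> ws; transitivity (\sum_x 1 * netflow w f x).
  by apply: eq_bigr => x _; rewrite mul1r.
rewrite (green f (fun=> 1) ws) /dirichlet; under eq_bigr do under eq_bigr do rewrite subrr !mulr0.
by rewrite big1 ?mulr0 ?oppr0// => x _; rewrite big1.
Qed.

Lemma dirichlet_ge0 w f : (forall x y, 0 <= w x y) -> 0 <= dirichlet w f f.
Proof.
move=> w0; rewrite mulr_ge0 ?invr_ge0//; apply: sumr_ge0 => x _; apply: sumr_ge0 => y _.
by rewrite mulr_ge0// -expr2 sqr_ge0.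
Qed.

(* [0 <= D (c f - g)] for the quadratic form [D]. *)
Lemma dirichlet_young w f g (c : R) : (forall x y, 0 <= w x y) -> 0 < c ->
  dirichlet w f g <= (c * dirichlet w f f + c^-1 * dirichlet w g g) / 2.
Proof.
move=> w0 c0; have c1 : 0 <= c^-1 by rewrite invr_ge0 ltW.
have := dirichlet_ge0 (fun x => c * f x - g x) w0.
have -> : dirichlet w (fun x => c * f x - g x) (fun x => c * f x - g x) =
    c ^+ 2 * dirichlet w f f - 2 * c * dirichlet w f g + dirichlet w g g.
  rewrite /dirichlet !mulrA ![_ * 2^-1]mulrC -!mulrA -mulrBr -mulrDr; congr (_ * _).
  rewrite !mulr_sumr -sumrB -big_split; apply: eq_bigr => x _ /=.
  rewrite !mulr_sumr -sumrB -big_split; apply: eq_bigr => y _ /=; ring.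
move=> h; rewrite -subr_ge0.
have -> : (c * dirichlet w f f + c^-1 * dirichlet w g g) / 2 - dirichlet w f g =
  c^-1 / 2 * (c ^+ 2 * dirichlet w f f - 2 * c * dirichlet w f g + dirichlet w g g).
  by field; rewrite gt_eqF.
by rewrite mulr_ge0// divr_ge0.
Qed.

Lemma dirichlet_sym w f g : dirichlet w f g = dirichlet w g f.
Proof.
rewrite /dirichlet; congr (_ * _); apply: eq_bigr => x _; apply: eq_bigr => y _.
by rewrite [_ * (g y - g x)]mulrC.
Qed.

Lemma dirichletN w f g : dirichlet w f (fun x => - g x) = - dirichlet w f g.
Proof.
rewrite /dirichlet -mulrN -sumrN; congr (_ * _); apply: eq_bigr => x _.
by rewrite -sumrN; apply: eq_bigr => y _; ring.
Qed.

Lemma dirichlet_young_norm w f g (c : R) : (forall x y, 0 <= w x y) -> 0 < c ->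
  `|dirichlet w f g| <= (c * dirichlet w f f + c^-1 * dirichlet w g g) / 2.
Proof.
move=> w0 c0; rewrite ler_norml dirichlet_young// andbT lerNl -dirichletN.
have -> : dirichlet w g g = dirichlet w (fun x => - g x) (fun x => - g x).
  by rewrite dirichletN dirichlet_sym dirichletN opprK.
exact: dirichlet_young.
Qed.

End Graph.

Section MatrixNorm.
Variables (R : realType) (n : nat).
Implicit Types p q : 'rV[R]_n.+1.

Lemma coord_le_norm p x : `|p 0 x| <= `|p|.
Proof.
rewrite [leRHS]/Num.Def.normr /= mx_normrE.
by rewrite (le_trans _ (le_bigmax _ _ (ord0, x)))//= .
Qed.

Lemma norm_le_coord p e : 0 <= e -> (forall x, `|p 0 x| <= e) -> `|p| <= e.
Proof.
move=> e0 he; rewrite [leLHS]/Num.Def.normr /= mx_normrE.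
by apply: bigmax_le => //= -[i x] _; rewrite ord1.
Qed.

Lemma cvg_coord T (F : set_system T) (FF : Filter F) (f : T -> 'rV[R]_n.+1) p :
  (forall x, f t 0 x @[t --> F] --> p 0 x) -> f t @[t --> F] --> p.
Proof.
move=> hf; apply/cvgrPdist_le => e e0.
have hx x : \forall t \near F, `|p 0 x - f t 0 x| <= e.
  by have /cvgrPdist_le := hf x; exact.
have : \forall t \near F, forall x, `|p 0 x - f t 0 x| <= e.
  by apply: filter_forall.
apply: filterS => t ht; apply: norm_le_coord (ltW e0) _ => x.
by rewrite !mxE.
Qed.

Lemma within_continuous_coordP (A : set R) (f : R -> 'rV[R]_n.+1) :
  {within A, continuous f} <-> forall x, {within A, continuous (fun t => f t 0 x)}.
Proof.
split=> [cf x t|cf].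
  have cx := @coord_continuous R 1 n.+1 0 x (f t).
  exact: (@continuous_comp (subspace A) _ _ f (fun M : 'rV[R]_n.+1 => M 0 x) t (cf t) cx).
by move=> t; apply: cvg_coord => x; exact: cf.
Qed.

End MatrixNorm.

(** What the general theory of curves and of the distance asks of the rates; irreducibility and
    reversibility first serve near the boundary. One Lipschitz constant serves all entries. *)
Record regular_rates (R : realType) (n : nat) (Q : 'rV[R]_n.+1 -> 'M[R]_n.+1) : Prop :=
  RegularRates {
  rates_ge0 : forall mu, simplex mu -> forall x y, x != y -> 0 <= Q mu x y;
  rates_lipschitz : exists2 L, 0 < L & forall p q, simplex p -> simplex q ->
    forall x y, `|Q p x y - Q q x y| <= L * `|p - q| }.

(** * The edge weights of the transport metric *)

Section Weights.
Variables (R : realType) (n : nat) (Q : 'rV[R]_n.+1 -> 'M[R]_n.+1).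
Notation leb := (@lebesgue_measure R).
Notation V := 'rV[R]_n.+1.
Implicit Types (mu psi p q : V).

(** Divergence and action only see the symmetric part of [Lambda] off the diagonal. Symmetrizing by
    hand makes symmetry immediate, and the zero diagonal discards the junk values. *)
Definition weight mu (x y : 'I_n.+1) : R :=
  if x == y then 0 else (Lambda Q mu x y + Lambda Q mu y x) / 2.

Lemma weight_sym mu x y : weight mu x y = weight mu y x.
Proof. by rewrite /weight eq_sym addrC. Qed.

Lemma weight_ge0 mu x y : 0 <= weight mu x y.
Proof.
rewrite /weight; case: eqP => // _.
by rewrite divr_ge0// addr_ge0// mxE log_mean_ge0.
Qed.

Lemma divergence_flux mu psi x :
  divergence (flux Q mu psi) 0 x = netflow (weight mu) (psi 0) x.
Proof.
rewrite /divergence /netflow mxE mulr_sumr; apply: eq_bigr => y _.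
rewrite !mxE /weight; case: eqP => [->|_]; first by rewrite subrr mulr0 mul0r.
by rewrite !mxE; field.
Qed.

Lemma action_dirichlet mu psi : action Q mu psi = dirichlet (weight mu) (psi 0) (psi 0).
Proof.
rewrite /action /dirichlet; congr (_ * _).
pose S := \sum_x \sum_y (psi 0 y - psi 0 x) ^+ 2 * Lambda Q mu x y.
pose S' := \sum_x \sum_y (psi 0 y - psi 0 x) ^+ 2 * Lambda Q mu y x.
have SS' : S = S'.
  rewrite /S' exchange_big; apply: eq_bigr => x _; apply: eq_bigr => y _.
  by rewrite -sqrrN opprB.
rewrite -/S; have -> : S = (S + S') / 2 by rewrite -SS'; field.
rewrite mulrDl !mulr_suml -big_split; apply: eq_bigr => x _ /=.
rewrite !mulr_suml -big_split; apply: eq_bigr => y _ /=.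
rewrite /weight; case: eqP => [->|_]; first by rewrite subrr expr0n/= !mul0r addr0.
by field.
Qed.

Lemma action_ge0 mu psi : 0 <= action Q mu psi.
Proof. by rewrite action_dirichlet; apply: dirichlet_ge0; exact: weight_ge0. Qed.

Lemma simplex_ge0 p x : simplex p -> 0 <= p 0 x. Proof. by case. Qed.

Lemma simplex_le1 p x : simplex p -> p 0 x <= 1.
Proof.
by move=> [p0 <-]; rewrite (bigD1 x)//= lerDl; apply: sumr_ge0.
Qed.

Hypothesis rQ : regular_rates Q.

Lemma rates_bounded : exists2 C, 0 < C & forall p, simplex p -> forall x y, `|Q p x y| <= C.
Proof.
have [L L0 hL] := rates_lipschitz rQ.
(* A vertex of the simplex, at sup-distance at most 1 from every point of it. *)
pose e : V := delta_mx 0 0.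
have se : simplex e.
  split=> [x|]; first by rewrite mxE.
  by rewrite (bigD1 0)//= mxE !eqxx big1 ?addr0// => x /negPf x0; rewrite mxE x0 andbF.
exists (L * 1 + \sum_x \sum_y `|Q e x y|).
  by rewrite mulr1 ltr_wpDr//; apply: sumr_ge0 => x _; apply: sumr_ge0.
move=> p sp x y; rewrite -[Q p x y](subrK (Q e x y)) (le_trans (ler_normD _ _))//.
apply: lerD.
  apply: le_trans (hL _ _ sp se x y) _; apply: ler_wpM2l; first exact: ltW.
  apply: norm_le_coord => // z; rewrite !mxE eqxx /= ler_norml.
  have p0 := simplex_ge0 z sp; have p1 := simplex_le1 z sp.
  by case: (z == 0) => /=; apply/andP; split; lra.
rewrite (bigD1 x)//= (bigD1 y)//= -addrA lerDl addr_ge0 ?sumr_ge0// => z _.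
by apply: sumr_ge0.
Qed.

Lemma rate_mass_ge0 p x y : simplex p -> x != y -> 0 <= p 0 x * Q p x y.
Proof. by move=> sp xy; rewrite mulr_ge0 ?(rates_ge0 rQ)// simplex_ge0. Qed.

Lemma weight_bounded : exists2 C, 0 < C & forall p, simplex p -> forall x y, weight p x y <= C.
Proof.
have [C C0 hC] := rates_bounded; exists (2 * C); first by rewrite mulr_gt0.
move=> p sp x y; rewrite /weight; case: eqVneq => [_|xy]; first by rewrite ltW// mulr_gt0.
have h u v : u != v -> Lambda Q p u v <= 2 * C.
  move=> uv; rewrite mxE (le_trans (log_mean_le_add _ _))//.
  - exact: rate_mass_ge0.
  - by apply: rate_mass_ge0 => //; rewrite eq_sym.
  have hm a b : p 0 a * Q p a b <= C.
    apply: (@le_trans _ _ (p 0 a * C)).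
      by rewrite ler_wpM2l ?simplex_ge0// (le_trans (ler_norm _))// hC.
    by apply: ler_piMl; [exact: ltW|exact: simplex_le1].
  by have := hm u v; have := hm v u; lra.
have := h _ _ xy; have := h y x; rewrite eq_sym => /(_ xy); lra.
Qed.

Lemma rates_within_continuous (A : set R) (mu : R -> V) x y :
  (forall t, A t -> simplex (mu t)) -> {within A, continuous mu} ->
  {within A, continuous (fun t => Q (mu t) x y)}.
Proof.
move=> smu /subspace_continuousP cmu; have [L L0 hL] := rates_lipschitz rQ.
apply/subspace_continuousP => t At; apply/cvgrPdist_le => e e0.
have e1 : 0 < e / L by rewrite divr_gt0.
have /cvgrPdist_le/(_ _ e1) h := cmu t At.
near=> s; have As : A s by near: s; exact: withinT.
apply: le_trans (hL _ _ (smu t At) (smu s As) x y) _.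
by rewrite mulrC -ler_pdivlMr//; near: s.
Unshelve. all: by end_near. Qed.

Lemma weight_measurable (a b : R) (mu : R -> V) x y :
  (forall t, `[a, b]%classic t -> simplex (mu t)) -> {within `[a, b], continuous mu} ->
  measurable_fun `[a, b] (fun t => weight (mu t) x y).
Proof.
move=> smu cmu; rewrite /weight; case: eqP => _; first exact: measurable_cst.
have mmass u v : measurable_fun `[a, b] (fun t => mu t 0 u * Q (mu t) u v).
  apply: measurable_funM; apply: subspace_continuous_measurable_fun => //.
    by move/within_continuous_coordP : cmu; exact.
  exact: rates_within_continuous.
have mL u v : measurable_fun `[a, b] (fun t => Lambda Q (mu t) u v).
  apply: (eq_measurable_fun (fun t => log_mean (mu t 0 u * Q (mu t) u v) (mu t 0 v * Q (mu t) v u))).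
    by move=> t _; rewrite mxE.
  exact: measurable_fun_log_mean.
apply: measurable_funM => //; exact: measurable_funD.
Qed.

End Weights.

(** * Curves satisfying the continuity equation *)

Section StrongCurves.
Variables (R : realType) (n : nat) (Q : 'rV[R]_n.+1 -> 'M[R]_n.+1).
Hypothesis rQ : regular_rates Q.
Notation leb := (@lebesgue_measure R).
Notation V := 'rV[R]_n.+1.
Implicit Types (mu psi : R -> V).

Definition flow mu psi (x : 'I_n.+1) (t : R) : R :=
  netflow (weight Q (mu t)) (psi t 0) x.

(** Continuity of [mu] is not a field: it follows from the integrability of the flow, so that gluing
    two curves requires no continuity argument. *)
Record scurve (a b : R) mu psi : Prop := SCurve {
  sc_simplex : forall t, `[a, b]%classic t -> simplex (mu t);
  sc_psi : forall x, leb.-integrable `[a, b] (fun t => (psi t 0 x)%:E);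
  sc_flow : forall x, leb.-integrable `[a, b] (EFin \o flow mu psi x);
  sc_eq : forall x t, `[a, b]%classic t ->
    mu t 0 x = mu a 0 x - \int[leb]_(s in `[a, t]) flow mu psi x s }.

Definition energy (a b : R) mu psi : \bar R :=
  (\int[leb]_(t in `[a, b]) (action Q (mu t) (psi t))%:E)%E.

Lemma within_continuous_eq (A : set R) (f g : R -> R) : {in A, f =1 g} ->
  {within A, continuous f} -> {within A, continuous g}.
Proof. by move=> fg; exact: subspace_eq_continuous. Qed.

Lemma sc_continuous a b mu psi : a <= b -> scurve a b mu psi ->
  {within `[a, b], continuous mu}.
Proof.
move=> ab cmu; apply/within_continuous_coordP => x.
apply: (@within_continuous_eq _ (fun t => mu a 0 x - \int[leb]_(s in `[a, t]) flow mu psi x s)).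
  by move=> t; rewrite inE => tab; rewrite -(sc_eq cmu x tab).
move=> t; apply: cvgB; first exact: cvg_cst.
exact: (parameterized_integral_continuous ab (sc_flow cmu x)).
Qed.

Lemma flow_integrable a b mu psi :
  (forall t, `[a, b]%classic t -> simplex (mu t)) -> {within `[a, b], continuous mu} ->
  (forall x, leb.-integrable `[a, b] (fun t => (psi t 0 x)%:E)) ->
  forall x, leb.-integrable `[a, b] (EFin \o flow mu psi x).
Proof.
move=> smu cmu ipsi x.
have mab : measurable (`[a, b]%classic : set (measurableTypeR R)) by exact: measurable_itv.
have [C C0 hC] := weight_bounded rQ.
have : leb.-integrable `[a, b] (fun t => \sum_y
    ((EFin \o (fun t => weight Q (mu t) x y)) \* (fun t => (psi t 0 y)%:E - (psi t 0 x)%:E))%E t)%E.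
  apply: integrable_sum => // y _; apply: integrableMr => //.
  - exact: weight_measurable.
  - exists C; split; first exact: num_real.
    move=> M CM t /= tab; rewrite ger0_norm ?weight_ge0// (le_trans _ (ltW CM))//.
    exact: hC (smu t tab) x y.
  - exact: integrableB.
apply: eq_integrable => // t _ /=; rewrite /flow /netflow -sumEFin.
by apply: eq_bigr => y _; rewrite -EFinB -EFinM.
Qed.

Lemma CE_scurve mu psi : CE Q mu psi <-> scurve 0 1 mu psi.
Proof.
have fE x (D : set R) (f : R -> R) : \int[leb]_(t in D)
    (f t * divergence (flux Q (mu t) (psi t)) 0 x) = \int[leb]_(t in D) (f t * flow mu psi x t).
  by apply: eq_Rintegral => t _; rewrite divergence_flux.
split=> [[smu cmu ipsi eqn]|cmu].
- have iflow := flow_integrable smu cmu ipsi.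
  split => // x t t01.
  have cx : {within `[0, 1], continuous (fun t => mu t 0 x)}.
    by move/within_continuous_coordP : cmu; exact.
  apply: ((weak_derivativeP cx (iflow x)).1 _ t t01) => phi tphi.
  by rewrite (eqn phi tphi x) fE.
- have cont := sc_continuous ler01 cmu.
  split => //; [exact: sc_simplex cmu|exact: sc_psi cmu|].
  move=> phi tphi x; rewrite fE.
  have cx : {within `[0, 1], continuous (fun t => mu t 0 x)}.
    by move/within_continuous_coordP : cont; exact.
  by apply: (weak_derivativeP cx (sc_flow cmu x)).2 => // t; exact: sc_eq cmu x t.
Qed.

Lemma action_measurable a b mu psi : a <= b -> scurve a b mu psi ->
  measurable_fun `[a, b] (fun t => action Q (mu t) (psi t)).
Proof.
move=> ab cmu; have cont := sc_continuous ab cmu.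
have mpsi x : measurable_fun `[a, b] (fun t => psi t 0 x).
  by apply/measurable_EFinP; exact: measurable_int (sc_psi cmu x).
apply: (eq_measurable_fun (fun t => dirichlet (weight Q (mu t)) (psi t 0) (psi t 0))).
  by move=> t _; rewrite action_dirichlet.
apply: measurable_funM; first exact: measurable_cst.
apply: measurable_sum => x; apply: measurable_sum => y.
apply: measurable_funM; first exact: weight_measurable (sc_simplex cmu) cont.
by apply: measurable_funM; apply: measurable_funB.
Qed.

Lemma energy_ge0 a b mu psi : (0 <= energy a b mu psi)%E.
Proof. by apply: integral_ge0 => t _; rewrite lee_fin action_ge0. Qed.

End StrongCurves.

(** * Integrals of functions glued at an intermediate time *)

Section Splitting.
Variable R : realType.
Notation leb := (@lebesgue_measure R).
Notation M := (measurableTypeR R).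

Lemma itv_split (a b c : R) : a <= b -> b <= c ->
  `[a, c]%classic = `[a, b] `|` `]b, c] :> set R.
Proof.
move=> ab bc; apply/seteqP; split => t /=; rewrite !in_itv/=.
  by move=> /andP[at_ tc]; have [tb|bt] := leP t b; [left|right]; apply/andP.
move=> [/andP[at_ tb]|/andP[bt tc]]; apply/andP; split => //.
  exact: le_trans bc.
by rewrite (le_trans ab)// ltW.
Qed.

Lemma integral_split (a b c : R) (f : R -> R) : a <= b -> b <= c ->
  measurable_fun `[a, c] f ->
  (\int[leb]_(t in `[a, c]) (f t)%:E =
   \int[leb]_(t in `[a, b]) (f t)%:E + \int[leb]_(t in `[b, c]) (f t)%:E)%E.
Proof.
move=> ab bc mf.
rewrite (itv_split ab bc) integral_setU//.
- congr (_ + _)%E; apply: integral_itv_obnd_cbnd.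
  apply/measurable_EFinP; apply: measurable_funS mf => // t /=.
  by rewrite !in_itv/= => /andP[bt ->]; rewrite (le_trans ab)// ltW.
- by rewrite -itv_split//; exact/measurable_EFinP.
- apply/disj_setPS => t [/=]; rewrite !in_itv/= => /andP[_ tb] /andP[bt _].
  by move: (lt_le_trans bt tb); rewrite ltxx.
Qed.

Lemma Rintegral_split (a b c : R) (f : R -> R) : a <= b -> b <= c ->
  leb.-integrable `[a, c] (EFin \o f) ->
  \int[leb]_(t in `[a, c]) f t =
  \int[leb]_(t in `[a, b]) f t + \int[leb]_(t in `[b, c]) f t.
Proof.
move=> ab bc fi; rewrite /Rintegral (integral_split ab bc).
  rewrite fineD//; apply: integrable_fin_num => //; apply: integrableS fi => //;
  apply: subset_itv; rewrite bnd_simp//.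
by apply/measurable_EFinP; exact: measurable_int fi.
Qed.

Definition cglue {T} (b : R) (f g : R -> T) (t : R) : T := if t <= b then f t else g t.

Section Glue.
Variables (a b c : R) (f g : R -> R).
Hypotheses (ab : a <= b) (bc : b <= c).

Lemma measurable_glue : measurable_fun `[a, b] f -> measurable_fun `[b, c] g ->
  measurable_fun `[a, c] (cglue b f g).
Proof.
move=> mf mg; rewrite (itv_split ab bc); apply/measurable_funU => //; split.
  apply: eq_measurable_fun mf => t; rewrite inE/= in_itv/= => /andP[_ tb].
  by rewrite /cglue tb.
have mg' : measurable_fun `]b, c] g.
  apply: measurable_funS mg => //; apply: subset_itv; rewrite bnd_simp//.
apply: eq_measurable_fun mg' => t; rewrite inE/= in_itv/= => /andP[bt _].
by rewrite /cglue leNgt bt.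
Qed.

Lemma integral_glue : measurable_fun `[a, b] f -> measurable_fun `[b, c] g ->
  (\int[leb]_(t in `[a, c]) (cglue b f g t)%:E =
   \int[leb]_(t in `[a, b]) (f t)%:E + \int[leb]_(t in `[b, c]) (g t)%:E)%E.
Proof.
move=> mf mg; have mfg := measurable_glue mf mg.
have mg' : measurable_fun `]b, c] g.
  by apply: measurable_funS mg => //; apply: subset_itv; rewrite bnd_simp.
rewrite (itv_split ab bc) integral_setU//.
- congr (_ + _)%E.
    by apply: eq_integral => t; rewrite inE/= in_itv/= => /andP[_ tb]; rewrite /cglue tb.
  rewrite -integral_itv_obnd_cbnd; last exact/measurable_EFinP.
  by apply: eq_integral => t; rewrite inE/= in_itv/= => /andP[bt _]; rewrite /cglue leNgt bt.
- by rewrite -itv_split//; exact/measurable_EFinP.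
- apply/disj_setPS => t [/=]; rewrite !in_itv/= => /andP[_ tb] /andP[bt _].
  by move: (lt_le_trans bt tb); rewrite ltxx.
Qed.

End Glue.

Lemma integrable_glue (a b c : R) (f g : R -> R) : a <= b -> b <= c ->
  leb.-integrable `[a, b] (EFin \o f) -> leb.-integrable `[b, c] (EFin \o g) ->
  leb.-integrable `[a, c] (EFin \o cglue b f g).
Proof.
move=> ab bc /integrableP[/measurable_EFinP mf fi] /integrableP[/measurable_EFinP mg gi].
apply/integrableP; split; first by apply/measurable_EFinP; exact: measurable_glue.
have -> : (fun t => `|(EFin \o cglue b f g) t|)%E =
    EFin \o cglue b (fun t => `|f t|) (fun t => `|g t|).
  by apply/funext => t; rewrite /= /cglue; case: ifP.
rewrite integral_glue//; [exact: lte_add_pinfty| |]; exact: measurableT_comp.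
Qed.

Lemma Rintegral_glue (a b c : R) (f g : R -> R) : a <= b -> b <= c ->
  leb.-integrable `[a, b] (EFin \o f) -> leb.-integrable `[b, c] (EFin \o g) ->
  \int[leb]_(t in `[a, c]) cglue b f g t =
  \int[leb]_(t in `[a, b]) f t + \int[leb]_(t in `[b, c]) g t.
Proof.
move=> ab bc fi gi; rewrite /Rintegral integral_glue//.
- by rewrite fineD//; exact: integrable_fin_num.
- by apply/measurable_EFinP; exact: measurable_int fi.
- by apply/measurable_EFinP; exact: measurable_int gi.
Qed.

End Splitting.

(** * Restriction, rescaling, reversal and gluing of curves *)

Section CurveSurgery.
Variables (R : realType) (n : nat) (Q : 'rV[R]_n.+1 -> 'M[R]_n.+1).
Hypothesis rQ : regular_rates Q.
Notation leb := (@lebesgue_measure R).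
Notation V := 'rV[R]_n.+1.
Implicit Types (mu psi : R -> V).

Lemma sub_itvcc (a b c d : R) : a <= c -> d <= b -> `[c, d]%classic `<=` `[a, b]%classic.
Proof. by move=> ac db; apply: subset_itv; rewrite bnd_simp. Qed.

Lemma scurve_restrict a b c d mu psi : a <= c -> c <= d -> d <= b ->
  scurve Q a b mu psi -> scurve Q c d mu psi.
Proof.
move=> ac cd db cmu; have sub := sub_itvcc ac db.
have isub (f : R -> \bar R) : leb.-integrable `[a, b] f -> leb.-integrable `[c, d] f.
  by move=> fi; apply: integrableS fi.
split=> [t /sub|x|x|x t tcd]; first exact: sc_simplex cmu t.
- exact/isub/(sc_psi cmu).
- exact/isub/(sc_flow cmu).
- have := tcd; rewrite /= in_itv/= => /andP[ct td].
  have cab : `[a, b]%classic c by apply: sub; rewrite /= in_itv/= lexx.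
  rewrite (sc_eq cmu x (sub _ tcd)) (sc_eq cmu x cab) (@Rintegral_split _ a c t)//.
    by rewrite opprD addrA.
  by apply: integrableS (sc_flow cmu x) => //; apply: sub_itvcc => //; exact: le_trans db.
Qed.

Lemma energy_restrict a b c d mu psi : a <= b -> a <= c -> d <= b ->
  scurve Q a b mu psi -> (energy Q c d mu psi <= energy Q a b mu psi)%E.
Proof.
move=> ab ac db cmu; apply: ge0_subset_integral => //.
- by apply/measurable_EFinP; exact: (action_measurable rQ ab cmu).
- by move=> t _; rewrite lee_fin action_ge0.
- exact: sub_itvcc.
Qed.

Lemma flow_scale mu psi (k : R) (h : R -> R) x t :
  flow Q (mu \o h) (fun s => k *: psi (h s)) x t = k * flow Q mu psi x (h t).
Proof.
rewrite /flow /netflow mulr_sumr; apply: eq_bigr => y _ /=.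
by rewrite !mxE; ring.
Qed.

Lemma action_scale p (q : V) (k : R) : action Q p (k *: q) = k ^+ 2 * action Q p q.
Proof.
rewrite /action [RHS]mulrCA; congr (_ * _).
rewrite mulr_sumr; apply: eq_bigr => x _; rewrite mulr_sumr; apply: eq_bigr => y _.
by rewrite !mxE; ring.
Qed.

Lemma preimage_affine_itv (k d a b : R) : 0 < k ->
  (fun x => k * x + d) @^-1` `[a, b] = `[(a - d) / k, (b - d) / k]%classic.
Proof.
move=> k0; apply/seteqP; split => x /=; rewrite !in_itv/=;
by rewrite ler_pdivlMr// ler_pdivrMr// mulrC lerBlDr lerBrDr.
Qed.

Lemma preimage_reverse_itv (a b : R) :
  (fun x : R => -1 * x + 1) @^-1` `[a, b] = `[1 - b, 1 - a]%classic.
Proof.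
apply/seteqP; split => x /=; rewrite !in_itv/= => /andP[h1 h2];
by apply/andP; split; lra.
Qed.

Lemma scurve_affine (k d a b : R) mu psi : 0 < k -> a <= b -> scurve Q a b mu psi ->
  scurve Q ((a - d) / k) ((b - d) / k)
    (mu \o (fun t : R => k * t + d)) (fun t : R => k *: psi (k * t + d)).
Proof.
move=> k0 ab cmu; have kn0 : k != 0 by rewrite gt_eqF.
have pre := preimage_affine_itv d a b k0.
have mem t : `[(a - d) / k, (b - d) / k]%classic t -> `[a, b]%classic (k * t + d).
  by rewrite -pre.
have iflow x : leb.-integrable `[(a - d) / k, (b - d) / k]
    (EFin \o flow Q (mu \o (fun t : R => k * t + d)) (fun t : R => k *: psi (k * t + d)) x).
  have := integrable_affine d kn0 _ (sc_flow cmu x); rewrite pre => /(_ _) h.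
  have {h} := @integrable_mulr _ _ (fun t => flow Q mu psi x (k * t + d)) k _ (h _).
  by move=> /(_ _ _) h; apply: eq_integrable (h _ _) => // t _ /=; rewrite flow_scale.
split=> [t /mem|x|//|x t tI].
- exact: sc_simplex cmu _.
- have ipsi : leb.-integrable `[a, b] (EFin \o (fun t => psi t 0 x)) by exact: sc_psi cmu x.
  have := integrable_affine d kn0 _ ipsi; rewrite pre => /(_ _) h.
  have {h} := @integrable_mulr _ _ (fun t => psi (k * t + d) 0 x) k _ (h _).
  by move=> /(_ _ _) h; apply: eq_integrable (h _ _) => // t _ /=; rewrite mxE.
- have tab := mem _ tI; apply: (etrans (sc_eq cmu x tab)).
  have -> : (mu \o (fun t : R => k * t + d)) ((a - d) / k) = mu a.
    by rewrite /=; congr mu; field.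
  congr (_ - _).
  transitivity (\int[leb]_(s in `[(a - d) / k, t]) (k * flow Q mu psi x (k * s + d))); last first.
    by apply: eq_Rintegral => s _; rewrite -flow_scale.
  have [at_ tb] : a <= k * t + d /\ k * t + d <= b by apply/andP; rewrite /= in_itv/= in tab.
  have iat : leb.-integrable `[a, k * t + d] (EFin \o flow Q mu psi x).
    by apply: integrableS (sc_flow cmu x) => //; exact: sub_itvcc.
  have pret : (fun x => k * x + d) @^-1` `[a, k * t + d] = `[(a - d) / k, t]%classic.
    by rewrite preimage_affine_itv// addrK mulrAC mulfV// mul1r.
  rewrite RintegralZl//; last first.
    by have := integrable_affine d kn0 _ iat; rewrite pret; exact.
  have := Rintegral_affine d kn0 _ iat; rewrite pret => -> //.
  by rewrite gtr0_norm// mulVKf.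
Qed.

(** Running [k] times faster multiplies the action by [k^2] and divides the duration by [k]. *)
Lemma energy_affine (k d a b : R) mu psi : 0 < k -> a <= b -> scurve Q a b mu psi ->
  energy Q ((a - d) / k) ((b - d) / k)
    (mu \o (fun t : R => k * t + d)) (fun t : R => k *: psi (k * t + d)) =
  (k%:E * energy Q a b mu psi)%E.
Proof.
move=> k0 ab cmu; have kn0 : k != 0 by rewrite gt_eqF.
have mact : measurable_fun `[a, b] (fun t => (action Q (mu t) (psi t))%:E).
  by apply/measurable_EFinP; exact: (action_measurable rQ ab cmu).
pose f t := ((k ^+ 2)%:E * (action Q (mu t) (psi t))%:E)%E.
have mf : measurable_fun `[a, b] f by exact: measurable_funeM.
have f0 t : `[a, b]%classic t -> (0 <= f t)%E.
  by move=> _; rewrite mule_ge0// lee_fin ?sqr_ge0 ?action_ge0.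
have := ge0_integral_affine d kn0 _ mf f0; rewrite preimage_affine_itv// => /(_ _) h.
rewrite /energy; transitivity (\int[leb]_(t in `[((a - d) / k)%R, ((b - d) / k)%R]) f (k * t + d)%R)%E.
  by apply: eq_integral => t _; rewrite action_scale EFinM.
rewrite h// /f ge0_integralZl//; last by rewrite lee_fin sqr_ge0.
  by rewrite muleA -EFinM gtr0_norm// expr2 mulKf.
by move=> t _; rewrite lee_fin action_ge0.
Qed.

(** Reversal is spelled [-1 * t + 1] to be an instance of the affine change of variables; the
    potential changes sign with the velocity. *)
Lemma scurve_reverse mu psi : scurve Q 0 1 mu psi ->
  scurve Q 0 1 (mu \o (fun t : R => -1 * t + 1)) (fun t : R => (-1) *: psi (-1 * t + 1)).
Proof.
move=> cmu; have kn0 : (-1 : R) != 0 by rewrite oppr_eq0 oner_eq0.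
have pre : (fun x : R => -1 * x + 1) @^-1` `[0, 1] = `[0, 1]%classic.
  by rewrite preimage_reverse_itv subrr subr0.
have mem (t : R) : `[0, 1]%classic t -> `[0, 1]%classic (-1 * t + 1).
  by rewrite /= !in_itv/= => /andP[h1 h2]; apply/andP; split; lra.
split=> [t /mem|x|x|x t tI].
- exact: sc_simplex cmu _.
- have ipsi : leb.-integrable `[0, 1] (EFin \o (fun t => psi t 0 x)) by exact: sc_psi cmu x.
  have := integrable_affine 1 kn0 _ ipsi; rewrite pre => /(_ _) h.
  have {h} := @integrable_mulr _ _ (fun t => psi (-1 * t + 1) 0 x) (-1) _ (h _).
  by move=> /(_ _ _) h; apply: eq_integrable (h _ _) => // t _ /=; rewrite mxE.
- have := integrable_affine 1 kn0 _ (sc_flow cmu x); rewrite pre => /(_ _) h.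
  have {h} := @integrable_mulr _ _ (fun t => flow Q mu psi x (-1 * t + 1)) (-1) _ (h _).
  by move=> /(_ _ _) h; apply: eq_integrable (h _ _) => // t _ /=; rewrite flow_scale.
- have tab := mem _ tI; apply: (etrans (sc_eq cmu x tab)).
  have -> : (mu \o (fun t : R => -1 * t + 1)) 0 = mu 1 by rewrite /= mulr0 add0r.
  have [t0 t1] : 0 <= t /\ t <= 1 by apply/andP; rewrite /= in_itv/= in tI.
  have i11 : `[0, 1]%classic (1 : R) by rewrite /= in_itv/= ler01 lexx.
  rewrite (sc_eq cmu x i11).
  have -> : \int[leb]_(s in `[0, t]) flow Q (mu \o (fun t : R => -1 * t + 1))
      (fun t : R => (-1) *: psi (-1 * t + 1)) x s =
      \int[leb]_(s in `[0, t]) (-1 * flow Q mu psi x (-1 * s + 1)).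
    by apply: eq_Rintegral => s _; rewrite -flow_scale.
  have it : leb.-integrable `[1 - t, 1] (EFin \o flow Q mu psi x).
    by apply: integrableS (sc_flow cmu x) => //; apply: sub_itvcc => //; rewrite subr_ge0.
  have pret : (fun x : R => -1 * x + 1) @^-1` `[1 - t, 1] = `[0, t]%classic.
    by rewrite preimage_reverse_itv subrr opprB addrC subrK.
  rewrite RintegralZl//; last first.
    by have := integrable_affine 1 kn0 _ it; rewrite pret; exact.
  have := Rintegral_affine 1 kn0 _ it; rewrite pret => -> //.
  rewrite normrN normr1 invr1 mul1r mulN1r (addrC (- t)).
  rewrite (@Rintegral_split _ 0 (1 - t) 1)//; [ring|by rewrite subr_ge0|by rewrite gerBl|].
  exact: sc_flow cmu x.
Qed.

Lemma energy_reverse mu psi : scurve Q 0 1 mu psi ->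
  energy Q 0 1 (mu \o (fun t : R => -1 * t + 1)) (fun t : R => (-1) *: psi (-1 * t + 1)) =
  energy Q 0 1 mu psi.
Proof.
move=> cmu; have kn0 : (-1 : R) != 0 by rewrite oppr_eq0 oner_eq0.
have mact : measurable_fun `[0 : R, 1] (fun t : R => (action Q (mu t) (psi t))%:E).
  by apply/measurable_EFinP; exact: (action_measurable rQ ler01 cmu).
have act0 (t : R) : `[0 : R, 1]%classic t -> (0 <= (action Q (mu t) (psi t))%:E)%E.
  by move=> _; rewrite lee_fin action_ge0.
have := ge0_integral_affine 1 kn0 _ mact act0.
rewrite preimage_reverse_itv subrr subr0 => /(_ _) h.
have n1 : (`|-1 : R|^-1)%:E = 1%E by rewrite normrN normr1 invr1.
rewrite /energy -[RHS]mul1e -n1 -h//.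
by apply: eq_integral => t _; rewrite action_scale sqrrN expr1n mul1r.
Qed.

Lemma flow_glue b m1 p1 m2 p2 x :
  flow Q (cglue b m1 m2) (cglue b p1 p2) x = cglue b (flow Q m1 p1 x) (flow Q m2 p2 x).
Proof. by apply/funext => t; rewrite /flow /cglue; case: ifP. Qed.

Lemma scurve_glue (a b c : R) m1 p1 m2 p2 : a <= b -> b <= c ->
  scurve Q a b m1 p1 -> scurve Q b c m2 p2 -> m1 b = m2 b ->
  scurve Q a c (cglue b m1 m2) (cglue b p1 p2).
Proof.
move=> ab bc c1 c2 m12; split=> [t|x|x|x t].
- rewrite /= in_itv/= => /andP[at_ tc]; rewrite /cglue.
  case: (leP t b) => [tb|bt].
    by apply: (sc_simplex c1); rewrite /= in_itv/= at_.
  by apply: (sc_simplex c2); rewrite /= in_itv/= ltW.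
- have h1 : leb.-integrable `[a, b] (EFin \o (fun t => p1 t 0 x)) by exact: sc_psi c1 x.
  have h2 : leb.-integrable `[b, c] (EFin \o (fun t => p2 t 0 x)) by exact: sc_psi c2 x.
  have := integrable_glue ab bc h1 h2.
  by apply: eq_integrable => // t _ /=; rewrite /cglue; case: ifP.
- by rewrite flow_glue; apply: integrable_glue => //; [exact: sc_flow c1 x|exact: sc_flow c2 x].
- rewrite /= in_itv/= => /andP[at_ tc]; rewrite flow_glue {1 2}/cglue ab.
  case: (leP t b) => [tb|/ltW bt].
    rewrite (sc_eq c1 x); last by rewrite /= in_itv/= at_.
    congr (_ - _); apply: eq_Rintegral => s; rewrite inE/= in_itv/= => /andP[_ st].
    by rewrite /cglue (le_trans st tb).
  rewrite (sc_eq c2 x); last by rewrite /= in_itv/= bt.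
  rewrite -m12 (sc_eq c1 x); last by rewrite /= in_itv/= ab lexx.
  rewrite Rintegral_glue//; first by rewrite opprD addrA.
    exact: sc_flow c1 x.
  by apply: integrableS (sc_flow c2 x) => //; exact: sub_itvcc.
Qed.

Lemma energy_glue (a b c : R) m1 p1 m2 p2 : a <= b -> b <= c ->
  scurve Q a b m1 p1 -> scurve Q b c m2 p2 ->
  energy Q a c (cglue b m1 m2) (cglue b p1 p2) =
  (energy Q a b m1 p1 + energy Q b c m2 p2)%E.
Proof.
move=> ab bc c1 c2; rewrite /energy -integral_glue//.
- by apply: eq_integral => t _; rewrite /cglue; case: ifP.
- exact: (action_measurable rQ ab c1).
- exact: (action_measurable rQ bc c2).
Qed.

End CurveSurgery.

(** * The transport distance *)

Section Transport.
Variables (R : realType) (n : nat) (Q : 'rV[R]_n.+1 -> 'M[R]_n.+1).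
Hypothesis rQ : regular_rates Q.
Notation leb := (@lebesgue_measure R).
Notation V := 'rV[R]_n.+1.
Notation W := (Wdist Q).
Implicit Types (mu psi : R -> V) (p q r : V).

Lemma Wdist_ge0 p q : (0 <= W p q)%E.
Proof.
by apply: le_ereal_inf_tmp => _ [mu [psi [_ _ _ ->]]]; exact: sqrte_ge0.
Qed.

(** Rescaling to unit time multiplies the energy by the duration [b - a]. *)
Lemma Wdist_le (a b e : R) mu psi : a < b -> scurve Q a b mu psi ->
  (energy Q a b mu psi <= e%:E)%E ->
  (W (mu a) (mu b) <= (Num.sqrt ((b - a) * e))%:E)%E.
Proof.
move=> ab cmu Ee; have k0 : 0 < b - a by rewrite subr_gt0.
have := scurve_affine a k0 (ltW ab) cmu.
have := energy_affine rQ a k0 (ltW ab) cmu.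
rewrite subrr mul0r mulfV ?gt_eqF//.
set mu' := _ \o _; set psi' := fun=> _ *: _ => E' c'.
have e0 : 0 <= e by rewrite -lee_fin (le_trans _ Ee)// energy_ge0.
apply: (@le_trans _ _ (sqrte (energy Q 0 1 mu' psi'))); last first.
  rewrite E' (@le_trans _ _ (sqrte ((b - a) * e)%:E))//.
  rewrite lee_sqrt; first by rewrite EFinM lee_wpmul2l// lee_fin ltW.
  by rewrite lee_fin mulr_ge0// ltW.
apply: ereal_inf_lbound; exists mu', psi'; split => //.
- exact/(CE_scurve rQ).
- by rewrite /mu' /= mulr0 add0r.
- by rewrite /mu' /= mulr1 subrK.
Qed.

Lemma Wdist_lt p q (r : R) : (W p q < r%:E)%E ->
  exists mu psi, [/\ scurve Q 0 1 mu psi, mu 0 = p, mu 1 = q &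
    (energy Q 0 1 mu psi < (r ^+ 2)%:E)%E].
Proof.
move=> /ereal_inf_lt[_ [mu [psi [cmu m0 m1 ->]]]].
rewrite -/(energy Q 0 1 mu psi) => Er; exists mu, psi; split => //.
  exact/(CE_scurve rQ).
have E0 := energy_ge0 Q 0 1 mu psi.
move: E0 Er; case: (energy _ _ _ _ _) => [e| |]//=; rewrite lee_fin !lte_fin => e0 er.
rewrite -[e]sqr_sqrtr// ltr_pXn2r// nnegrE ?sqrtr_ge0//.
by rewrite (le_trans _ (ltW er))// sqrtr_ge0.
Qed.

Lemma Wdist_pos_lt p q (r : R) : (W p q < r%:E)%E -> 0 < r.
Proof. by rewrite -lte_fin; apply: le_lt_trans; exact: Wdist_ge0. Qed.

Lemma Wdist_sym_le p q : (W q p <= W p q)%E.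
Proof.
apply: le_ereal_inf_tmp => _ [mu [psi [/(CE_scurve rQ) cmu m0 m1 ->]]].
have := scurve_reverse cmu; have := energy_reverse rQ cmu.
set mu' := _ \o _; set psi' := fun=> _ *: _.
have m'0 : mu' 0 = q by rewrite /mu' /= mulr0 add0r.
have m'1 : mu' 1 = p by rewrite /mu' /= mulr1 addNr.
move: mu' psi' m'0 m'1 => mu' psi' m'0 m'1 E c'.
rewrite -[X in sqrte X]/(energy Q 0 1 mu psi) -E.
apply: ereal_inf_lbound.
exists mu', psi'.
split.
- by apply/(CE_scurve rQ).
- exact: m'0.
- exact: m'1.
- reflexivity.
Qed.

Lemma Wdist_sym p q : W q p = W p q.
Proof. by apply/le_anti; rewrite !Wdist_sym_le. Qed.

(** The two curves are run during times [u] and [v], so that each piece has energy at most its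
    duration ([u^2 / u = u]). The glued curve then has duration and energy at most [u + v]. The
    shift [- (u / v)] starts the second piece at time [u]. *)
Lemma Wdist_triangle_lt p q r (u v : R) :
  (W p q < u%:E)%E -> (W q r < v%:E)%E -> (W p r <= (u + v)%:E)%E.
Proof.
move=> pu qv; have u0 := Wdist_pos_lt pu; have v0 := Wdist_pos_lt qv.
have [m1 [p1 [c1 m10 m11 E1]]] := Wdist_lt pu.
have [m2 [p2 [c2 m20 m21 E2]]] := Wdist_lt qv.
have iu0 : 0 < u^-1 by rewrite invr_gt0.
have iv0 : 0 < v^-1 by rewrite invr_gt0.
have := scurve_affine 0 iu0 ler01 c1; have := energy_affine rQ 0 iu0 ler01 c1.
rewrite subrr mul0r subr0 invrK mul1r.
set M1 := _ \o _; set P1 := fun=> _ *: _ => e1 {}c1.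
have := scurve_affine (- (u / v)) iv0 ler01 c2.
have := energy_affine rQ (- (u / v)) iv0 ler01 c2.
have -> : (0 - - (u / v)) / v^-1 = u by field; rewrite gt_eqF.
have -> : (1 - - (u / v)) / v^-1 = u + v by field; rewrite gt_eqF.
set M2 := _ \o _; set P2 := fun=> _ *: _ => e2 {}c2.
have uv : u <= u + v by rewrite lerDl ltW.
have M12 : M1 u = M2 u.
  rewrite /M1 /M2 /= addr0 mulVf ?gt_eqF// m11 -m20; congr m2.
  by field; rewrite gt_eqF.
have M10 : M1 0 = p by rewrite /M1 /= mulr0 addr0.
have M21 : M2 (u + v) = r by rewrite /M2 /= -m21; congr m2; field; rewrite gt_eqF.
have glued := scurve_glue (ltW u0) uv c1 c2 M12.
have uv0 : 0 < u + v by rewrite addr_gt0.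
have Ele : (energy Q 0 (u + v)%R (cglue u M1 M2) (cglue u P1 P2) <= (u + v)%:E)%E.
  rewrite (energy_glue rQ (ltW u0) uv c1 c2) e1 e2 EFinD; apply: leeD.
    apply: (@le_trans _ _ ((u^-1)%:E * (u ^+ 2)%:E)%E).
      by apply: lee_wpmul2l; rewrite ?lee_fin ltW.
    by rewrite -EFinM lee_fin expr2 mulKf// gt_eqF.
  apply: (@le_trans _ _ ((v^-1)%:E * (v ^+ 2)%:E)%E).
    by apply: lee_wpmul2l; rewrite ?lee_fin ltW.
  by rewrite -EFinM lee_fin expr2 mulKf// gt_eqF.
have := Wdist_le uv0 glued Ele.
rewrite subr0 -expr2 sqrtr_sqr ger0_norm ?(ltW uv0)//.
have uvu : (u + v <= u) = false by rewrite leNgt ltrDl v0.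
by rewrite /cglue (ltW u0) uvu M10 M21.
Qed.

Lemma Rintegral_sum (D : set (measurableTypeR R)) (I : finType) (h : I -> R -> R) :
  measurable D -> (forall i, leb.-integrable D (EFin \o h i)) ->
  \int[leb]_(t in D) (\sum_i h i t) = \sum_i \int[leb]_(t in D) h i t.
Proof.
move=> mD hi.
have E : (\int[leb]_(t in D) (\sum_i h i t)%:E = \sum_i \int[leb]_(t in D) (h i t)%:E)%E.
  by under eq_integral do rewrite -sumEFin; rewrite integral_sum.
rewrite [LHS]/Rintegral E.
have -> : (\sum_i \int[leb]_(t in D) (h i t)%:E = \sum_i (\int[leb]_(t in D) h i t)%:E)%E.
  by apply: eq_bigr => i _; rewrite /Rintegral fineK//; exact: integrable_fin_num (hi i).
by rewrite sumEFin.
Qed.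

(** By Green's formula the time derivative of the pairing with [f] is the Dirichlet form of [psi]
    and [f]; Young's inequality is applied at each time and integrated. The weight [c] is left free,
    to be tuned by each application. *)
Lemma curve_young (a b e c B : R) mu psi (f : 'I_n.+1 -> R) : a <= b ->
  scurve Q a b mu psi -> (energy Q a b mu psi <= e%:E)%E -> 0 < c ->
  (forall t, `[a, b]%classic t -> dirichlet (weight Q (mu t)) f f <= B) ->
  `|\sum_x f x * (mu b 0 x - mu a 0 x)| <= (c * B * (b - a) + c^-1 * e) / 2.
Proof.
move=> ab cmu Ee c0 hB.
have mab : measurable (`[a, b]%classic : set (measurableTypeR R)) by exact: measurable_itv.
have bab : `[a, b]%classic b by rewrite /= in_itv/= ab lexx.
have ifl x : leb.-integrable `[a, b] (EFin \o (fun t => f x * flow Q mu psi x t)).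
  by apply: integrable_mulr => //; exact: sc_flow cmu x.
pose g t := \sum_x f x * flow Q mu psi x t.
have ig : leb.-integrable `[a, b] (EFin \o g).
  have := integrable_sum mab (index_enum 'I_n.+1) (fun x (_ : xpredT x) => ifl x).
  by apply: eq_integrable => // t _ /=; rewrite sumEFin.
have gE t : g t = - dirichlet (weight Q (mu t)) (psi t 0) f.
  by apply: green; exact: weight_sym.
have -> : \sum_x f x * (mu b 0 x - mu a 0 x) = - \int[leb]_(t in `[a, b]) g t.
  have -> : \int[leb]_(t in `[a, b]) g t =
      \sum_x \int[leb]_(t in `[a, b]) (f x * flow Q mu psi x t).
    exact: Rintegral_sum.
  rewrite -sumrN; apply: eq_bigr => x _.
  rewrite (sc_eq cmu x bab) RintegralZl//; last exact: sc_flow cmu x.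
  by ring.
have Efin : energy Q a b mu psi \is a fin_num.
  by rewrite ge0_fin_numE ?energy_ge0// (le_lt_trans Ee)// ltry.
have iact : leb.-integrable `[a, b] (EFin \o (fun t => action Q (mu t) (psi t))).
  apply/integrableP; split; first by apply/measurable_EFinP; exact: (action_measurable rQ ab cmu).
  under eq_integral do rewrite /= ger0_norm ?action_ge0//.
  by rewrite -/(energy Q a b mu psi) (le_lt_trans Ee)// ltry.
have Ee' : \int[leb]_(t in `[a, b]) action Q (mu t) (psi t) <= e.
  by rewrite -lee_fin /Rintegral fineK.
have iyoung : leb.-integrable `[a, b] (EFin \o
    (fun t => (c * B / 2) + (c^-1 / 2) * action Q (mu t) (psi t))).
  have := integrableD mab (continuous_integrable_itv a b (@cst_continuous _ _ (c * B / 2)))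
    (integrable_mulr (c^-1 / 2) mab iact).
  by apply: eq_integrable.
rewrite normrN (le_trans (le_normr_Rintegral mab ig))//.
apply: (@le_trans _ _ (\int[leb]_(t in `[a, b]) ((c * B / 2) + (c^-1 / 2) * action Q (mu t) (psi t)))).
  apply: le_Rintegral => //; first exact: integrable_norm ig.
  move=> t tab; rewrite gE normrN dirichlet_sym action_dirichlet.
  apply: le_trans (dirichlet_young_norm _ _ (weight_ge0 Q (mu t)) c0) _.
  rewrite mulrDl lerD//; last by rewrite mulrAC.
  by rewrite ler_wpM2r// ler_wpM2l ?(ltW c0)// hB.
rewrite RintegralD//; [|exact: continuous_integrable_itv (@cst_continuous _ _ _)|exact: integrable_mulr].
rewrite (Rintegral_cst leb mab) RintegralZl//= lebesgue_measure_itv/= lte_fin.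
have -> : fine (if (a < b)%R then b%:E - a%:E else 0)%E = b - a.
  by move: ab; rewrite le_eqVlt => /predU1P[->|->]//; rewrite ltxx subrr.
have ic : 0 <= c^-1 / 2 by rewrite divr_ge0// invr_ge0 ltW.
have := ler_wpM2l ic Ee'; lra.
Qed.

(** In [curve_young] take the indicator of [x] for [f] and [r] for the weight: both terms become
    linear in [r]. *)
Lemma curve_modulus : exists2 C, 0 < C & forall (r : R) mu psi, 0 < r ->
  scurve Q 0 1 mu psi -> (energy Q 0 1 mu psi <= (r ^+ 2)%:E)%E ->
  forall s t, 0 <= s -> s <= t -> t <= 1 -> forall x, `|mu t 0 x - mu s 0 x| <= C * r.
Proof.
have [C C0 hC] := weight_bounded rQ.
pose B := 2^-1 * \sum_(x : 'I_n.+1) \sum_(y : 'I_n.+1) C.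
have B0 : 0 <= B by rewrite mulr_ge0// sumr_ge0// => x _; rewrite sumr_ge0// => y _; exact: ltW.
exists (B + 1); first by rewrite ltr_wpDl.
move=> r mu psi r0 cmu Er s t s0 st t1 x.
have cst := scurve_restrict s0 st t1 cmu.
have Est : (energy Q s t mu psi <= (r ^+ 2)%:E)%E.
  by apply: le_trans Er; exact: energy_restrict.
pose f (y : 'I_n.+1) : R := (y == x)%:R.
have hB u : `[s, t]%classic u -> dirichlet (weight Q (mu u)) f f <= B.
  move=> ust; rewrite /dirichlet /B ler_wpM2l ?invr_ge0//.
  apply: ler_sum => y _; apply: ler_sum => z _.
  have su := sc_simplex cst ust.
  rewrite -[leRHS]mulr1 ler_pM ?weight_ge0 ?hC// -expr2 ?sqr_ge0//.
  by rewrite /f; case: eqP; case: eqP => _ _ /=; rewrite ?subrr ?subr0 ?sub0r ?sqrrN ?expr0n ?expr1n ?ler01.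
have := curve_young st cst Est r0 hB.
rewrite (bigD1 x)//= big1 ?addr0; last by move=> y /negPf yx; rewrite /f yx mul0r.
rewrite /f eqxx mul1r => /le_trans; apply.
rewrite expr2 mulKf ?gt_eqF//.
have h1 : r * B * (t - s) <= r * B.
  by apply: ler_piMr; [rewrite mulr_ge0// ltW|lra].
have h2 : 0 <= r * B by rewrite mulr_ge0// ltW.
lra.
Qed.

Lemma Wdist0_eq p q : W p q = 0%E -> p = q.
Proof.
move=> pq0; have [C C0 hC] := curve_modulus.
apply/rowP => x; apply/eqP; rewrite eq_sym -subr_eq0 -normr_le0.
apply/ler_addgt0Pl => e e0; rewrite addr0.
have r0 : 0 < e / C by rewrite divr_gt0.
have [|mu [psi [cmu <- <- E]]] := @Wdist_lt p q (e / C); first by rewrite pq0 lte_fin.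
have := hC _ _ _ r0 cmu (ltW E) 0 1 (lexx _) ler01 (lexx _) x.
by rewrite mulrC divfK// gt_eqF.
Qed.

End Transport.

(** * Explicit paths and continuity up to the boundary *)

Section Elliptic.
Variables (R : realType) (n : nat).
Notation V := 'rV[R]_n.+1.
Implicit Types (w : 'I_n.+1 -> 'I_n.+1 -> R) (psi v : V) (A : {set 'I_n.+1}).

Definition cutw w A : R := \sum_(x in A) \sum_(y | y \notin A) w x y.

(** The graph Laplacian plus the all-ones matrix. The added term removes the kernel of constants,
    and for data of zero sum the solution itself has zero sum. *)
Definition lapl_mx w : 'M[R]_n.+1 :=
  \matrix_(x, y) ((x == y)%:R * (\sum_z w x z) - w x y + 1).

Lemma lapl_mxE w psi y : (forall x y, w x y = w y x) ->
  (psi *m lapl_mx w) 0 y = - netflow w (psi 0) y + \sum_x psi 0 x.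
Proof.
move=> ws; rewrite mxE /netflow.
under eq_bigr do rewrite mxE mulrDr mulr1 mulrBr.
rewrite big_split/=; congr (_ + _); rewrite sumrB.
rewrite (bigD1 y)//= eqxx mul1r.
rewrite [X in _ * _ + X]big1 ?addr0; last first.
  by move=> x /negPf ->; rewrite mul0r mulr0.
rewrite mulr_sumr -sumrB -sumrN; apply: eq_bigr => x _.
by rewrite (ws x y); ring.
Qed.

(** Flows between two points of [A] cancel by antisymmetry. *)
Lemma cut_sum w A (f : 'I_n.+1 -> R) : (forall x y, w x y = w y x) ->
  \sum_(x in A) netflow w f x = \sum_(x in A) \sum_(y | y \notin A) w x y * (f y - f x).
Proof.
move=> ws; rewrite /netflow.
have -> : \sum_(x in A) \sum_y w x y * (f y - f x) =
   \sum_(x in A) \sum_(y in A) w x y * (f y - f x) +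
   \sum_(x in A) \sum_(y | y \notin A) w x y * (f y - f x).
  rewrite -big_split; apply: eq_bigr => x _ /=.
  by rewrite (bigID (mem A)).
suff -> : \sum_(x in A) \sum_(y in A) w x y * (f y - f x) = 0 by rewrite add0r.
set S := LHS; suff : S = - S by lra.
rewrite {1}/S exchange_big /= /S -sumrN; apply: eq_bigr => x _.
by rewrite -sumrN; apply: eq_bigr => y _; rewrite (ws y x); ring.
Qed.

Section Solve.
Variable w : 'I_n.+1 -> 'I_n.+1 -> R.
Hypothesis ws : forall x y, w x y = w y x.
Hypothesis w0 : forall x y, 0 <= w x y.
Hypothesis cut_gt0 : forall A x y, x \in A -> y \notin A -> 0 < cutw w A.

(** [psi] takes equal values at the ends of every edge of positive weight, so no such edge leaves
    the level set of [psi 0 x]. As proper cuts have positive capacity, that set is everything. *)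
Lemma dirichlet_eq0_cst psi : dirichlet w (psi 0) (psi 0) = 0 ->
  forall x y, psi 0 x = psi 0 y.
Proof.
move=> d0.
have edge x y : 0 < w x y -> psi 0 x = psi 0 y.
  move=> wxy; move/eqP : d0; rewrite mulf_eq0 invr_eq0 pnatr_eq0/=.
  have term0 u z : 0 <= w u z * ((psi 0 z - psi 0 u) * (psi 0 z - psi 0 u)).
    by rewrite mulr_ge0// -expr2 sqr_ge0.
  rewrite psumr_eq0 => [|u _]; last by apply: sumr_ge0.
  move=> /allP/(_ x (mem_index_enum _))/=; rewrite psumr_eq0 => [|u _]; last exact: term0.
  move=> /allP/(_ y (mem_index_enum _))/=.
  by rewrite mulf_eq0 (gt_eqF wxy)/= mulf_eq0 orbb subr_eq0 => /eqP.
move=> x y; pose A : {set 'I_n.+1} := [set z | psi 0 z == psi 0 x]%SET.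
have Ax : x \in A by rewrite inE.
have [|Ay] := boolP (y \in A); first by rewrite inE => /eqP.
have := cut_gt0 Ax Ay; rewrite /cutw big1 ?ltxx// => u uA; rewrite big1// => z zA.
apply/eqP; rewrite eq_le w0 andbT leNgt; apply/negP => /edge uz.
by move: uA zA; rewrite !inE uz => ->.
Qed.

(** Summing the equation shows that a kernel vector has zero sum; it is then harmonic, hence
    constant, hence zero. *)
Lemma lapl_mx_unit : lapl_mx w \in unitmx.
Proof.
rewrite -row_free_unit; apply: inj_row_free => psi psi0.
have key y : - netflow w (psi 0) y + \sum_x psi 0 x = 0.
  by rewrite -lapl_mxE// psi0 mxE.
have sum0 : \sum_x psi 0 x = 0.
  have : \sum_y (- netflow w (psi 0) y + \sum_x psi 0 x) = 0 by rewrite big1.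
  rewrite big_split/= sumrN (sum_netflow _ ws) oppr0 add0r sumr_const card_ord.
  by move/eqP; rewrite mulrn_eq0 => /eqP.
have nf y : netflow w (psi 0) y = 0 by have := key y; rewrite sum0; lra.
have d0 : dirichlet w (psi 0) (psi 0) = 0.
  by apply/eqP; rewrite -oppr_eq0 -green// big1// => x _; rewrite nf mulr0.
have c := dirichlet_eq0_cst d0; apply/rowP => y; rewrite mxE.
move: sum0; rewrite (eq_bigr (fun=> psi 0 y)) => [|x _]; last exact: c.
by rewrite sumr_const card_ord => /eqP; rewrite mulrn_eq0 => /eqP.
Qed.

(** The inverse matrix is written through the adjugate, so that the potential depends measurably on
    the weights by an explicit formula. *)
Definition potential_of v : V := v *m ((\det (lapl_mx w))^-1 *: \adj (lapl_mx w)).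

Lemma potential_ofP v : \sum_x v 0 x = 0 ->
  \sum_x potential_of v 0 x = 0 /\ forall x, - netflow w (potential_of v 0) x = v 0 x.
Proof.
move=> v0; set psi := potential_of v.
have psiL : psi *m lapl_mx w = v.
  have := mulmxKV lapl_mx_unit v; rewrite /invmx lapl_mx_unit; exact.
have key y : - netflow w (psi 0) y + \sum_x psi 0 x = v 0 y by rewrite -lapl_mxE// psiL.
have sum0 : \sum_x psi 0 x = 0.
  have : \sum_y (- netflow w (psi 0) y + \sum_x psi 0 x) = 0.
    by apply: etrans v0; apply: eq_bigr => y _; exact: key.
  rewrite big_split/= sumrN (sum_netflow _ ws) oppr0 add0r sumr_const card_ord.
  by move/eqP; rewrite mulrn_eq0 => /eqP.
by split=> // x; rewrite -key sum0 addr0.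
Qed.

(* The upper level sets of [psi] grow by at least one point each time the level
   decreases by [beta]: otherwise the flow through the boundary of the level
   set would exceed [beta] times its capacity. *)
Lemma potential_osc psi v (beta : R) : 0 <= beta ->
  (forall x, - netflow w (psi 0) x = v 0 x) ->
  (forall A x y, x \in A -> y \notin A -> `|\sum_(z in A) v 0 z| <= beta * cutw w A) ->
  forall x y, psi 0 x - psi 0 y <= n%:R * beta.
Proof.
move=> b0 hpsi hv x y.
pose z := [arg max_(i > ord0) psi 0 i]%O.
have zmax i : psi 0 i <= psi 0 z.
  by rewrite /z; case: arg_maxP => // j _ /(_ i isT).
pose A k : {set 'I_n.+1} := [set i | psi 0 z - k%:R * beta <= psi 0 i]%SET.
have cardA k : (k <= n)%N -> (k < #|A k|)%N.
  elim: k => [_|k IHk kn].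
    by apply/card_gt0P; exists z; rewrite inE mul0r subr0.
  have Asub : A k \subset A k.+1.
    apply/fintype.subsetP => i; rewrite !inE => /(le_trans _); apply.
    by rewrite lerD2l lerN2 ler_wpM2r// ler_nat.
  have [j0 j0A|full] := pickP [pred j | j \notin A k]; last first.
    have AT : A k = [set: 'I_n.+1]%SET.
      by apply/setP => j; rewrite finset.in_setT; have /negbFE := full j.
    by apply: leq_trans (subset_leq_card Asub); rewrite AT cardsT card_ord.
  have [i0 i0A] : exists i, i \in A k by apply/card_gt0P; exact: leq_ltn_trans (IHk (ltnW kn)).
  have [/existsP[i /andP[iA iA1]]|/existsPn none] :=
      boolP [exists i, (i \notin A k) && (i \in A k.+1)].
    apply: leq_ltn_trans (IHk (ltnW kn)) _; apply: proper_card.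
    by apply/properP; split => //; exists i.
  exfalso; have := hv _ _ _ i0A j0A; rewrite leNgt => /negP; apply.
  have gap i j : i \in A k -> j \notin A k -> beta < psi 0 i - psi 0 j.
    move=> iA jA; have := none j; rewrite jA/= !inE -ltNge => jA1.
    move: iA; rewrite inE => iA; move: jA1; rewrite -natr1; lra.
  rewrite (eq_bigr (fun i => - netflow w (psi 0) i)) => [|i _]; last by rewrite hpsi.
  rewrite sumrN cut_sum// normrN -normrN -sumrN (lt_le_trans _ (ler_norm _))//.
  rewrite -subr_gt0 /cutw mulr_sumr -sumrB.
  have c0 := cut_gt0 i0A j0A.
  have termge i j : i \in A k -> j \notin A k ->
      0 <= w i j * (psi 0 i - psi 0 j - beta).
    by move=> iA jA; rewrite mulr_ge0// subr_ge0 ltW// gap.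
  have -> : \sum_(i in A k) (- (\sum_(j | j \notin A k) w i j * (psi 0 j - psi 0 i)) -
      beta * (\sum_(j | j \notin A k) w i j)) =
      \sum_(i in A k) \sum_(j | j \notin A k) w i j * (psi 0 i - psi 0 j - beta).
    apply: eq_bigr => i _; rewrite -sumrN mulr_sumr -sumrB.
    by apply: eq_bigr => j _; ring.
  rewrite lt_neqAle eq_sym; apply/andP; split; last first.
    by apply: sumr_ge0 => i iA; apply: sumr_ge0 => j jA; exact: termge.
  apply/negP; rewrite psumr_eq0; last by move=> i iA; apply: sumr_ge0 => j jA; exact: termge.
  move=> /allP zero; move: c0; rewrite /cutw big1 ?ltxx// => i iA; rewrite big1// => j jA.
  have /implyP/(_ iA) := zero i (mem_index_enum _).
  rewrite psumr_eq0; last by move=> j' jA'; exact: termge.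
  move=> /allP/(_ j (mem_index_enum _))/implyP/(_ jA).
  by rewrite mulf_eq0 subr_eq0 (gt_eqF (gap _ _ iA jA)) orbF => /eqP.
have : y \in A n.
  have /eqP -> : A n == [set: 'I_n.+1]%SET.
    by rewrite eqEcard finset.subsetT cardsT card_ord; exact: cardA.
  by rewrite finset.in_setT.
by rewrite inE; have := zmax x; lra.
Qed.

(** A function of zero sum is bounded by its oscillation, and by Green's formula its Dirichlet
    energy is its pairing with [v]. *)
Lemma potential_of_bound v (beta : R) : 0 <= beta -> \sum_x v 0 x = 0 ->
  (forall A x y, x \in A -> y \notin A -> `|\sum_(z in A) v 0 z| <= beta * cutw w A) ->
  (forall x, `|potential_of v 0 x| <= n%:R * beta) /\
  dirichlet w (potential_of v 0) (potential_of v 0) <= n%:R * beta * \sum_x `|v 0 x|.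
Proof.
move=> b0 v0 hv; have [sum0 hpsi] := potential_ofP v0.
have osc := potential_osc b0 hpsi hv; set psi := potential_of v in sum0 hpsi osc *.
have bound x : `|psi 0 x| <= n%:R * beta.
  have avg (c : R) : \sum_(y : 'I_n.+1) c = n.+1%:R * c.
    by rewrite sumr_const card_ord mulr_natl.
  have N0 : (0 : R) < n.+1%:R by rewrite ltr0n.
  rewrite ler_norml; apply/andP; split.
    rewrite -(ler_pM2l N0) -avg -subr_ge0 -avg -sumrB.
    have -> : \sum_(i < n.+1) (psi 0 x - - (n%:R * beta)) =
        \sum_y (n%:R * beta - (psi 0 y - psi 0 x)).
      apply/eqP; rewrite -subr_eq0 -sumrB (eq_bigr (psi 0)) ?sum0// => y _; ring.
    by apply: sumr_ge0 => y _; rewrite subr_ge0 osc.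
  rewrite -(ler_pM2l N0) -!avg -subr_ge0 -sumrB.
  have -> : \sum_(i < n.+1) (n%:R * beta - psi 0 x) =
      \sum_y (n%:R * beta - (psi 0 x - psi 0 y)).
    apply/eqP; rewrite -subr_eq0 -sumrB (eq_bigr (fun y => - psi 0 y)) => [|y _]; last ring.
    by rewrite sumrN sum0 oppr0.
  by apply: sumr_ge0 => y _; rewrite subr_ge0 osc.
split=> //.
have -> : dirichlet w (psi 0) (psi 0) = \sum_x psi 0 x * v 0 x.
  apply: oppr_inj; rewrite -green// -sumrN.
  by apply: eq_bigr => x _; rewrite -hpsi mulrN opprK.
rewrite mulr_sumr; apply: ler_sum => x _; rewrite (le_trans (ler_norm _))//.
by rewrite normrM ler_wpM2r.
Qed.

End Solve.
End Elliptic.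

(** * Measurability of determinants and adjugates *)

Section MeasurableLinearAlgebra.
Variables (d : measure_display) (T : measurableType d) (R : realType) (D : set T).

(** Writing the inverse as [f * (f^2)^(-1)] reduces it to a real power of a nonnegative number; both
    sides vanish where [f] does. *)
Lemma measurable_fun_inv (f : T -> R) : measurable_fun D f -> measurable_fun D (fun t => (f t)^-1).
Proof.
move=> mf.
have -> : (fun t => (f t)^-1) = f \* (fun t => (f t ^+ 2) `^ (-1)).
  apply/funext => t /=; rewrite powR_inv1 ?sqr_ge0//.
  have [->|f0] := eqVneq (f t) 0; first by rewrite invr0 mul0r.
  by rewrite expr2 invfM mulrA mulfV// mul1r.
apply: measurable_funM => //.
apply: (measurableT_comp (measurable_powR _)); exact: measurable_funX.
Qed.

Lemma measurable_det m (A : T -> 'M[R]_m) :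
  (forall i j, measurable_fun D (fun t => A t i j)) -> measurable_fun D (fun t => \det (A t)).
Proof.
move=> mA; apply: measurable_sum => s; apply: measurable_funM => //.
exact: measurable_prod.
Qed.

Lemma measurable_adj m (A : T -> 'M[R]_m) :
  (forall i j, measurable_fun D (fun t => A t i j)) ->
  forall i j, measurable_fun D (fun t => \adj (A t) i j).
Proof.
case: m A => [|m] A mA i j; first by case: i.
apply: (eq_measurable_fun (fun t => (-1) ^+ (j + i) * \det (row' j (col' i (A t))))).
  by move=> t _; rewrite mxE.
apply: measurable_funM => //; apply: measurable_det => a b.
by under eq_fun do rewrite !mxE; exact: mA.
Qed.

End MeasurableLinearAlgebra.

(** * The cost of a path with prescribed velocity *)

Section PathCost.
Variables (R : realType) (n : nat) (Q : 'rV[R]_n.+1 -> 'M[R]_n.+1).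
Hypothesis rQ : regular_rates Q.
Notation leb := (@lebesgue_measure R).
Notation V := 'rV[R]_n.+1.
Variables (T beta C : R) (m v : R -> V).
Hypotheses (T0 : 0 < T) (beta0 : 0 <= beta).
Hypothesis dm : forall x (t : R), is_derive t 1 (fun s => m s 0 x) (v t 0 x).
Hypothesis cv : forall x, continuous (fun t => v t 0 x).
Hypothesis sm : forall t : R, `[0, T]%classic t -> simplex (m t).
Hypothesis v0 : forall t : R, `[0, T]%classic t -> \sum_x v t 0 x = 0.
Hypothesis vC : forall t : R, `[0, T]%classic t -> \sum_x `|v t 0 x| <= C.
(** The first alternative is meant for the starting time of a path issued from the boundary, where
    cuts may have capacity 0. *)
Hypothesis vcut : forall t : R, `[0, T]%classic t -> v t = 0 \/
  forall (A : {set 'I_n.+1}) x y, x \in A -> y \notin A ->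
    0 < cutw (weight Q (m t)) A /\ `|\sum_(z in A) v t 0 z| <= beta * cutw (weight Q (m t)) A.

Let psi t : V := potential_of (weight Q (m t)) (v t).

Let spec (t : R) : `[0, T]%classic t ->
  [/\ forall x, - netflow (weight Q (m t)) (psi t 0) x = v t 0 x,
      forall x, `|psi t 0 x| <= n%:R * beta &
      action Q (m t) (psi t) <= n%:R * beta * C].
Proof.
move=> tT; have ws := weight_sym Q (m t); have w0 := weight_ge0 Q (m t).
have nb0 : 0 <= n%:R * beta by rewrite mulr_ge0.
have Cge0 : 0 <= C by apply: le_trans (vC tT); exact: sumr_ge0.
case: (vcut tT) => [vt0|cutP].
  have p0 : psi t = 0 by rewrite /psi /potential_of vt0 mul0mx.
  have nf x : netflow (weight Q (m t)) (psi t 0) x = 0.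
    by rewrite /netflow p0 big1// => y _; rewrite !mxE subrr mulr0.
  split=> [x|x|].
  - by rewrite nf vt0 mxE oppr0.
  - by rewrite p0 mxE normr0.
  - rewrite action_dirichlet -[X in X <= _]opprK -green// big1 ?oppr0 ?mulr_ge0// => x _.
    by rewrite nf mulr0.
have cpos (A : {set 'I_n.+1}) x y : x \in A -> y \notin A -> 0 < cutw (weight Q (m t)) A.
  by move=> xA yA; case: (cutP A x y xA yA).
have cbd (A : {set 'I_n.+1}) x y : x \in A -> y \notin A ->
    `|\sum_(z in A) v t 0 z| <= beta * cutw (weight Q (m t)) A.
  by move=> xA yA; case: (cutP A x y xA yA).
have [_ hpsi] := potential_ofP ws w0 cpos (v0 tT).
have [bpsi dpsi] := potential_of_bound ws w0 cpos beta0 (v0 tT) cbd.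
split=> //; rewrite action_dirichlet (le_trans dpsi)// ler_wpM2l//.
exact: vC.
Qed.

Let mcont : {within `[0, T], continuous m}.
Proof.
apply/within_continuous_coordP => x; apply: continuous_subspaceT => t.
by apply: differentiable_continuous; apply/derivable1_diffP; case: (dm x t).
Qed.

Let mpsi x : measurable_fun `[0, T] (fun t => psi t 0 x).
Proof.
have mv y : measurable_fun `[0, T] (fun t => v t 0 y).
  by apply: measurable_funTS; exact: continuous_measurable_fun.
have mw y z : measurable_fun `[0, T] (fun t => weight Q (m t) y z).
  exact: weight_measurable.
have mL y z : measurable_fun `[0, T] (fun t => lapl_mx (weight Q (m t)) y z).
  apply: (eq_measurable_fun (fun t => (y == z)%:R * (\sum_u weight Q (m t) y u) -
    weight Q (m t) y z + 1)); first by move=> t _; rewrite mxE.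
  apply: measurable_funD => //; apply: measurable_funB => //.
  by apply: measurable_funM => //; exact: measurable_sum.
pose L t := lapl_mx (weight Q (m t)).
apply: (eq_measurable_fun (fun t => \sum_y v t 0 y * ((\det (L t))^-1 * (\adj (L t)) y x))).
  move=> t _; rewrite /psi /potential_of mxE; apply: eq_bigr => y _.
  by congr (_ * _); rewrite [RHS]mxE.
apply: measurable_sum => y; apply: measurable_funM => //.
apply: measurable_funM; last exact: measurable_adj.
by apply: measurable_fun_inv; exact: measurable_det.
Qed.

Lemma path_scurve : scurve Q 0 T m psi.
Proof.
have mT : measurable (`[0, T]%classic : set (measurableTypeR R)) by exact: measurable_itv.
have flowE x t : `[0, T]%classic t -> flow Q m psi x t = - v t 0 x.
  by move=> tT; rewrite /flow -[LHS]opprK; have [-> _ _] := spec tT.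
have ipsi x : leb.-integrable `[0, T] (fun t => (psi t 0 x)%:E).
  apply: measurable_bounded_integrable => //.
    by rewrite /= lebesgue_measure_itv/= lte_fin T0 -EFinB ltry.
    exact: mpsi.
  exists (n%:R * beta); split; first exact: num_real.
  move=> M bM t /= tT; rewrite (le_trans _ (ltW bM))//.
  by have [_ bpsi _] := spec tT; exact: bpsi.
split=> // [x|x t tT]; first exact: flow_integrable.
have [t0 tT'] : 0 <= t /\ t <= T by apply/andP; rewrite /= in_itv/= in tT.
have -> : \int[leb]_(s in `[0, t]) flow Q m psi x s = \int[leb]_(s in `[0, t]) (-1 * v s 0 x).
  apply: eq_Rintegral => s; rewrite inE/= in_itv/= => /andP[s0 st].
  by rewrite flowE ?mulN1r//= in_itv/= s0 (le_trans st).
have iv := continuous_integrable_itv 0 t (@cv x).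
rewrite RintegralZl//.
by rewrite (FTC_everywhere t0 (@cv x) (dm x)); ring.
Qed.

Lemma path_cost : (Wdist Q (m 0) (m T) <= (T * Num.sqrt (n%:R * beta * C))%:E)%E.
Proof.
have E : (energy Q 0 T m psi <= (T * (n%:R * beta * C))%R%:E)%E.
  rewrite /energy; have -> : (T * (n%:R * beta * C))%R%:E =
      (\int[leb]_(t in `[0%R, T]) (n%:R * beta * C)%R%:E)%E.
    rewrite integral_cst//= lebesgue_measure_itv/= lte_fin T0 oppr0 adde0 -EFinM.
    by rewrite mulrC.
  apply: ge0_le_integral => //.
  - by move=> t _; rewrite lee_fin action_ge0.
  - by apply/measurable_EFinP; exact: (action_measurable rQ (ltW T0) path_scurve).
  - by move=> t tT; rewrite lee_fin; case: (spec tT).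
have := Wdist_le rQ T0 path_scurve E.
rewrite subr0 mulrA -expr2 sqrtrM ?sqr_ge0// sqrtr_sqr ger0_norm//; exact: ltW.
Qed.

End PathCost.

(** The inverse of one plus the sum of the inverses, which unlike a minimum also makes sense when no
    value is positive. *)
Lemma positive_min (R : realType) (I : finType) (f : I -> R) :
  exists2 q, 0 < q & forall i, 0 < f i -> q <= f i.
Proof.
pose S := 1 + \sum_i (if 0 < f i then (f i)^-1 else 0).
have T0 i : 0 <= (if 0 < f i then (f i)^-1 else 0).
  by case: ifP => // fi; rewrite invr_ge0 ltW.
have S0 : 0 < S by rewrite /S ltr_wpDr// sumr_ge0.
exists S^-1 => [|i fi]; first by rewrite invr_gt0.
rewrite -[leRHS]invrK lef_pV2 ?posrE ?invr_gt0//.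
rewrite /S (bigD1 i)//= fi addrCA lerDl addr_ge0// sumr_ge0//.
Qed.

Section GraphDistance.
Variables (T : finType) (e : rel T).
Hypothesis conn : forall x y, connect e x y.

(** Take the length of a shortest path; the vertex before the last one is the neighbour closer to
    [z]. *)
Lemma graph_distance : exists h : T -> T -> nat,
  (forall z x, (h z x == 0%N) = (x == z)) /\
  (forall z x, x != z -> exists2 u, e u x & (h z u < h z x)%N).
Proof.
pose P z x k := [exists p : k.-tuple T, path e z p && (last z p == x)].
have exP z x : exists k, P z x k.
  have /connectP[p zp ->] := conn z x; exists (size p).
  by apply/existsP; exists (in_tuple p); rewrite zp eqxx.
pose h z x := ex_minn (exP z x).
have hP z x : P z x (h z x) by rewrite /h; case: ex_minnP.
have hmin z x (p : seq T) : path e z p -> last z p = x -> (h z x <= size p)%N.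
  move=> zp lx; rewrite /h; case: ex_minnP => k _; apply.
  by apply/existsP; exists (in_tuple p); rewrite zp lx eqxx.
exists h; split => z x.
  apply/eqP/eqP => [h0|->].
    have := hP z x; rewrite h0 => /existsP[p /andP[_ /eqP <-]].
    by rewrite (tuple0 p).
  by apply/eqP; rewrite -leqn0; exact: (hmin z z [::]).
move=> xz; have /existsP[[p /= /eqP sp] /andP[]] := hP z x.
case/lastP: p sp => [|p y]; first by move=> _ _ /= /eqP zx; rewrite zx eqxx in xz.
rewrite size_rcons rcons_path last_rcons => sp /andP[zp ey] /eqP yx.
exists (last z p); first by rewrite -yx.
by rewrite -sp ltnS; exact: hmin.
Qed.

(** Walk from [x] towards [z] with decreasing distance until [A] is entered. The bounds on [h] at
    both ends of the edge bound the masses there from below along [spread]. *)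
Lemma crossing_edge (h : T -> T -> nat) :
  (forall z x, x != z -> exists2 u, e u x & (h z u < h z x)%N) ->
  forall (A : pred T) z x, A z -> ~~ A x ->
  exists u w, [/\ A u, ~~ A w, e u w, (h z u < h z x)%N & (h z w <= h z x)%N].
Proof.
move=> hP A z x Az; move: {2}(h z x).+1 (ltnSn (h z x)) => k.
elim: k x => // k IHk x; rewrite ltnS => hk Ax.
have xz : x != z by apply: contraNneq Ax => ->.
have [u eux hu] := hP _ _ xz.
have [Au|Au] := boolP (A u); first by exists u, x.
have [u' [w' [? ? ? h1 h2]]] := IHk u (leq_trans hu hk) Au.
exists u', w'; split => //; first exact: ltn_trans hu.
exact: leq_trans h2 (ltnW hu).
Qed.

End GraphDistance.

(** * Rates of a Markov triple and the graph they define *)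

Section TripleRates.
Variables (R : realType) (n : nat).
Variables (K : 'rV[R]_n.+1 -> 'I_n.+1 -> R) (Q : 'rV[R]_n.+1 -> 'M[R]_n.+1).
Hypothesis triple : nonlinear_markov_triple K Q.
Notation V := 'rV[R]_n.+1.

Lemma triple_regular : regular_rates Q.
Proof.
split=> [mu smu x y xy|]; first by case: (triple_rates triple smu) => h _; exact: h.
have hxy (z : 'I_n.+1 * 'I_n.+1) : exists L, 0 < L /\ forall p q, simplex p -> simplex q ->
    `|Q p z.1 z.2 - Q q z.1 z.2| <= L * `|p - q|.
  have := triple_lipschitz triple z.1 z.2.
  move=> [M [Mr hM]]; exists (`|M| + 1); split; first by rewrite ltr_wpDl.
  move=> p q sp sq.
  have MM : M < `|M| + 1 by rewrite (le_lt_trans (ler_norm _))// ltrDl.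
  by have := hM _ MM (p, q) (conj sp sq).
have [L hL] := choice hxy.
exists (1 + \sum_z L z).
  by rewrite ltr_wpDr// sumr_ge0// => z _; case: (hL z) => /ltW.
move=> p q sp sq x y; case: (hL (x, y)) => L0 /(_ p q sp sq) /le_trans; apply.
rewrite ler_wpM2r// (bigD1 (x, y))//= addrCA lerDl addr_ge0// sumr_ge0// => z _.
by case: (hL z) => /ltW.
Qed.

Lemma gibbs_gt0 mu x : 0 < gibbs K mu x.
Proof.
rewrite mulr_gt0 ?expR_gt0// invr_gt0 /partition_function (bigD1 x)//=.
by rewrite ltr_pwDl ?expR_gt0// sumr_ge0// => y _; exact: expR_ge0.
Qed.

Lemma rate_gt0_sym mu x y : simplex mu -> 0 < Q mu x y -> 0 < Q mu y x.
Proof.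
move=> smu Qxy; have := triple_reversible triple smu x y.
have gx := gibbs_gt0 mu x; have gy := gibbs_gt0 mu y => E.
have := mulr_gt0 gx Qxy; rewrite E; move: (gibbs K mu y) gy => g g0.
by rewrite pmulr_rgt0.
Qed.

Lemma rate_gt0_neq mu x y : simplex mu -> 0 < Q mu x y -> x != y.
Proof.
move=> smu Qxy; apply: contraTneq Qxy => <-; rewrite -leNgt.
case: (triple_rates triple smu) => h ->; rewrite oppr_le0 sumr_ge0// => z zx.
by apply: h; rewrite eq_sym.
Qed.

(** The graph of positive rates at [mu] can thus serve for all nearby points; edges that appear only
    there are ignored. *)
Lemma uniform_rates mu : simplex mu -> exists c r, [/\ 0 < c, 0 < r &
  forall nu, simplex nu -> `|nu - mu| <= r -> forall x y, 0 < Q mu x y -> c <= Q nu x y].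
Proof.
move=> smu; have [L L0 hL] := rates_lipschitz triple_regular.
have [q q0 hq] := positive_min (fun z : 'I_n.+1 * 'I_n.+1 => Q mu z.1 z.2).
exists (q / 2), (q / (2 * L)); split; [by rewrite divr_gt0|by rewrite divr_gt0// mulr_gt0|].
move=> nu snu hr x y Qxy; have := hL _ _ snu smu x y; have := hq (x, y) Qxy => /= h1 h2.
have : `|Q nu x y - Q mu x y| <= q / 2.
  rewrite (le_trans h2)// -(ler_pdivlMl _ _ L0) (le_trans hr)//.
  by rewrite le_eqVlt; apply/orP; left; apply/eqP; field; rewrite gt_eqF.
by rewrite ler_norml => /andP[]; lra.
Qed.

End TripleRates.

(** * Paths along segments and out of the boundary *)

Section BoundaryPath.
Variables (R : realType) (n : nat) (Q : 'rV[R]_n.+1 -> 'M[R]_n.+1).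
Hypothesis rQ : regular_rates Q.
Notation V := 'rV[R]_n.+1.
Notation N := (n.+1%:R : R).
Variables (e : rel 'I_n.+1) (h : 'I_n.+1 -> 'I_n.+1 -> nat) (D : nat) (c : R).
Hypothesis c0 : 0 < c.
Hypothesis esym : forall x y, e x y -> e y x.
Hypothesis eneq : forall x y, e x y -> x != y.
Hypothesis h0 : forall z x, (h z x == 0%N) = (x == z).
Hypothesis hD : forall z x, (h z x <= D)%N.
Hypothesis hstep : forall z x, x != z -> exists2 u, e u x & (h z u < h z x)%N.

Definition good (q : V) := simplex q /\ forall x y, e x y -> c <= Q q x y.

(** A single edge across the cut already gives a lower bound, because the logarithmic mean dominates
    the geometric mean. *)
Lemma cutw_edge (q : V) (A : {set 'I_n.+1}) u w : good q -> e u w ->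
  u \in A -> w \notin A -> c * Num.sqrt (q 0 u * q 0 w) <= cutw (weight Q q) A.
Proof.
move=> [sq hq] uw uA wA.
have hL x y : e x y -> c * Num.sqrt (q 0 x * q 0 y) <= Lambda Q q x y.
  move=> xy; rewrite mxE; have yx := esym xy.
  have q0 z : 0 <= q 0 z by exact: simplex_ge0.
  have Q0 a b : e a b -> 0 <= Q q a b by move=> ab; rewrite (le_trans (ltW c0))// hq.
  apply: le_trans (sqrt_le_log_mean _ _); rewrite ?mulr_ge0 ?Q0//.
  have -> : c * Num.sqrt (q 0 x * q 0 y) = Num.sqrt (c ^+ 2 * (q 0 x * q 0 y)).
    by rewrite (sqrtrM (q 0 x * q 0 y) (sqr_ge0 c)) sqrtr_sqr gtr0_norm.
  rewrite ler_sqrt ?mulr_ge0 ?Q0//.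
  have -> : q 0 x * Q q x y * (q 0 y * Q q y x) = Q q x y * Q q y x * (q 0 x * q 0 y) by ring.
  by rewrite ler_wpM2r ?mulr_ge0// expr2 ler_pM ?(ltW c0) ?hq.
apply: (@le_trans _ _ (weight Q q u w)).
  rewrite /weight (negPf (eneq uw)).
  have := hL _ _ uw; have := hL _ _ (esym uw); rewrite [q 0 w * _]mulrC; lra.
rewrite /cutw (bigD1 u)//= (bigD1 w)//= -addrA lerDl addr_ge0// ?sumr_ge0// => [z _|z _].
  exact: weight_ge0.
by rewrite sumr_ge0// => y _; exact: weight_ge0.
Qed.

Lemma cross (A : {set 'I_n.+1}) z x : z \in A -> x \notin A ->
  exists u w, [/\ u \in A, w \notin A, e u w, (h z u < h z x)%N & (h z w <= h z x)%N].
Proof. by move=> zA xA; exact: (crossing_edge hstep (A := mem A)). Qed.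

(** Along the segment all masses are at least [a], so every proper cut has capacity at least
    [c * a], while the flow through it is at most [S]: [path_cost] applies with
    [beta = S / (c * a)]. *)
Lemma line_cost (p q : V) (a : R) : 0 < a ->
  (forall t, 0 <= t -> t <= 1 -> good (p + t *: (q - p))) ->
  (forall x, a <= p 0 x) -> (forall x, a <= q 0 x) ->
  (Wdist Q p q <= ((\sum_x `|q 0 x - p 0 x|) * Num.sqrt (n%:R / (c * a)))%:E)%E.
Proof.
move=> a0 gpq pa qa; set S := \sum_x _.
have S0 : 0 <= S by exact: sumr_ge0.
have ca0 : 0 < c * a by exact: mulr_gt0.
pose m t : V := p + t *: (q - p).
have mE t x : m t 0 x = p 0 x + t * (q 0 x - p 0 x) by rewrite !mxE.
have sp : simplex p by have := gpq 0 (lexx _) ler01; rewrite scale0r addr0 => -[].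
have sq : simplex q by have := gpq 1 ler01 (lexx _); rewrite scale1r addrC subrK => -[].
have m0 : m 0 = p by rewrite /m scale0r addr0.
have m1 : m 1 = q by rewrite /m scale1r addrC subrK.
suff : (Wdist Q (m 0%R) (m 1%R) <= (1 * Num.sqrt (n%:R * (S / (c * a)) * S))%:E)%E.
  rewrite m0 m1 mul1r.
  have -> : n%:R * (S / (c * a)) * S = S ^+ 2 * (n%:R / (c * a)) by field; rewrite !gt_eqF.
  by rewrite (sqrtrM (n%:R / (c * a)) (sqr_ge0 S)) sqrtr_sqr ger0_norm.
have mem01 (t : R) : `[0, 1]%classic t -> 0 <= t /\ t <= 1 by rewrite /= in_itv/= => /andP[].
have vx x : (q - p) 0 x = q 0 x - p 0 x by rewrite !mxE.
apply: (@path_cost _ _ _ rQ 1 _ _ m (fun=> q - p)) => //.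
- by rewrite divr_ge0// ltW.
- move=> x t; pose P : {poly R} := (p 0 x)%:P + 'X * (q 0 x - p 0 x)%:P.
  have -> : (fun s => m s 0 x) = horner P.
    by apply/funext => s; rewrite /P !hornerE mE /=; ring.
  apply: (is_derive_eq (is_derive_poly P t)).
  by rewrite /P !(derivM, derivC, derivD, derivX) !hornerE vx/=; ring.
- by move=> x t; exact: cvg_cst.
- by move=> t /mem01[t0 t1]; case: (gpq t t0 t1).
- move=> t _; under eq_bigr do rewrite vx.
  by rewrite sumrB (proj2 sp) (proj2 sq) subrr.
- by move=> t _; under eq_bigr do rewrite vx.
move=> t /mem01[t0 t1]; right => A x y xA yA.
have [u [w [uA wA uw _ _]]] := cross xA yA.
have ma z : a <= m t 0 z.
  rewrite mE; have := pa z; have := qa z => h1 h2.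
  have : 0 <= t * (q 0 z - a) by rewrite mulr_ge0// subr_ge0.
  have : 0 <= (1 - t) * (p 0 z - a) by rewrite mulr_ge0// subr_ge0.
  lra.
have : c * a <= cutw (weight Q (m t)) A.
  apply: le_trans (cutw_edge (gpq t t0 t1) uw uA wA).
  rewrite ler_wpM2l ?(ltW c0)//.
  have -> : a = Num.sqrt (a ^+ 2) by rewrite sqrtr_sqr gtr0_norm.
  by rewrite ler_sqrt ?mulr_ge0 ?(le_trans (ltW a0))// expr2 ler_pM// ltW.
move=> cutge; split; first exact: lt_le_trans cutge.
apply: (@le_trans _ _ S).
  apply: le_trans (ler_norm_sum _ _ _) _; under eq_bigr do rewrite vx.
  by rewrite /S [leRHS](bigID (mem A))/= lerDl sumr_ge0.
by rewrite mulrAC ler_pdivlMr// ler_wpM2l.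
Qed.

(* [path_poly z x] is the fraction of the mass started at [z] that has reached
   [x]: of order [s ^ (2 h z x)], so that neighbouring masses are comparable up
   to a factor [s ^ 2]. *)
Definition path_poly z x : {poly R} :=
  if x == z then 1 - \sum_(y | y != z) 'X^(2 * h z y) else 'X^(2 * h z x).

Let hpos z x : x != z -> (0 < h z x)%N.
Proof. by rewrite lt0n h0. Qed.

Lemma path_poly_sum z : \sum_x path_poly z x = 1.
Proof.
rewrite (bigD1 z)//= {1}/path_poly eqxx.
have -> : \sum_(x | x != z) path_poly z x = \sum_(x | x != z) 'X^(2 * h z x).
  by apply: eq_bigr => x /negPf xz; rewrite /path_poly xz.
by rewrite subrK.
Qed.

Lemma path_polyE z x (s : R) : x != z -> (path_poly z x).[s] = s ^+ (2 * h z x).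
Proof. by move=> /negPf xz; rewrite /path_poly xz hornerXn. Qed.

Lemma path_poly_diag z (s : R) : (path_poly z z).[s] = 1 - \sum_(y | y != z) s ^+ (2 * h z y).
Proof.
rewrite /path_poly eqxx hornerD hornerN hornerC horner_sum.
by congr (_ - _); apply: eq_bigr => y _; rewrite hornerXn.
Qed.

Lemma path_poly_deriv z x (s : R) : x != z ->
  (path_poly z x)^`().[s] = (2 * h z x)%:R * s ^+ (2 * h z x).-1.
Proof.
by move=> /negPf xz; rewrite /path_poly xz derivXn hornerMn hornerXn mulr_natl.
Qed.

Lemma path_poly_deriv_diag z (s : R) :
  (path_poly z z)^`().[s] = - \sum_(y | y != z) (2 * h z y)%:R * s ^+ (2 * h z y).-1.
Proof.
rewrite /path_poly eqxx derivB derivC sub0r hornerN; congr (- _).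
rewrite raddf_sum /= horner_sum; apply: eq_bigr => y _.
by rewrite derivXn hornerMn hornerXn mulr_natl.
Qed.

Section SmallTime.
Variable s : R.
Hypotheses (s_ge0 : 0 <= s) (s_le1 : s <= 1) (s_small : N * s ^+ 2 <= 2^-1).

Let pow_le z x : x != z -> s ^+ (2 * h z x) <= s ^+ 2.
Proof.
move=> xz; apply: ler_wiXn2l => //.
by rewrite -[leqLHS]muln1 leq_mul2l hpos ?orbT.
Qed.

Let sum_pow z : 0 <= \sum_(y | y != z) s ^+ (2 * h z y) <= N * s ^+ 2.
Proof.
apply/andP; split; first by apply: sumr_ge0 => y _; rewrite exprn_ge0.
apply: (@le_trans _ _ (\sum_(y : 'I_n.+1) s ^+ 2)); last by rewrite sumr_const card_ord mulr_natl.
rewrite big_mkcond; apply: ler_sum => y _; case: ifP => yz; first exact: pow_le.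
exact: sqr_ge0.
Qed.

Lemma path_poly_near z x : `|(path_poly z x).[s] - (x == z)%:R| <= N * s ^+ 2.
Proof.
have [->|xz] := eqVneq x z.
  rewrite path_poly_diag addrAC subrr add0r normrN.
  by have /andP[? ?] := sum_pow z; rewrite ger0_norm.
rewrite path_polyE// subr0 ger0_norm ?exprn_ge0// (le_trans (pow_le xz))//.
by rewrite ler_peMl ?sqr_ge0// ler1n.
Qed.

(** The factor [1 / 2] is for the diagonal entry: by [s_small] at least half of the mass stays at
    its origin. *)
Lemma path_poly_lb z x : s ^+ (2 * h z x) / 2 <= (path_poly z x).[s].
Proof.
have [->|xz] := eqVneq x z; last first.
  by rewrite path_polyE// ler_pdivrMr// ler_peMr ?exprn_ge0// ler1n.
have /eqP -> : h z z == 0%N by rewrite h0.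
rewrite path_poly_diag muln0 expr0; have /andP[_ hs] := sum_pow z.
have := le_trans hs s_small; set S := \sum_(_ | _) _.
lra.
Qed.

Lemma path_poly_ge0 z x : 0 <= (path_poly z x).[s].
Proof. by apply: le_trans (path_poly_lb z x); rewrite divr_ge0// exprn_ge0. Qed.

Lemma path_poly_deriv_bound z x : `|(path_poly z x)^`().[s]| <= N * (2 * D)%:R.
Proof.
have one y : 0 <= (2 * h z y)%:R * s ^+ (2 * h z y).-1 <= (2 * D)%:R.
  rewrite mulr_ge0 ?exprn_ge0//= -[leRHS]mulr1 ler_pM ?exprn_ge0//.
    by rewrite ler_nat leq_mul2l hD.
  exact: exprn_ile1.
have [->|xz] := eqVneq x z; last first.
  rewrite path_poly_deriv//; have /andP[? ?] := one x.
  by rewrite ger0_norm// (le_trans (_ : _ <= (2 * D)%:R))// ler_peMl// ler1n.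
rewrite path_poly_deriv_diag normrN ger0_norm; last first.
  by apply: sumr_ge0 => y _; case/andP: (one y).
apply: (@le_trans _ _ (\sum_(y : 'I_n.+1) (2 * D)%:R)); last by rewrite sumr_const card_ord mulr_natl.
by rewrite big_mkcond; apply: ler_sum => y _; case: ifP => // _; case/andP: (one y).
Qed.

End SmallTime.

Definition spread (p : V) (s : R) : V := \row_x \sum_z p 0 z * (path_poly z x).[s].

Definition spread' (p : V) (s : R) : V := \row_x \sum_z p 0 z * (path_poly z x)^`().[s].

Let spread_poly (p : V) x : {poly R} := \sum_z p 0 z *: path_poly z x.

Lemma spreadE p x : (fun s => spread p s 0 x) = horner (spread_poly p x).
Proof.
apply/funext => s; rewrite mxE /spread_poly horner_sum; apply: eq_bigr => z _.
by rewrite hornerZ.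
Qed.

Lemma spread'E p x : (fun s => spread' p s 0 x) = horner (spread_poly p x)^`().
Proof.
apply/funext => s; rewrite mxE /spread_poly raddf_sum /= horner_sum; apply: eq_bigr => z _.
by rewrite derivZ hornerZ.
Qed.

Lemma spread0 p : spread p 0 = p.
Proof.
apply/rowP => x; rewrite mxE (bigD1 x)//= big1 ?addr0.
  rewrite path_poly_diag big1 ?subr0 ?mulr1// => y yx.
  by rewrite expr0n muln_eq0 h0 (negPf yx).
move=> z zx; rewrite path_polyE ?(eq_sym x)// expr0n muln_eq0 h0 (eq_sym x).
by rewrite (negPf zx) mulr0.
Qed.

Lemma spread_sum p s : \sum_x spread p s 0 x = \sum_z p 0 z.
Proof.
under eq_bigr do rewrite mxE.
rewrite exchange_big; apply: eq_bigr => z _ /=.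
by rewrite -mulr_sumr -horner_sum path_poly_sum hornerC mulr1.
Qed.

Lemma spread'_sum p s : \sum_x spread' p s 0 x = 0.
Proof.
under eq_bigr do rewrite mxE.
rewrite exchange_big big1//= => z _.
rewrite -mulr_sumr.
have -> : \sum_x (path_poly z x)^`().[s] = (\sum_x path_poly z x)^`().[s].
  by rewrite raddf_sum horner_sum.
by rewrite path_poly_sum derivC horner0 mulr0.
Qed.

Section SpreadSmallTime.
Variables (p : V) (s : R).
Hypotheses (sp : simplex p) (s_ge0 : 0 <= s) (s_le1 : s <= 1) (s_small : N * s ^+ 2 <= 2^-1).

Lemma spread_simplex : simplex (spread p s).
Proof.
split=> [x|]; last by rewrite spread_sum; case: sp.
by rewrite mxE sumr_ge0// => z _; rewrite mulr_ge0 ?path_poly_ge0// simplex_ge0.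
Qed.

Lemma spread_near : `|spread p s - p| <= N * s ^+ 2.
Proof.
apply: norm_le_coord => [|x]; first by rewrite mulr_ge0// sqr_ge0.
have -> : (spread p s - p) 0 x = \sum_z p 0 z * ((path_poly z x).[s] - (x == z)%:R).
  rewrite !mxE; under [RHS]eq_bigr do rewrite mulrBr.
  rewrite sumrB; congr (_ - _); rewrite (bigD1 x)//= eqxx mulr1 big1 ?addr0// => z.
  by rewrite eq_sym => /negPf ->; rewrite mulr0.
apply: le_trans (ler_norm_sum _ _ _) _.
apply: (@le_trans _ _ (\sum_z p 0 z * (N * s ^+ 2))).
  apply: ler_sum => z _; rewrite normrM ger0_norm ?simplex_ge0//.
  by rewrite ler_wpM2l ?simplex_ge0// path_poly_near.
by rewrite -mulr_suml (proj2 sp) mul1r.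
Qed.

Lemma spread_lb z x : p 0 z * (s ^+ (2 * h z x) / 2) <= spread p s 0 x.
Proof.
rewrite mxE (bigD1 z)//= -[leLHS]addr0 lerD//.
  by rewrite ler_wpM2l ?simplex_ge0// path_poly_lb.
by apply: sumr_ge0 => y _; rewrite mulr_ge0 ?simplex_ge0// path_poly_ge0.
Qed.

Lemma spread_ge x : s ^+ (2 * D) / 2 <= spread p s 0 x.
Proof.
have -> : s ^+ (2 * D) / 2 = (\sum_z p 0 z) * (s ^+ (2 * D) / 2).
  by rewrite (proj2 sp) mul1r.
rewrite mxE mulr_suml; apply: ler_sum => z _.
apply: ler_wpM2l; first exact: simplex_ge0.
apply: le_trans (path_poly_lb s_ge0 s_le1 s_small z x).
by rewrite ler_wpM2r// ler_wiXn2l// leq_mul2l hD.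
Qed.

Lemma spread'_norm : \sum_x `|spread' p s 0 x| <= N * (N * (2 * D)%:R).
Proof.
apply: (@le_trans _ _ (\sum_(x : 'I_n.+1) (N * (2 * D)%:R))); last first.
  by rewrite sumr_const card_ord [leRHS]mulr_natl.
apply: ler_sum => x _; rewrite mxE; apply: le_trans (ler_norm_sum _ _ _) _.
have -> : N * (2 * D)%:R = (\sum_z p 0 z) * (N * (2 * D)%:R) by rewrite (proj2 sp) mul1r.
rewrite mulr_suml; apply: ler_sum => z _.
rewrite normrM ger0_norm ?simplex_ge0// ler_wpM2l ?simplex_ge0//.
exact: path_poly_deriv_bound.
Qed.

(** If [A] separates [z] from [x], some edge across [A] has one end at distance at most [h z x - 1]
    from [z] and the other at most [h z x]. The geometric mean of the masses at its ends is at least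
    half of the left-hand side, which has the order of the velocity of the mass sent from [z] to
    [x]. *)
Lemma spread_cutw (A : {set 'I_n.+1}) z x : good (spread p s) -> (z \in A) != (x \in A) ->
  p 0 z * s ^+ (2 * h z x).-1 <= 2 / c * cutw (weight Q (spread p s)) A.
Proof.
move=> gs zxA; set m := spread p s.
have cutE u w : u \in A -> w \notin A -> e u w ->
    ((h z u + h z w).+1 <= 2 * h z x)%N ->
    p 0 z * s ^+ (2 * h z x).-1 <= 2 / c * cutw (weight Q m) A.
  move=> uA wA uw hh; apply: (@le_trans _ _ (2 / c * (c * Num.sqrt (m 0 u * m 0 w)))); last first.
    by rewrite ler_wpM2l ?divr_ge0 ?(ltW c0)// cutw_edge.
  have -> : 2 / c * (c * Num.sqrt (m 0 u * m 0 w)) = 2 * Num.sqrt (m 0 u * m 0 w).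
    by field; rewrite gt_eqF.
  rewrite -ler_pdivrMl// .
  have pz := simplex_ge0 z sp.
  have q0 : 0 <= 2^-1 * (p 0 z * s ^+ (2 * h z x).-1) by rewrite !mulr_ge0// exprn_ge0.
  rewrite -[leLHS]ger0_norm// -sqrtr_sqr ler_sqrt; last first.
    by rewrite mulr_ge0// simplex_ge0//; exact: spread_simplex.
  apply: le_trans (_ : (p 0 z * (s ^+ (2 * h z u) / 2)) * (p 0 z * (s ^+ (2 * h z w) / 2)) <= _); last first.
    by rewrite ler_pM ?spread_lb// !mulr_ge0 ?invr_ge0// exprn_ge0.
  have -> : p 0 z * (s ^+ (2 * h z u) / 2) * (p 0 z * (s ^+ (2 * h z w) / 2)) =
      2^-1 ^+ 2 * p 0 z ^+ 2 * s ^+ (2 * h z u + 2 * h z w).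
    by rewrite exprD; ring.
  rewrite !exprMn -exprM mulrA ler_wpM2l ?mulr_ge0 ?sqr_ge0// ler_wiXn2l//.
  by move: hh; move: (h z u) (h z w) (h z x) => a b d; clear; lia.
have [zA|zA] := boolP (z \in A).
  have xA : x \notin A by move: zxA; rewrite zA; case: (x \in A).
  have [u [w [uA wA uw h1 h2]]] := cross zA xA.
  by apply: (cutE u w) => //; move: h1 h2; move: (h z u) (h z w) (h z x) => a b d; clear; lia.
have xA : x \in A by move: zxA; rewrite (negPf zA); case: (x \in A).
(* Here [z] lies outside [A]: the crossing edge is found for the complement and then reversed. *)
have xA' : ~~ [pred y | y \notin A] x by rewrite /= negbK.
have [u [w [uA wA uw h1 h2]]] := crossing_edge hstep (A := [pred y | y \notin A]) zA xA'.
rewrite /= negbK in wA; apply: (cutE w u wA uA (esym uw)).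
by move: h1 h2; move: (h z u) (h z w) (h z x) => a b d; clear; lia.
Qed.

(** Only pairs [z], [x] on opposite sides of [A] contribute. For [z] in [A] the diagonal derivative
    is eliminated by passing to the complement, since the derivatives sum to 0. *)
Lemma spread'_cut (A : {set 'I_n.+1}) : good (spread p s) ->
  `|\sum_(x in A) spread' p s 0 x| <=
  N * (N * ((2 * D)%:R * (2 / c))) * cutw (weight Q (spread p s)) A.
Proof.
move=> gs; set cw := cutw _ _.
have cw0 : 0 <= cw.
  by apply: sumr_ge0 => u _; apply: sumr_ge0 => w _; exact: weight_ge0.
have c2 : 0 <= 2 / c by rewrite divr_ge0// ltW.
pose F z := \sum_(x in A) (path_poly z x)^`().[s].
pose G z x := (2 * h z x)%:R * s ^+ (2 * h z x).-1.
have -> : \sum_(x in A) spread' p s 0 x = \sum_z p 0 z * F z.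
  under eq_bigr do rewrite mxE.
  by rewrite exchange_big; apply: eq_bigr => z _ /=; rewrite /F mulr_sumr.
have Gb z x : (z \in A) != (x \in A) -> p 0 z * G z x <= (2 * D)%:R * (2 / c) * cw.
  move=> zx; rewrite /G mulrCA -[leRHS]mulrA; apply: ler_pM => //.
  - by apply: mulr_ge0; [exact: simplex_ge0|exact: exprn_ge0].
  - by rewrite ler_nat leq_mul2l hD.
  - exact: spread_cutw.
have Fb z : `|p 0 z * F z| <= N * ((2 * D)%:R * (2 / c)) * cw.
  have rhs0 : 0 <= (2 * D)%:R * (2 / c) * cw by rewrite mulr_ge0// mulr_ge0.
  suff : `|p 0 z * F z| <= \sum_(x | (z \in A) != (x \in A)) p 0 z * G z x.
    move=> /le_trans; apply; rewrite -[leRHS]mulrA.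
    apply: (@le_trans _ _ (\sum_(x : 'I_n.+1) (2 * D)%:R * (2 / c) * cw)).
      by rewrite big_mkcond; apply: ler_sum => x _; case: ifP => // /Gb.
    by rewrite sumr_const card_ord [leRHS]mulr_natl.
  have G0 x : 0 <= p 0 z * G z x.
    by apply: mulr_ge0; [exact: simplex_ge0|rewrite mulr_ge0// exprn_ge0].
  have [zA|zA] := boolP (z \in A).
    have -> : F z = - \sum_(x | x \notin A) G z x.
      have tot : \sum_x (path_poly z x)^`().[s] = 0.
        have -> : \sum_x (path_poly z x)^`().[s] = (\sum_x path_poly z x)^`().[s].
          by rewrite raddf_sum horner_sum.
        by rewrite path_poly_sum derivC horner0.
      move: tot; rewrite (bigID (mem A))/= -/(F z) => /eqP; rewrite addr_eq0 => /eqP ->.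
      congr (- _); apply: eq_bigr => x xA; rewrite path_poly_deriv//.
      by apply: contraNneq xA => ->.
    rewrite mulrN normrN mulr_sumr ger0_norm; last by apply: sumr_ge0 => x _; exact: G0.
    by rewrite le_eqVlt; apply/orP; left; apply/eqP/eq_bigl => x; case: (x \in A).
  have -> : F z = \sum_(x in A) G z x.
    apply: eq_bigr => x xA; rewrite path_poly_deriv//.
    by apply: contraNneq zA => <-.
  rewrite mulr_sumr ger0_norm; last by apply: sumr_ge0 => x _; exact: G0.
  by rewrite le_eqVlt; apply/orP; left; apply/eqP/eq_bigl => x; case: (x \in A).
apply: le_trans (ler_norm_sum _ _ _) _.
apply: (@le_trans _ _ (\sum_(z : 'I_n.+1) N * ((2 * D)%:R * (2 / c)) * cw)).
  by apply: ler_sum => z _.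
by rewrite sumr_const card_ord -[leRHS]mulrA [leRHS]mulr_natl.
Qed.

Lemma spread_cut_gt0 (A : {set 'I_n.+1}) x y : 0 < s -> good (spread p s) ->
  x \in A -> y \notin A -> 0 < cutw (weight Q (spread p s)) A.
Proof.
move=> s0 gs xA yA.
have [z pz] : exists z, 0 < p 0 z.
  apply/existsP; apply: contraT; rewrite negb_exists => /forallP p0.
  have /eqP := proj2 sp; rewrite big1 ?(eq_sym 0) ?oner_eq0// => z _.
  by apply/eqP; rewrite eq_le simplex_ge0// andbT leNgt.
have [x' zx'] : exists x', (z \in A) != (x' \in A).
  by have [zA|zA] := boolP (z \in A); [exists y; rewrite (negPf yA)|exists x; rewrite xA].
have := spread_cutw gs zx'; have : 0 < p 0 z * s ^+ (2 * h z x').-1.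
  by rewrite mulr_gt0// exprn_gt0.
move=> /lt_le_trans /[apply]; rewrite pmulr_rgt0// divr_gt0//.
Qed.

End SpreadSmallTime.

(** Every exponent [(2 * h z y).-1] with [y != z] is positive. This settles the starting time, when
    capacities may vanish. *)
Lemma spread'_at0 p : spread' p 0 = 0.
Proof.
apply/rowP => x; rewrite !mxE big1// => z _.
have pow0 y : y != z -> (2 * h z y)%:R * 0 ^+ (2 * h z y).-1 = 0 :> R.
  move=> yz; rewrite expr0n; have := hpos yz.
  by case: (h z y) => // k _; rewrite mulnS /= mulr0.
have [->|xz] := eqVneq x z; last by rewrite path_poly_deriv// pow0 ?mulr0.
by rewrite path_poly_deriv_diag big1 ?oppr0 ?mulr0.
Qed.

Lemma boundary_cost : exists2 B, 0 < B & forall p (d : R), simplex p -> 0 < d -> d <= 1 ->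
  N * d ^+ 2 <= 2^-1 -> (forall s, 0 <= s -> s <= d -> good (spread p s)) ->
  (Wdist Q p (spread p d) <= (d * B)%:E)%E.
Proof.
pose beta := N * (N * ((2 * D)%:R * (2 / c))); pose C := N * (N * (2 * D)%:R).
(* The square root may be 0; the [+ 1] makes the constant positive. *)
exists (Num.sqrt (n%:R * beta * C) + 1).
  by rewrite ltr_wpDl// sqrtr_ge0.
move=> p d sp d0 d1 dN gs.
have beta0 : 0 <= beta by rewrite !mulr_ge0// invr_ge0 ltW.
suff : (Wdist Q (spread p 0) (spread p d) <= (d * Num.sqrt (n%:R * beta * C))%:E)%E.
  by rewrite spread0 => /le_trans; apply; rewrite lee_fin ler_pM2l// lerDl.
have memd (s : R) : `[0, d]%classic s -> [/\ 0 <= s, s <= d, s <= 1 & N * s ^+ 2 <= 2^-1].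
  rewrite /= in_itv/= => /andP[s0 sd]; split => //; first exact: le_trans sd d1.
  by apply: le_trans dN; rewrite ler_wpM2l// ler_sqr ?nnegrE// ltW.
apply: (@path_cost _ _ _ rQ d beta C (spread p) (spread' p)) => //.
- move=> x t; rewrite spreadE.
  by have := is_derive_poly (spread_poly p x) t; rewrite -spread'E.
- by move=> x; rewrite spread'E; exact: continuous_horner.
- by move=> s /memd[s0 _ s1 sN]; exact: spread_simplex.
- by move=> s _; exact: spread'_sum.
- by move=> s /memd[s0 _ s1 sN]; exact: spread'_norm.
move=> s sd; have [s0 sd' s1 sN] := memd s sd.
move: s0; rewrite le_eqVlt => /predU1P[<-|s0]; first by left; exact: spread'_at0.
have s00 := ltW s0; right => A x y xA yA; split.
  by apply: (spread_cut_gt0 _ _ _ _ _ _ xA yA) => //; exact: gs.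
by apply: spread'_cut => //; exact: gs.
Qed.

End BoundaryPath.

Lemma small_param (R : realType) (a b d : R) : 0 < a -> 0 < b -> 0 < d ->
  exists s, [/\ 0 < s, s <= 1, s <= a, s <= b & s <= d].
Proof.
move=> a0 b0 d0; exists (Num.min (Num.min 1 a) (Num.min b d)).
by rewrite !lt_min ltr01 a0 b0 d0 !ge_min !lexx ?orbT.
Qed.

(** * Continuity of the distance on the whole simplex *)

Section WdistContinuity.
Variables (R : realType) (n : nat).
Variables (K : 'rV[R]_n.+1 -> 'I_n.+1 -> R) (Q : 'rV[R]_n.+1 -> 'M[R]_n.+1).
Hypothesis triple : nonlinear_markov_triple K Q.
Notation V := 'rV[R]_n.+1.
Notation N := (n.+1%:R : R).

Lemma simplex_convex (p q : V) t : simplex p -> simplex q -> 0 <= t -> t <= 1 ->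
  simplex (p + t *: (q - p)).
Proof.
move=> [p0 p1] [q0 q1] t0 t1; split => [x|].
  rewrite !mxE; have := mulr_ge0 t0 (q0 x).
  have : 0 <= (1 - t) * p 0 x by rewrite mulr_ge0// subr_ge0.
  lra.
under eq_bigr do rewrite !mxE.
by rewrite big_split/= -mulr_sumr sumrB p1 q1 subrr mulr0 addr0.
Qed.

(** For small [s] the [path_poly] form a Markov kernel, which does not increase the l1 distance; the
    factor [N] compares the l1 and sup norms. *)
Lemma spread_lipschitz (h : 'I_n.+1 -> 'I_n.+1 -> nat) (p q : V) s :
  (forall z x, (h z x == 0%N) = (x == z)) ->
  0 <= s -> s <= 1 -> N * s ^+ 2 <= 2^-1 ->
  \sum_x `|spread h q s 0 x - spread h p s 0 x| <= N * `|q - p|.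
Proof.
move=> h0 s0 s1 sN.
apply: (@le_trans _ _ (\sum_z `|q 0 z - p 0 z|)); last first.
  apply: (@le_trans _ _ (\sum_(z < n.+1) `|q - p|)); last first.
    by rewrite sumr_const card_ord [leRHS]mulr_natl.
  apply: ler_sum => z _.
  by have := coord_le_norm (q - p) z; rewrite !mxE.
apply: (@le_trans _ _ (\sum_x \sum_z `|q 0 z - p 0 z| * (path_poly R h z x).[s])).
  apply: ler_sum => x _; rewrite !mxE -sumrB.
  apply: le_trans (ler_norm_sum _ _ _) _; apply: ler_sum => z _.
  rewrite -mulrBl normrM [X in _ * X <= _]ger0_norm//.
  exact: path_poly_ge0.
rewrite exchange_big/=; apply: ler_sum => z _.
by rewrite -mulr_sumr -horner_sum path_poly_sum hornerC mulr1.
Qed.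

(* From [mu] spread the mass for a short time [d], go straight to the spread of
   [nu], and undo the spreading: the outer parts cost [O(d)], and the segment
   stays in the interior, where its cost tends to [0] with [nu - mu]. *)
Lemma Wdist_near (mu : V) (eps : R) : simplex mu -> 0 < eps ->
  exists2 r, 0 < r & forall nu, simplex nu -> `|nu - mu| <= r ->
  (Wdist Q mu nu < eps%:E)%E.
Proof.
move=> smu eps0; have rQ := triple_regular triple.
pose e := [rel u v | 0 < Q mu u v].
have esym x y : e x y -> e y x by exact: (rate_gt0_sym triple smu).
have eneq x y : e x y -> x != y by exact: (rate_gt0_neq triple smu).
have [h [h0 hstep]] := @graph_distance _ e (triple_irreducible triple smu).
pose D := (\max_(z : 'I_n.+1) \max_(x : 'I_n.+1) h z x)%N.
have hD z x : (h z x <= D)%N.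
  by rewrite (leq_trans (leq_bigmax x))// (leq_bigmax (F := fun z => \max_x h z x)%N).
have [c [r0 [c0 r00 hc]]] := uniform_rates triple smu.
have [B B0 hB] := boundary_cost rQ c0 esym eneq h0 hD hstep.
have N0 : 0 < N by rewrite ltr0n.
(* [dN] is the smallness required by [path_poly], [dr] keeps the spreads within [r0] of [mu], where
   the rates on the graph are at least [c], and [dB] makes each spreading cost less than
   [eps / 4]. *)
have [d [d0 d1 dN dr dB]] : exists d, [/\ 0 < d, d <= 1, d <= (2 * N)^-1,
    d <= r0 / (2 * N) & d <= eps / (8 * B)].
  by apply: small_param; rewrite ?invr_gt0 ?divr_gt0// mulr_gt0.
have d2 : d ^+ 2 <= d by rewrite expr2 ler_piMr// ltW.
have dN2 : N * d ^+ 2 <= 2^-1.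
  have : N * d <= N * (2 * N)^-1 by rewrite ler_wpM2l// ltW.
  have -> : N * (2 * N)^-1 = 2^-1 by field; rewrite gt_eqF.
  by apply: le_trans; rewrite ler_wpM2l// ltW.
have dr2 : N * d ^+ 2 <= r0 / 2.
  have : N * d <= N * (r0 / (2 * N)) by rewrite ler_wpM2l// ltW.
  have -> : N * (r0 / (2 * N)) = r0 / 2 by field; rewrite gt_eqF.
  by apply: le_trans; rewrite ler_wpM2l// ltW.
have dB4 : d * B < eps / 4.
  have : d * B <= eps / (8 * B) * B by rewrite ler_wpM2r// ltW.
  have -> : eps / (8 * B) * B = eps / 8 by field; rewrite gt_eqF.
  by move/le_lt_trans; apply; rewrite ltr_pM2l// ltf_pV2 ?posrE// ltr_nat.
pose a := d ^+ (2 * D) / 2.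
have a0 : 0 < a by rewrite divr_gt0// exprn_gt0.
pose S := Num.sqrt (n%:R / (c * a)).
have S0 : 0 <= S by exact: sqrtr_ge0.
have S1 : 0 < S + 1 by rewrite ltr_wpDl.
exists (Num.min (r0 / 2) (eps / (8 * N * (S + 1)))).
  by rewrite lt_min !divr_gt0// !mulr_gt0.
move=> nu snu; rewrite le_min => /andP[nur nue].
have mur : `|mu - mu| <= r0 / 2 by rewrite subrr normr0 divr_ge0// ltW.
have small s : 0 <= s -> s <= d -> s <= 1 /\ N * s ^+ 2 <= N * d ^+ 2.
  move=> s0 sd; split; first exact: le_trans sd d1.
  by rewrite ler_wpM2l ?(ltW N0)// ler_sqr ?nnegrE// ltW.
have snear (p : V) s : simplex p -> `|p - mu| <= r0 / 2 -> 0 <= s -> s <= d ->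
    simplex (spread h p s) /\ `|spread h p s - mu| <= r0.
  move=> sp pr s0 sd; have [s1 sN] := small s s0 sd.
  have sN2 := le_trans sN dN2.
  split; first exact: (spread_simplex h0 sp s0 s1 sN2).
  have := spread_near h0 sp s0 s1.
  have := ler_normD (spread h p s - p) (p - mu); rewrite subrKA; lra.
have hgood (p : V) s : simplex p -> `|p - mu| <= r0 / 2 -> 0 <= s -> s <= d ->
    good Q e c (spread h p s).
  move=> sp pr s0 sd; have [s1 s2] := snear p s sp pr s0 sd.
  by split => // x y xy; exact: (hc _ s1 s2).
have up : (Wdist Q mu (spread h mu d) < (eps / 4)%:E)%E.
  apply: (@le_lt_trans _ _ (d * B)%:E); last by rewrite lte_fin.
  apply: hB => // s s0 sd; exact: hgood.
have down : (Wdist Q (spread h nu d) nu < (eps / 4)%:E)%E.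
  rewrite (Wdist_sym rQ); apply: (@le_lt_trans _ _ (d * B)%:E); last by rewrite lte_fin.
  apply: hB => // s s0 sd; exact: hgood.
have line : (Wdist Q (spread h mu d) (spread h nu d) < (eps / 4)%:E)%E.
  have [sm1 sm2] := snear mu d smu mur (ltW d0) (lexx _).
  have [sn1 sn2] := snear nu d snu nur (ltW d0) (lexx _).
  apply: (@le_lt_trans _ _ ((\sum_x `|spread h nu d 0 x - spread h mu d 0 x|) * S)%:E).
    apply: (line_cost rQ c0 esym eneq hstep a0).
    - move=> t t0 t1; have st := simplex_convex sm1 sn1 t0 t1.
      split => // x y xy; apply: hc => //.
      set p := spread h mu d in sm2 *; set q := spread h nu d in sn2 *.
      have -> : p + t *: (q - p) - mu = (1 - t) *: (p - mu) + t *: (q - mu).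
        by apply/rowP => z; rewrite !mxE; ring.
      apply: le_trans (ler_normD _ _) _; rewrite !normrZ (ger0_norm t0) ger0_norm ?subr_ge0//.
      have : (1 - t) * `|p - mu| <= (1 - t) * r0 by rewrite ler_wpM2l// subr_ge0.
      have : t * `|q - mu| <= t * r0 by rewrite ler_wpM2l.
      lra.
    - by move=> x; apply: spread_ge => //; exact: ltW.
    - by move=> x; apply: spread_ge => //; exact: ltW.
  rewrite lte_fin; have := @spread_lipschitz h mu nu d h0 (ltW d0) d1 dN2.
  move=> hl; apply: (@le_lt_trans _ _ (N * (eps / (8 * N * (S + 1))) * (S + 1))).
    apply: ler_pM => //; first by apply: sumr_ge0.
      by apply: (le_trans hl); rewrite ler_wpM2l// ltW.
    by rewrite lerDl.
  have -> : N * (eps / (8 * N * (S + 1))) * (S + 1) = eps / 8 by field; rewrite !gt_eqF.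
  by rewrite ltr_pM2l// ltf_pV2 ?posrE// ltr_nat.
have tri1 := Wdist_triangle_lt rQ up line.
have tri2 : (Wdist Q mu (spread h nu d) < (eps / 4 + eps / 4 + eps / 8)%:E)%E.
  by apply: le_lt_trans tri1 _; rewrite lte_fin; lra.
have tri3 := Wdist_triangle_lt rQ tri2 down.
by apply: (le_lt_trans tri3); rewrite lte_fin; lra.
Qed.

End WdistContinuity.

Lemma norm_line (R : realType) (n : nat) (v : 'rV[R]_n.+1) (s t r : R) : 0 < r ->
  `|s - t| <= r / (`|v| + 1) -> `|s *: v - t *: v| <= r.
Proof.
move=> r0 st; rewrite -scalerBl normrZ; have v0 : 0 < `|v| + 1 by rewrite ltr_wpDl.
apply: (@le_trans _ _ (r / (`|v| + 1) * (`|v| + 1))); last by rewrite divfK// gt_eqF.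
by rewrite ler_pM// lerDl.
Qed.

(** * The distance as a finite metric, and almost minimal curves *)

Section RealDistance.
Variables (R : realType) (n : nat).
Variables (K : 'rV[R]_n.+1 -> 'I_n.+1 -> R) (Q : 'rV[R]_n.+1 -> 'M[R]_n.+1).
Hypothesis triple : nonlinear_markov_triple K Q.
Notation V := 'rV[R]_n.+1.
Notation W := (Wdist Q).
Let rQ : regular_rates Q := triple_regular triple.

Lemma Wdist_refl (p : V) : simplex p -> W p p = 0%E.
Proof.
move=> sp; apply/eqP; rewrite eq_le Wdist_ge0 andbT.
apply/lee_addgt0Pr => e e0; rewrite add0e.
have [r r0 hr] := Wdist_near triple sp e0.
by apply/ltW/hr; rewrite // subrr normr0 ltW.
Qed.

(** [Wdist_near] gives finiteness only locally. The times of the segment from [p] to [q] reached at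
    finite cost have a supremum; local finiteness shows first that it is reached, then that it is
    1. *)
Lemma Wdist_bounded (p q : V) : simplex p -> simplex q -> exists u : R, (W p q < u%:E)%E.
Proof.
move=> sp sq; pose m t : V := p + t *: (q - p).
pose A := [set t : R | [/\ 0 <= t, t <= 1 & exists u : R, (W p (m t) < u%:E)%E]].
have A0 : A 0.
  by split => //; exists 1; rewrite /m scale0r addr0 Wdist_refl.
have supA : has_sup A by split; [exists 0|exists 1 => t []].
have s0 : 0 <= sup A by exact: ub_le_sup supA.2 _ A0.
have s1 : sup A <= 1 by apply: ge_sup; [exists 0|move=> t []].
set s := sup A in s0 s1 *.
have [r r0 hr] := Wdist_near triple (simplex_convex sp sq s0 s1) ltr01.
pose d := r / (`|q - p| + 1).
have d0 : 0 < d by rewrite divr_gt0// ltr_wpDl.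
have near t : 0 <= t -> t <= 1 -> `|t - s| <= d -> (W (m s) (m t) < 1%:E)%E.
  move=> t0 t1 td; apply: hr; first exact: simplex_convex.
  by rewrite /m opprD addrACA subrr add0r; exact: norm_line.
have [t [t0 t1 [u pu]] ts] := sup_adherent d0 supA.
have tles : t <= s by apply: (ub_le_sup supA.2); split => //; exists u.
have As : A s.
  split => //; exists (u + 1 + 1).
  have ms : (W (m t) (m s) < 1%:E)%E.
    by rewrite (Wdist_sym rQ); apply: near => //; rewrite distrC ger0_norm ?subr_ge0//; rewrite -/s in ts; lra.
  by apply: le_lt_trans (Wdist_triangle_lt rQ pu ms) _; rewrite lte_fin ltrDl.
have [v pv] := (let: And3 _ _ H := As in H).
have [s1'|] := ltP s 1; last first.
  move=> s1'; exists v; move: pv; have -> : s = 1 by apply/eqP; rewrite eq_le s1 s1'.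
  by rewrite /m scale1r addrC subrK.
have [t' [t'0 t's t'1 t'd]] : exists t', [/\ 0 <= t', s < t', t' <= 1 & t' - s <= d].
  exists (Num.min 1 (s + d)).
  rewrite le_min ler01 addr_ge0 ?(ltW d0)// lt_min s1' ltrDl d0 ge_min lexx.
  by split=> //; rewrite lerBlDl ge_min lexx orbT.
have At' : A t'.
  split => //; exists (v + 1 + 1).
  have ms : (W (m s) (m t') < 1%:E)%E.
    by apply: near => //; rewrite ger0_norm// subr_ge0 ltW.
  by apply: le_lt_trans (Wdist_triangle_lt rQ pv ms) _; rewrite lte_fin ltrDl.
by have := ub_le_sup supA.2 At'; rewrite -/s leNgt t's.
Qed.

Definition wd (p q : V) : R := fine (W p q).

Lemma wdE p q : simplex p -> simplex q -> W p q = (wd p q)%:E.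
Proof.
move=> sp sq; rewrite /wd fineK// fin_real//.
have [u pu] := Wdist_bounded sp sq.
by rewrite (lt_le_trans _ (Wdist_ge0 Q p q))//= (lt_le_trans pu)// leey.
Qed.

Lemma wd_ge0 p q : 0 <= wd p q.
Proof. exact/fine_ge0/Wdist_ge0. Qed.

Lemma wd_sym p q : wd q p = wd p q.
Proof. by rewrite /wd (Wdist_sym rQ). Qed.

Lemma wd_refl p : simplex p -> wd p p = 0.
Proof. by move=> sp; rewrite /wd Wdist_refl. Qed.

Lemma wd0_eq p q : simplex p -> simplex q -> wd p q = 0 -> p = q.
Proof. by move=> sp sq pq0; apply: (Wdist0_eq rQ); rewrite wdE// pq0. Qed.

Lemma wd_near mu eps : simplex mu -> 0 < eps -> exists2 r, 0 < r &
  forall nu, simplex nu -> `|nu - mu| <= r -> wd mu nu < eps.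
Proof.
move=> smu e0; have [r r0 hr] := Wdist_near triple smu e0.
by exists r => // nu snu nr; rewrite -lte_fin -wdE//; exact: hr.
Qed.

Lemma wd_triangle p q r : simplex p -> simplex q -> simplex r ->
  wd p r <= wd p q + wd q r.
Proof.
move=> sp sq sr; apply/ler_addgt0Pr => e e0.
have h1 : (W p q < (wd p q + e / 2)%:E)%E by rewrite wdE// lte_fin ltrDl divr_gt0.
have h2 : (W q r < (wd q r + e / 2)%:E)%E by rewrite wdE// lte_fin ltrDl divr_gt0.
have := Wdist_triangle_lt rQ h1 h2; rewrite wdE// lee_fin; lra.
Qed.

Lemma wd_lt p q r : simplex p -> simplex q -> wd p q < r ->
  exists mu psi, [/\ scurve Q 0 1 mu psi, mu 0 = p, mu 1 = q &
    (energy Q 0 1 mu psi < (r ^+ 2)%:E)%E].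
Proof. by move=> sp sq pq; apply: (Wdist_lt rQ); rewrite wdE. Qed.

(** The Cauchy-Schwarz inequality for two terms, stated without quotients because the durations [a]
    and [b] may vanish. *)
Lemma sum_sqrt_le (x y a b e f : R) : 0 <= x -> 0 <= y -> 0 <= a -> 0 <= b ->
  0 <= e -> 0 <= f -> x ^+ 2 <= a * e -> y ^+ 2 <= b * f ->
  (x + y) ^+ 2 <= (a + b) * (e + f).
Proof.
move=> x0 y0 a0 b0 e0 f0 hx hy.
suff : x * y <= (a * f + b * e) / 2 by lra.
rewrite -ler_sqr ?nnegrE ?mulr_ge0 ?divr_ge0 ?addr_ge0 ?mulr_ge0// .
have : x ^+ 2 * y ^+ 2 <= (a * e) * (b * f) by rewrite ler_pM ?sqr_ge0.
have := sqr_ge0 (a * f - b * e); rewrite !expr2; lra.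
Qed.

Lemma wd_energy (a b e : R) mu psi : a <= b -> scurve Q a b mu psi ->
  (energy Q a b mu psi <= e%:E)%E -> wd (mu a) (mu b) ^+ 2 <= (b - a) * e.
Proof.
move=> ab cmu Ee.
have sm t : a <= t -> t <= b -> simplex (mu t).
  by move=> at_ tb; apply: (sc_simplex cmu); rewrite /= in_itv/= at_ tb.
have e0 : 0 <= e by rewrite -lee_fin (le_trans (energy_ge0 Q a b mu psi)).
move: ab; rewrite le_eqVlt => /predU1P[ab|ab].
  by move: Ee; rewrite -ab wd_refl ?subrr ?mul0r ?expr0n//; apply: sm; rewrite ?ab.
have := Wdist_le rQ ab cmu Ee; rewrite wdE ?lee_fin; last 2 first.
  by apply: sm; rewrite // ltW.
  by apply: sm; rewrite // ltW.
rewrite -ler_sqr ?nnegrE ?wd_ge0 ?sqrtr_ge0// sqr_sqrtr// mulr_ge0// subr_ge0.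
exact: ltW.
Qed.

(** A curve of nearly minimal energy has nearly constant speed: a piece longer than its share of
    time would, by Cauchy-Schwarz, cost extra energy. *)
Lemma almost_geodesic p q eta : simplex p -> simplex q -> 0 < eta ->
  exists mu : R -> V, [/\ forall t, 0 <= t -> t <= 1 -> simplex (mu t),
    mu 0 = p, mu 1 = q & forall s t, 0 <= s -> s <= t -> t <= 1 ->
      wd (mu s) (mu t) <= (t - s) * wd p q + eta].
Proof.
move=> sp sq eta0; set w := wd p q; have w0 : 0 <= w by exact: wd_ge0.
(* The energy excess [(w + e)^2 - w^2] equals [e * (2 * w + e)], which these bounds keep below
   [(eta / 2)^2]; the other half of [eta] absorbs [l * e]. *)
have [e [e0 e1 e2 e3 _]] : exists e, [/\ 0 < e, e <= 1, e <= eta / 2,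
    e <= (eta / 2) ^+ 2 / (2 * w + 1) & e <= eta / 2].
  apply: small_param; rewrite ?divr_gt0// ?exprn_gt0 ?divr_gt0//.
  by rewrite ltr_wpDl// mulr_ge0.
have we : w < w + e by rewrite ltrDl.
have [mu [psi [cmu m0 m1 /ltW Er]]] := wd_lt sp sq we.
have sm t : 0 <= t -> t <= 1 -> simplex (mu t).
  by move=> t0 t1; apply: (sc_simplex cmu); rewrite /= in_itv/= t0 t1.
exists mu; split => // s t s0 st t1.
have s1 := le_trans st t1; have t0 := le_trans s0 st.
have ma (a b : R) : 0 <= a -> a <= b -> b <= 1 ->
    measurable_fun `[a, b] (fun t => action Q (mu t) (psi t)).
  move=> a0 ab b1; exact: (action_measurable rQ ab (scurve_restrict a0 ab b1 cmu)).
have split1 : energy Q 0 1 mu psi =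
    (energy Q 0 s mu psi + (energy Q s t mu psi + energy Q t 1 mu psi))%E.
  rewrite /energy (integral_split s0 s1); last exact: ma.
  by congr (_ + _)%E; apply: (integral_split st t1); exact: ma.
have en a b : 0 <= a -> a <= b -> b <= 1 -> exists2 x, 0 <= x & energy Q a b mu psi = x%:E.
  move=> a0 ab b1; have E0 := energy_ge0 Q a b mu psi.
  have E1 : (energy Q a b mu psi <= ((w + e) ^+ 2)%:E)%E.
    by apply: le_trans Er; exact: (energy_restrict rQ ler01 a0 b1 cmu).
  exists (fine (energy Q a b mu psi)); first exact: fine_ge0.
  rewrite fineK// fin_real// (lt_le_trans _ E0)//=; exact: le_lt_trans E1 (ltry _).
have [ea ea0 Ea] := en 0 s (lexx _) s0 s1.
have [ex ex0 Ex] := en s t s0 st t1.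
have [eb eb0 Eb] := en t 1 t0 t1 (lexx _).
move: Er; rewrite split1 Ea Ex Eb -!EFinD lee_fin => Er.
have leE (u v : \bar R) : u = v -> (u <= v)%E by move=> ->.
have ha := wd_energy s0 (scurve_restrict (lexx _) s0 s1 cmu) (leE _ _ Ea).
have hx := wd_energy st (scurve_restrict s0 st t1 cmu) (leE _ _ Ex).
have hb := wd_energy t1 (scurve_restrict t0 t1 (lexx _) cmu) (leE _ _ Eb).
have tri : w <= wd (mu 0) (mu s) + wd (mu s) (mu t) + wd (mu t) (mu 1).
  rewrite /w -m0 -m1.
  have := wd_triangle (sm 0 (lexx _) ler01) (sm s s0 s1) (sm 1 ler01 (lexx _)).
  have := wd_triangle (sm s s0 s1) (sm t t0 t1) (sm 1 ler01 (lexx _)).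
  lra.
move: ha hx hb tri (wd_ge0 (mu 0) (mu s)) (wd_ge0 (mu s) (mu t)) (wd_ge0 (mu t) (mu 1)).
move: (wd (mu 0) (mu s)) (wd (mu s) (mu t)) (wd (mu t) (mu 1)) => a x b.
rewrite subr0 => ha hx hb tri a0 x0 b0.
set l := t - s in hx *; have l0 : 0 <= l by rewrite subr_ge0.
have l1 : l <= 1 by rewrite /l; lra.
(* The two outer pieces are pooled into one of length [y] and duration [1 - l], leaving two pieces
   to compare. *)
pose y := a + b; have y0 : 0 <= y by rewrite addr_ge0.
have hy : y ^+ 2 <= (1 - l) * (ea + eb).
  have -> : 1 - l = s + (1 - t) by rewrite /l; ring.
  by apply: sum_sqrt_le => //; rewrite subr_ge0.
have hxy : (x + y) ^+ 2 <= (w + e) ^+ 2.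
  apply: le_trans Er; have -> : ea + (ex + eb) = (l + (1 - l)) * (ex + (ea + eb)) by ring.
  by apply: sum_sqrt_le => //; rewrite ?subr_ge0 ?addr_ge0.
have xyw : w <= x + y by rewrite /y; lra.
have xyr : x + y <= w + e.
  by rewrite -ler_sqr ?nnegrE ?addr_ge0// ltW.
have key : (x - l * (x + y)) ^+ 2 <= (eta / 2) ^+ 2.
  (* The defect of [x^2 / l + y^2 / (1 - l) >= (x + y)^2], cleared of denominators. *)
  have par : x ^+ 2 * (1 - l) + y ^+ 2 * l =
      l * (1 - l) * (x + y) ^+ 2 + (x - l * (x + y)) ^+ 2 by ring.
  have b1 : x ^+ 2 * (1 - l) + y ^+ 2 * l <= l * (1 - l) * (w + e) ^+ 2.
    apply: (@le_trans _ _ (l * (1 - l) * (ex + (ea + eb)))).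
      have : x ^+ 2 * (1 - l) <= l * ex * (1 - l) by rewrite ler_wpM2r// subr_ge0.
      have : y ^+ 2 * l <= (1 - l) * (ea + eb) * l by rewrite ler_wpM2r.
      lra.
    by rewrite ler_wpM2l ?mulr_ge0 ?subr_ge0//; lra.
  have ll : 0 <= l * (1 - l) <= 1.
    by rewrite mulr_ge0 ?subr_ge0//= mulr_ile1 ?subr_ge0//; lra.
  have w2 : w ^+ 2 <= (x + y) ^+ 2 by rewrite ler_sqr ?nnegrE ?addr_ge0.
  have b2 : (x - l * (x + y)) ^+ 2 <= l * (1 - l) * ((w + e) ^+ 2 - w ^+ 2).
    have /andP[ll0 _] := ll.
    have : l * (1 - l) * w ^+ 2 <= l * (1 - l) * (x + y) ^+ 2 by rewrite ler_wpM2l.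
    lra.
  apply: (le_trans b2); have /andP[_ ll1] := ll.
  have we2 : (w + e) ^+ 2 - w ^+ 2 = e * (2 * w + e) by ring.
  rewrite we2; apply: (@le_trans _ _ (e * (2 * w + e))).
    by rewrite ler_piMl// mulr_ge0 ?(ltW e0)// addr_ge0 ?mulr_ge0// ltW.
  have w10 : 0 < 2 * w + 1 by rewrite ltr_wpDl// mulr_ge0.
  rewrite (ler_pdivlMr _ _ w10) in e3.
  apply: le_trans e3; rewrite ler_wpM2l ?(ltW e0)//; lra.
have : x - l * (x + y) <= eta / 2.
  apply: (le_trans (ler_norm _)); rewrite -[leRHS]ger0_norm ?divr_ge0 ?(ltW eta0)//.
  by rewrite -ler_sqr ?nnegrE// !real_normK ?num_real.
have : l * (x + y) <= l * (w + e) by rewrite ler_wpM2l.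
have : l * e <= e by rewrite ler_piMl// ltW.
lra.
Qed.

End RealDistance.

(** * Existence of geodesics *)

Section Geodesics.
Variables (R : realType) (n : nat).
Notation V := 'rV[R]_n.+1.

Lemma simplex_compact : compact (@simplex R n).
Proof.
apply: bounded_closed_compact.
  exists 1; split => // M M1 p sp; apply: (le_trans _ (ltW M1)).
  by apply: norm_le_coord => // x; rewrite ger0_norm ?simplex_ge0// simplex_le1.
have cx (x : 'I_n.+1) : continuous (fun p : V => p 0 x) by move=> p; exact: coord_continuous.
have csum : continuous (fun p : V => \sum_x p 0 x).
  by apply: continuous_big => [|x _]; [exact: add_continuous|exact: cx].
have -> : @simplex R n = \bigcap_(x in [set: 'I_n.+1]) [set p : V | 0 <= p 0 x] `&`
    [set p : V | \sum_x p 0 x = 1].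
  apply/seteqP; split => p /= [h1 h2]; split => // x; [move=> _|]; exact: h1.
apply: closedI.
  apply: closed_bigI => x _.
  by apply: (@closed_comp _ _ (fun p : V => p 0 x) [set u | 0 <= u]) => [p _|];
    [exact: cx|exact: closed_ge].
apply: (@closed_comp _ _ (fun p : V => \sum_x p 0 x) [set u | u = 1]) => [p _|]; last exact: closed_eq.
exact: csum.
Qed.

Lemma ultra_limit (U : set_system nat) (f : nat -> V) : UltraFilter U ->
  (forall k, simplex (f k)) -> exists x, simplex x /\
  forall r, 0 < r -> U [set k | `|f k - x| <= r].
Proof.
move=> UU sf; have UP : ProperFilter U by exact: ultra_proper.
have [|x [sx cx]] := @simplex_compact (f @ U) _.
  by apply: (@filterS _ U _ setT) => [k _|]; [exact: sf|exact: filterT].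
exists x; split => // r r0; have [//|UC] := in_ultra_setVsetC [set k | `|f k - x| <= r] UU.
have h1 : (f @ U) [set y | ~ (`|y - x| <= r)] by exact: UC.
have h2 : nbhs x [set y : V | `|y - x| <= r].
  apply: filterS (nbhsx_ballx x r r0) => y; rewrite -ball_normE /= distrC; exact: ltW.
by have [y []] := cx _ _ h1 h2.
Qed.

Variables (K : V -> 'I_n.+1 -> R) (Q : V -> 'M[R]_n.+1).
Hypothesis triple : nonlinear_markov_triple K Q.

(** An ultrafilter gives limits at uncountably many times simultaneously. Since [Wgeodesic] only
    speaks of distances, continuity of [W] is enough to pass to the limit, and no limit of the
    potentials is sought. *)
Lemma geodesic_exists (p q : V) : simplex p -> simplex q ->
  exists mu, [/\ Wgeodesic Q mu, mu 0 = p & mu 1 = q].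
Proof.
move=> sp sq; have ik0 k : 0 < k.+1%:R^-1 :> R by rewrite invr_gt0.
have [f hf] := choice (fun k => almost_geodesic triple sp sq (ik0 k)).
have [U [UU oU]] := ultraFilterLemma (eventually_filter : ProperFilter \oo).
have UP : ProperFilter U by exact: ultra_proper.
have lim t : exists x, 0 <= t -> t <= 1 -> simplex x /\
    forall r, 0 < r -> U [set k | `|f k t - x| <= r].
  have [t01|nt] := boolP ((0 <= t) && (t <= 1)); last first.
    by exists 0 => t0 t1; rewrite t0 t1 in nt.
  have /andP[t0 t1] := t01.
  have [k|x hx] := @ultra_limit U (fun k => f k t) UU; last by exists x.
  by case: (hf k) => h _ _ _; exact: h.
have [g hg] := choice lim.
have const t c : 0 <= t -> t <= 1 -> (forall k, f k t = c) -> g t = c.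
  move=> t0 t1 fc; have [_ gt] := hg t t0 t1.
  apply/eqP; rewrite eq_sym -subr_eq0 -normr_le0; apply/ler_addgt0Pl => e e0; rewrite addr0.
  by have /filter_ex[k] := gt e e0; rewrite /= fc.
have g0 : g 0 = p by apply: const => // k; case: (hf k).
have g1 : g 1 = q by apply: const => // k; case: (hf k).
have sg t : 0 <= t -> t <= 1 -> simplex (g t) by move=> t0 t1; case: (hg t t0 t1).
set w := wd Q p q.
have up s t : 0 <= s -> s <= t -> t <= 1 -> wd Q (g s) (g t) <= (t - s) * w.
  move=> s0 st t1; have s1 := le_trans st t1; have t0 := le_trans s0 st.
  (* One third of [e] for each endpoint, and one for the defect of [f k]. *)
  apply/ler_addgt0Pr => e e0; have e30 : 0 < e / 3 by rewrite divr_gt0.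
  have [rs rs0 hrs] := wd_near triple (sg s s0 s1) e30.
  have [rt rt0 hrt] := wd_near triple (sg t t0 t1) e30.
  have Uk : U [set k | k.+1%:R^-1 <= e / 3 :> R].
    by apply: oU; apply: filterS (near_infty_natSinv_lt (PosNum e30)) => k /ltW.
  have [k [[/= k1 k2] k3]] := filter_ex (filterI (filterI ((hg s s0 s1).2 rs rs0)
    ((hg t t0 t1).2 rt rt0)) Uk).
  have [sf _ _ hk] := hf k; have sfs := sf s s0 s1; have sft := sf t t0 t1.
  have := hk s t s0 st t1; rewrite -/w.
  have := hrs _ sfs k1; have := hrt _ sft k2.
  have := wd_triangle triple (sg s s0 s1) sfs (sg t t0 t1).
  have := wd_triangle triple sfs sft (sg t t0 t1).
  rewrite (wd_sym triple (g t) (f k t)); move: k3 => /=; move: (k.+1%:R^-1) => v; lra.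
(* The upper bounds are forced to be equalities: were the middle piece shorter, the three pieces
   together could not cover the distance from [p] to [q]. *)
have eq s t : 0 <= s -> s <= t -> t <= 1 -> wd Q (g s) (g t) = (t - s) * w.
  move=> s0 st t1; have s1 := le_trans st t1; have t0 := le_trans s0 st.
  apply/eqP; rewrite eq_le up//=.
  have := up 0 s (lexx _) s0 s1; have := up t 1 t0 t1 (lexx _).
  have := wd_triangle triple (sg 0 (lexx _) ler01) (sg s s0 s1) (sg 1 ler01 (lexx _)).
  have := wd_triangle triple (sg s s0 s1) (sg t t0 t1) (sg 1 ler01 (lexx _)).
  rewrite g0 g1 -/w; lra.
exists g; split => //; split => [t|s t]; first by rewrite in_itv/= => /andP[]; exact: sg.
rewrite !in_itv/= => /andP[s0 s1] /andP[t0 t1].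
rewrite g0 g1 !(wdE triple)//; try exact: sg.
rewrite -EFinM; congr (_%:E); have [st|/ltW ts] := leP s t.
  by rewrite eq// distrC ger0_norm// subr_ge0.
by rewrite (wd_sym triple) eq// ger0_norm// subr_ge0.
Qed.

End Geodesics.

(** * The free energy and its dissipation *)

Section Linearization.
Variables (R : realType) (n : nat).
Notation V := 'rV[R]_n.+1.
Notation N := (n.+1%:R : R).

(** Differentiability at [mu] in the sense of Frechet, with an explicit radius and with the
    differential given by its coordinates. *)
Definition linearized (f : V -> R) (mu : V) (g : 'I_n.+1 -> R) := forall eps, 0 < eps ->
  exists2 r, 0 < r & forall nu : V, `|nu - mu| <= r ->
  `|f nu - f mu - \sum_x g x * (nu 0 x - mu 0 x)| <= eps * `|nu - mu|.

Lemma linearizedD f1 f2 mu g1 g2 : linearized f1 mu g1 -> linearized f2 mu g2 ->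
  linearized (fun p => f1 p + f2 p) mu (fun x => g1 x + g2 x).
Proof.
move=> h1 h2 eps e0; have e20 : 0 < eps / 2 by rewrite divr_gt0.
have [r1 r10 H1] := h1 _ e20; have [r2 r20 H2] := h2 _ e20.
exists (Num.min r1 r2) => [|nu]; first by rewrite lt_min r10 r20.
rewrite le_min => /andP[/H1 a1 /H2 a2].
have -> : \sum_x (g1 x + g2 x) * (nu 0 x - mu 0 x) =
    \sum_x g1 x * (nu 0 x - mu 0 x) + \sum_x g2 x * (nu 0 x - mu 0 x).
  by rewrite -big_split; apply: eq_bigr => x _; rewrite mulrDl.
have := ler_normD (f1 nu - f1 mu - \sum_x g1 x * (nu 0 x - mu 0 x))
  (f2 nu - f2 mu - \sum_x g2 x * (nu 0 x - mu 0 x)).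
set S1 := \sum_x g1 x * _ in a1 *; set S2 := \sum_x g2 x * _ in a2 *.
have -> : f1 nu - f1 mu - S1 + (f2 nu - f2 mu - S2) =
  f1 nu + f2 nu - (f1 mu + f2 mu) - (S1 + S2) by ring.
lra.
Qed.

Lemma is_derive_line (f : V -> R) (p v : V) (u d : R) :
  is_derive (p + u *: v) v f d -> is_derive u 1 (fun s => f (p + s *: v)) d.
Proof.
move=> [df Df]; have E : (fun h : R => h^-1 *: (((fun s : R => f (p + s *: v)) \o shift u) (h *: 1)
    - f (p + u *: v))) = (fun h => h^-1 *: ((f \o shift (p + u *: v)) (h *: v) - f (p + u *: v))).
  apply/funext => h /=; congr (_ *: (f _ - _)).
  by rewrite -[h *: 1]/(h * 1) mulr1 scalerDl addrCA.
split; first by move: df; rewrite /derivable -E.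
by move: Df; rewrite /derive -E.
Qed.

Lemma linearizedP (f : V -> R) (mu : V) (O : set V) : open O -> O mu ->
  (forall p, O p -> forall x, derivable f p (delta_mx 0 x)) ->
  (forall x, {for mu, continuous (partial x f)}) ->
  linearized f mu (fun x => partial x f mu).
Proof.
move=> oO Omu dO cf eps e0.
have N0 : 0 < N by rewrite ltr0n.
have e10 : 0 < eps / N by rewrite divr_gt0.
have : \forall p \near mu, O p /\ forall x, `|partial x f mu - partial x f p| <= eps / N.
  near=> p; split; first by near: p; exact: open_nbhs_nbhs.
  near: p; apply: filter_forall => x.
  by have /cvgrPdist_le/(_ _ e10) := cf x; exact.
move=> /nbhs_ballP[r /= r0]; rewrite -ball_normE => hr.
exists (r / 2) => [|nu nur]; first by rewrite divr_gt0.
have near p : `|p - mu| <= r / 2 -> O p /\ forall x, `|partial x f mu - partial x f p| <= eps / N.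
  by move=> pr; apply: hr => /=; rewrite distrC (le_lt_trans pr)// ltr_pdivrMr// ltr_pMr// ltrDl.
(* Change the coordinates one at a time and use the mean value theorem. *)
pose P (k : nat) : V := \row_x (if (x < k)%N then nu 0 x else mu 0 x).
have P0 : P 0%N = mu by apply/rowP => x; rewrite mxE.
have PN : P n.+1 = nu by apply/rowP => x; rewrite mxE ltn_ord.
pose d (x : 'I_n.+1) := nu 0 x - mu 0 x.
have PS (k : 'I_n.+1) : P k.+1 = P k + d k *: delta_mx 0 k.
  apply/rowP => x; rewrite !mxE eqxx /= ltnS leq_eqVlt.
  have [->|/negPf xk] := eqVneq x k; first by rewrite eqxx ltnn /= mulr1 /d addrC subrK.
  have -> : (x == k :> nat) = false by rewrite -xk; apply/eqP/eqP => [/val_inj ->|->].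
  by rewrite mulr0 addr0.
have step (k : 'I_n.+1) : `|f (P k.+1) - f (P k) - partial k f mu * d k| <= eps / N * `|nu - mu|.
  have seg (s : R) : 0 <= s -> s <= 1 -> `|P k + (s * d k) *: delta_mx 0 k - mu| <= r / 2.
    move=> s0 s1; apply: le_trans nur; apply: norm_le_coord => // x; rewrite !mxE eqxx /=.
    have := coord_le_norm (nu - mu) x; rewrite !mxE => dx.
    have [xk|xk] := eqVneq x k.
      rewrite xk ltnn mulr1 addrAC subrr add0r normrM (ger0_norm s0).
      by rewrite xk in dx; rewrite (le_trans _ dx)// ler_piMl.
    by rewrite mulr0 addr0; case: ifP => // _; rewrite subrr normr0.
  pose g s := f (P k + (s * d k) *: delta_mx 0 k).
  have dg (s : R) : 0 <= s -> s <= 1 ->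
      is_derive s 1 g (d k * partial k f (P k + (s * d k) *: delta_mx 0 k)).
    move=> s0 s1; have [Op _] := near _ (seg s s0 s1).
    have h1 := @is_derive_line f (P k) (delta_mx 0 k) (s * d k) _ (derivableP (dO _ Op k)).
    have h2 : is_derive s (1 : R) (fun s => s * d k) (d k).
      by apply: is_derive_eq; rewrite scaler0 add0r /GRing.scale /= mulr1.
    have h3 := @is_derive1_comp R (fun u => f (P k + u *: delta_mx 0 k)) (fun s => s * d k) s _ _ h1 h2.
    by apply: (is_derive_eq (h3 : is_derive s 1 g _)); rewrite mulrC.
  have [s||c /itvP c01] := @MVT_segment R g
      (fun s => d k * partial k f (P k + (s * d k) *: delta_mx 0 k)) 0 1 ler01.
  - by rewrite in_itv/= => /andP[/ltW s0 /ltW s1]; exact: dg.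
  - apply: (@continuous_in_subspaceT _ _ _ g) => s /set_mem.
    rewrite /= in_itv/= => /andP[s0 s1]; have [h _] := dg s s0 s1.
    exact/differentiable_continuous/derivable1_diffP.
  rewrite /g mul0r scale0r addr0 mul1r subr0 mulr1 -PS => ->.
  rewrite mulrC -mulrBl normrM ler_pM//.
    have [_ /(_ k)] := near _ (seg c ltac:(by rewrite c01) ltac:(by rewrite c01)); by rewrite distrC.
  by have := coord_le_norm (nu - mu) k; rewrite !mxE.
have -> : f nu - f mu = \sum_(k < n.+1) (f (P k.+1) - f (P k)).
  by rewrite -(big_mkord xpredT (fun k => f (P k.+1) - f (P k))) telescope_sumr// P0 PN.
rewrite -sumrB; apply: le_trans (ler_norm_sum _ _ _) _.
apply: (@le_trans _ _ (\sum_(k < n.+1) eps / N * `|nu - mu|)); first by apply: ler_sum => k _; exact: step.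
by rewrite sumr_const card_ord -[leLHS]mulr_natl mulrA [n.+1%:R * _]mulrC divfK ?gt_eqF.
Unshelve. all: by end_near. Qed.

Lemma linearized_sum (phi : R -> R) (mu : V) (g : 'I_n.+1 -> R) :
  (forall x, is_derive (mu 0 x) 1 phi (g x)) ->
  linearized (fun p => \sum_x phi (p 0 x)) mu g.
Proof.
move=> dphi eps e0; have N0 : 0 < N by rewrite ltr0n.
have e10 : 0 < eps / N by rewrite divr_gt0.
have one x : exists r, 0 < r /\ forall u, `|u - mu 0 x| <= r ->
    `|phi u - phi (mu 0 x) - g x * (u - mu 0 x)| <= eps / N * `|u - mu 0 x|.
  have [dx Dx] := dphi x.
  have /cvgrPdist_le/(_ _ e10) : (fun h => h^-1 *: ((phi \o shift (mu 0 x)) (h *: (1:R)) - phi (mu 0 x))) @ 0^' --> g x.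
    by move: (dx); rewrite /derivable /cvg_ex -Dx.
  move=> /nbhs_ballP[r /= r0 hr]; exists (r / 2); split; first by rewrite divr_gt0.
  move=> u ur; have [->|ux] := eqVneq u (mu 0 x).
    by rewrite !subrr mulr0 subr0 normr0 mulr0.
  have h0 : u - mu 0 x != 0 by rewrite subr_eq0.
  have := hr (u - mu 0 x); rewrite -ball_normE /= sub0r normrN h0.
  have ur' : `|u - mu 0 x| < r by rewrite (le_lt_trans ur)// ltr_pdivrMr// ltr_pMr// ltrDl.
  move=> /(_ ur' isT); rewrite /GRing.scale/= mulr1 subrK => H.
  have -> : phi u - phi (mu 0 x) - g x * (u - mu 0 x) =
      - (g x - (u - mu 0 x)^-1 * (phi u - phi (mu 0 x))) * (u - mu 0 x) by field.
  by rewrite normrM normrN ler_wpM2r.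
have [r hr] := choice one.
have [q q0 hq] := positive_min r.
exists q => // nu nuq; rewrite -!sumrB; apply: le_trans (ler_norm_sum _ _ _) _.
apply: (@le_trans _ _ (\sum_(k < n.+1) eps / N * `|nu - mu|)); last first.
  by rewrite sumr_const card_ord -[leLHS]mulr_natl mulrA [n.+1%:R * _]mulrC divfK ?gt_eqF.
apply: ler_sum => x _; have [rx0 H] := hr x.
have := coord_le_norm (nu - mu) x; rewrite !mxE => cx.
have cr : `|nu 0 x - mu 0 x| <= r x by rewrite (le_trans cx)// (le_trans nuq)// hq.
by apply: (le_trans (H _ cr)); rewrite ler_wpM2l// ltW.
Qed.

End Linearization.

(** At 0, the bound [- ln w <= 1 / w] for [w = sqrt v] gives [|v ln v| <= 2 sqrt v]. To the left of
    0 the function vanishes because [ln] does. *)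
Lemma continuous_xlnx (R : realType) : continuous (fun u : R => u * ln u).
Proof.
move=> u; have [u0|u0|->] := ltgtP u 0.
- have near0 : \forall v \near u, v * ln v = 0.
    near=> v; rewrite ln0 ?mulr0//; apply/ltW; near: v; exact: lt_nbhsl.
  rewrite /continuous_at (nbhs_singleton near0); apply: cvg_near_cst; exact: near0.
- by apply: cvgM; [exact: cvg_id|exact: continuous_ln].
apply/cvgrPdist_le => e e0; rewrite mul0r.
pose d := Num.min 1 ((e / 2) ^+ 2).
have d0 : 0 < d by rewrite lt_min ltr01 exprn_gt0// divr_gt0.
near=> v; rewrite sub0r normrN.
have vd : `|v| <= d by near: v; have := nbhsx_ballx (0 : R) d d0; apply: filterS => v;
  rewrite -ball_normE /= sub0r normrN; exact: ltW.
have [v0|v0] := leP v 0; first by rewrite ln0// mulr0 normr0 ltW.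
move: vd; rewrite gtr0_norm// le_min => /andP[v1 ve].
rewrite normrM gtr0_norm// ler0_norm ?ln_le0//.
set w := Num.sqrt v; have w0 : 0 < w by rewrite sqrtr_gt0.
have vw : v = w ^+ 2 by rewrite sqr_sqrtr// ltW.
have we : w <= e / 2.
  by rewrite -ler_sqr ?nnegrE -?vw// ?divr_ge0// ltW.
have iw : 0 < w^-1 by rewrite invr_gt0.
have lw : - ln w <= w^-1 by rewrite -lnV ?posrE//; exact/ltW/ln_sublinear.
rewrite {2}vw lnXn// vw mulr2n.
have -> : w ^+ 2 * - (ln w + ln w) = 2 * (w ^+ 2 * - ln w) by ring.
apply: (@le_trans _ _ (2 * (w ^+ 2 * w^-1))).
  by rewrite ler_pM2l// ler_wpM2l// sqr_ge0.
by rewrite expr2 mulfK ?gt_eqF// -ler_pdivlMl// mulrC.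
Unshelve. all: by end_near. Qed.

(** * The differential of the free energy and the Fisher information *)

Section FreeEnergy.
Variables (R : realType) (n : nat).
Variables (K : 'rV[R]_n.+1 -> 'I_n.+1 -> R) (Q : 'rV[R]_n.+1 -> 'M[R]_n.+1).
Hypothesis triple : nonlinear_markov_triple K Q.
Notation V := 'rV[R]_n.+1.

Lemma linearized_continuous (f : V -> R) mu g : linearized f mu g -> {for mu, continuous f}.
Proof.
move=> fl; suff : f p @[p --> nbhs mu] --> f mu by [].
apply/cvgrPdist_le => e e0.
have [r r0 hr] := fl 1 ltr01.
pose C := 1 + \sum_x `|g x|; have C0 : 0 < C by rewrite ltr_wpDr// sumr_ge0.
have d0 : 0 < Num.min r (e / C) by rewrite lt_min r0 divr_gt0.
near=> nu; have : `|nu - mu| <= Num.min r (e / C).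
  near: nu; have := nbhsx_ballx mu _ d0; apply: filterS => nu.
  by rewrite -ball_normE /= distrC; exact: ltW.
rewrite le_min => /andP[nr ne]; have := hr _ nr.
set S := \sum_x _; rewrite mul1r => h.
have SC : `|S| <= (\sum_x `|g x|) * `|nu - mu|.
  apply: (le_trans (ler_norm_sum _ _ _)); rewrite mulr_suml; apply: ler_sum => x _.
  by rewrite normrM ler_wpM2l//; have := coord_le_norm (nu - mu) x; rewrite !mxE.
rewrite distrC; have : C * `|nu - mu| <= e by rewrite -ler_pdivlMl// mulrC.
have := ler_normD (f nu - f mu - S) S; rewrite subrK /C; lra.
Unshelve. all: by end_near. Qed.

Lemma is_derive_coord (p : V) x y : is_derive p (delta_mx 0 y) (fun p : V => p 0 x) (x == y)%:R.
Proof.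
have h : (fun h : R => h^-1 *: (((fun p : V => p 0 x) \o shift p) (h *: delta_mx 0 y) - p 0 x)) @ 0^'
    --> ((x == y)%:R : R).
  apply: cvg_near_cst; near=> h; rewrite /= !mxE eqxx /= addrK.
  rewrite -[_ *: _]/(_ * _) mulKf//; near: h; exact: nbhs_dnbhs_neq.
by split; [apply/cvg_ex; eexists; exact: h|exact/cvg_lim].
Unshelve. all: by end_near. Qed.

Lemma potential_linearized mu : simplex mu ->
  linearized (potential K) mu (hamiltonian K mu).
Proof.
move=> smu; have [A [oA sA KA]] := triple_C2 triple.
have Amu := sA _ smu.
(* The product rule for the partial derivative of the potential. It holds only on [A], which is
   open, so continuity at [mu] is transferred through equality near [mu]. *)
pose G y (p : V) : R := \sum_x (p 0 x *: partial y (fun q => K q x) p + K p x *: (x == y)%:R).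
have dU p y : A p -> is_derive p (delta_mx 0 y) (potential K) (G y p).
  move=> Ap; have -> : potential K = \sum_x ((fun p : V => p 0 x) * (fun q => K q x)).
    by apply/funext => q; rewrite fct_sumE.
  apply: is_derive_sum => x; apply: is_deriveM; first exact: is_derive_coord.
  by apply: derivableP; case: (KA x p Ap) => _ /(_ y)[].
apply: (@linearizedP _ _ _ _ A) => // [p Ap x|y].
  by case: (dU p x Ap).
have GE p : A p -> partial y (potential K) p = G y p by move=> /dU-/(_ y)[_].
suff : partial y (potential K) p @[p --> nbhs mu] --> G y mu by rewrite -(GE _ Amu).
apply: (@cvg_trans _ (G y @ mu)).
  apply: near_eq_cvg; near=> p; apply/esym/GE; near: p; exact: open_nbhs_nbhs.
suff : G y p @[p --> nbhs mu] --> G y mu by [].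
apply: cvg_big => [|x _]; first exact: add_continuous.
have [cK /(_ y)[_ cD _]] := KA x _ Amu.
apply: cvgD; apply: cvgZ; [exact: coord_continuous|exact: cD|exact: cK|exact: cvg_cst].
Unshelve. all: by end_near. Qed.

Lemma free_energy_continuous mu : simplex mu -> {for mu, continuous (free_energy K)}.
Proof.
move=> smu; suff : free_energy K p @[p --> nbhs mu] --> free_energy K mu by [].
apply: cvgD; last exact: linearized_continuous (potential_linearized smu).
apply: cvg_big => [|x _]; first exact: add_continuous.
by apply: (@continuous_comp _ _ _ (fun p : V => p 0 x) (fun u => u * ln u));
  [exact: coord_continuous|exact: continuous_xlnx].
Qed.

Definition dfree (mu : V) (x : 'I_n.+1) : R := (ln (mu 0 x) + 1) + hamiltonian K mu x.

Lemma is_derive_xlnx (u : R) : 0 < u -> is_derive u 1 (fun u => u * ln u) (ln u + 1).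
Proof.
move=> u0; have h := is_deriveM (is_derive_id u 1) (is_derive1_ln u0).
apply: (is_derive_eq h); rewrite -![_ *: _]/(_ * _).
by rewrite mulfV ?gt_eqF// mulr1 addrC.
Qed.

Lemma free_energy_linearized (mu : V) : simplex mu -> (forall x, 0 < mu 0 x) ->
  linearized (free_energy K) mu (dfree mu).
Proof.
move=> smu mu0; apply: linearizedD; last exact: potential_linearized.
by apply: (linearized_sum (phi := fun u => u * ln u)) => x; exact: is_derive_xlnx.
Qed.

Definition fisher (mu : V) : R :=
  2^-1 * \sum_x \sum_(y | y != x) Theta (mu 0 x * Q mu x y) (mu 0 y * Q mu y x).

(** The logarithm of detailed balance; the partition function and the constant 1 of the entropy
    cancel in the difference. *)
Lemma dfreeB (mu : V) x y : simplex mu -> (forall x, 0 < mu 0 x) -> 0 < Q mu x y ->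
  dfree mu x - dfree mu y = ln (mu 0 x * Q mu x y) - ln (mu 0 y * Q mu y x).
Proof.
move=> smu mu0 Qxy; have Qyx := rate_gt0_sym triple smu Qxy.
have Z0 : 0 < (partition_function K mu)^-1.
  by have := gibbs_gt0 K mu x; rewrite /gibbs pmulr_lgt0 ?expR_gt0.
have := triple_reversible triple smu x y; rewrite /gibbs /dfree.
move: (partition_function K mu)^-1 Z0 (hamiltonian K mu x) (hamiltonian K mu y) => Z Z0 hx hy.
rewrite -!mulrA => /(mulfI (lt0r_neq0 Z0)).
move/(congr1 (@ln R)); rewrite !lnM ?posrE ?expR_gt0// !expRK; lra.
Qed.

Lemma rate_eq0_sym (mu : V) x y : simplex mu -> x != y -> Q mu x y <= 0 ->
  Q mu x y = 0 /\ Q mu y x = 0.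
Proof.
move=> smu xy Qxy; have [r0 _] := triple_rates triple smu.
split; apply/eqP; rewrite eq_le ?Qxy ?r0 ?(eq_sym y)//= andbT leNgt.
by apply/negP => /(rate_gt0_sym triple smu); rewrite ltNge Qxy.
Qed.

Lemma Theta_dfree (mu : V) x y : simplex mu -> (forall x, 0 < mu 0 x) -> x != y ->
  (dfree mu x - dfree mu y) * (mu 0 x * Q mu x y - mu 0 y * Q mu y x) =
  Theta (mu 0 x * Q mu x y) (mu 0 y * Q mu y x).
Proof.
move=> smu mu0 xy; have [Q0|Q0] := ltP 0 (Q mu x y).
  by rewrite dfreeB// mulrC.
have [-> ->] := rate_eq0_sym smu xy Q0.
by rewrite (mulr0 (mu 0 x)) (mulr0 (mu 0 y)) /Theta subrr mulr0 mul0r.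
Qed.

Lemma Theta_ge0 (a b : R) : 0 <= a -> 0 <= b -> (a == 0) = (b == 0) -> 0 <= Theta a b.
Proof.
move=> a0 b0; have [->|a1] := eqVneq a 0; first by move/esym/eqP ->; rewrite /Theta subrr mul0r.
move/esym/negbT => b1; have {a0 a1} : 0 < a by rewrite lt_def a1.
have {b0 b1} : 0 < b by rewrite lt_def b1.
move=> b0 a0; rewrite /Theta; have [ab|ab] := leP a b.
  by apply: mulr_le0; rewrite subr_le0 ?ler_ln.
by apply: mulr_ge0; rewrite subr_ge0 ?ler_ln// ltW.
Qed.

Lemma Theta_eq0 (a b : R) : 0 < a -> 0 < b -> Theta a b = 0 -> a = b.
Proof.
move=> a0 b0 /eqP; rewrite mulf_eq0 !subr_eq0 => /orP[/eqP//|/eqP/ln_inj]; exact.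
Qed.

Lemma sum_mulmx_rates (mu : V) (g : 'I_n.+1 -> R) : simplex mu ->
  \sum_y g y * (mu *m Q mu) 0 y = - (2^-1 * \sum_x \sum_(y | y != x)
    (g x - g y) * (mu 0 x * Q mu x y - mu 0 y * Q mu y x)).
Proof.
move=> smu; have [_ Qd] := triple_rates triple smu.
pose T := \sum_x \sum_(y | y != x) (g y - g x) * (mu 0 x * Q mu x y).
have -> : \sum_y g y * (mu *m Q mu) 0 y = T.
  under eq_bigr do rewrite mxE mulr_sumr.
  rewrite exchange_big; apply: eq_bigr => x _ /=.
  rewrite (bigD1 x)//= Qd.
  have -> : g x * (mu 0 x * - \sum_(y | y != x) Q mu x y) =
      \sum_(y | y != x) - (g x * (mu 0 x * Q mu x y)).
    by rewrite sumrN -!mulr_sumr; ring.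
  rewrite -big_split/=.
  by apply: eq_bigr => y _; ring.
have TE : T = \sum_x \sum_(y | y != x) (g x - g y) * (mu 0 y * Q mu y x).
  rewrite /T (exchange_big_dep xpredT)//=; apply: eq_bigr => x _.
  by apply: eq_bigl => y; rewrite eq_sym.
have : - (2^-1 * \sum_x \sum_(y | y != x)
    (g x - g y) * (mu 0 x * Q mu x y - mu 0 y * Q mu y x)) = 2^-1 * (T + T).
  rewrite {2}TE /T -mulrN -sumrN -big_split; congr (_ * _); apply: eq_bigr => x _ /=.
  rewrite -sumrN -big_split; apply: eq_bigr => y _ /=; ring.
by move=> ->; field.
Qed.

Lemma dfree_flow (mu : V) : simplex mu -> (forall x, 0 < mu 0 x) ->
  \sum_y dfree mu y * (mu *m Q mu) 0 y = - fisher mu.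
Proof.
move=> smu mu0; rewrite sum_mulmx_rates// /fisher; congr (- (_ * _)).
apply: eq_bigr => x _; apply: eq_bigr => y yx; rewrite Theta_dfree//.
by rewrite eq_sym.
Qed.

(** The logarithmic mean turns one of the two logarithmic differences into [a - b], which leaves
    [Theta a b]. The identity is used in both orders because [weight] averages them. *)
Lemma dirichlet_dfree (mu : V) : simplex mu -> (forall x, 0 < mu 0 x) ->
  dirichlet (weight Q mu) (dfree mu) (dfree mu) = fisher mu.
Proof.
move=> smu mu0; rewrite /dirichlet /fisher; congr (_ * _); apply: eq_bigr => x _.
rewrite (bigD1 x)//= subrr mulr0 mulr0 add0r; apply: eq_bigr => y yx.
have xy : x != y by rewrite eq_sym.
rewrite -Theta_dfree// /weight (negPf xy) !mxE.
have [Q0|Q0] := ltP 0 (Q mu x y); last first.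
  have [-> ->] := rate_eq0_sym smu xy Q0.
  by rewrite (mulr0 (mu 0 x)) (mulr0 (mu 0 y)) (log_mean_diag (lexx 0)) addr0 !mul0r subr0 mulr0.
have a0 : 0 < mu 0 x * Q mu x y by rewrite mulr_gt0.
have b0 : 0 < mu 0 y * Q mu y x by rewrite mulr_gt0// (rate_gt0_sym triple).
have h1 := log_mean_mul_lnB a0 b0; have h2 := log_mean_mul_lnB b0 a0.
rewrite -(opprB (dfree mu x)) dfreeB//.
move: (mu 0 x * _) (mu 0 y * _) h1 h2 {a0 b0} => a b.
move: (log_mean a b) (log_mean b a) (ln a) (ln b) => l1 l2 u v h1 h2.
have -> : (l1 + l2) / 2 * (- (u - v) * - (u - v)) =
   (l1 * (u - v) - l2 * (v - u)) / 2 * (u - v) by ring.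
by rewrite h1 h2; field.
Qed.

End FreeEnergy.

(** If both arguments are positive, nearby ones lie below [(1 + k) * a] and [(1 + k) * b], and
    monotonicity and homogeneity conclude. If both vanish, the mean is at most the sum. *)
Lemma log_mean_usc (R : realType) (a b eta : R) : 0 <= a -> 0 <= b ->
  (a == 0) = (b == 0) -> 0 < eta ->
  exists k, 0 < k /\ forall a' b', 0 <= a' -> 0 <= b' -> a' <= a + k -> b' <= b + k ->
  log_mean a' b' <= log_mean a b + eta.
Proof.
move=> a0 b0 ab eta0; have l0 := log_mean_ge0 a b.
have l1 : 0 < log_mean a b + 1 by rewrite ltr_wpDl.
have [a00|an0] := eqVneq a 0.
  have b00 : b = 0 by apply/eqP; rewrite -ab a00.
  exists (eta / 2); split; first by rewrite divr_gt0.
  move=> a' b' a'0 b'0; rewrite a00 b00 !add0r => ha hb.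
  have := log_mean_le_add a'0 b'0; have := log_mean_ge0 (0 : R) 0.
  by move: (log_mean a' b') (log_mean 0 0) => l l'; lra.
have bn0 : b != 0 by rewrite -ab.
have ap : 0 < a by rewrite lt_def an0.
have bp : 0 < b by rewrite lt_def bn0.
pose k := eta / (log_mean a b + 1).
have k0 : 0 < k by rewrite divr_gt0.
exists (Num.min (k * a) (k * b)); split; first by rewrite lt_min (mulr_gt0 k0 ap) (mulr_gt0 k0 bp).
move=> a' b' a'0 b'0 ha hb.
apply: (@le_trans _ _ (log_mean ((1 + k) * a) ((1 + k) * b))).
  apply: log_mean_le => //; rewrite mulrDl mul1r.
    by apply: (le_trans ha); rewrite lerD2l ge_min lexx.
  by apply: (le_trans hb); rewrite lerD2l ge_min lexx orbT.
have k10 : 0 <= 1 + k by rewrite addr_ge0// ltW.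
rewrite (log_meanZ k10 a0 b0) mulrDl mul1r lerD2l.
by rewrite /k mulrAC ler_pdivrMr// ler_pM2l// lerDl.
Qed.

(** * The functional inequalities *)

Section ModifiedLogSobolev.
Variables (R : realType) (n : nat).
Variables (K : 'rV[R]_n.+1 -> 'I_n.+1 -> R) (Q : 'rV[R]_n.+1 -> 'M[R]_n.+1).
Hypothesis triple : nonlinear_markov_triple K Q.
Notation V := 'rV[R]_n.+1.
Let rQ : regular_rates Q := triple_regular triple.

Lemma rate_mass_lipschitz : exists2 M, 0 < M & forall p q : V, simplex p -> simplex q ->
  forall x y, `|p 0 x * Q p x y - q 0 x * Q q x y| <= M * `|p - q|.
Proof.
have [L L0 hL] := rates_lipschitz rQ; have [C C0 hC] := rates_bounded rQ.
exists (L + C); first exact: addr_gt0.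
move=> p q sp sq x y.
have -> : p 0 x * Q p x y - q 0 x * Q q x y =
  p 0 x * (Q p x y - Q q x y) + (p 0 x - q 0 x) * Q q x y by ring.
apply: (le_trans (ler_normD _ _)); rewrite !normrM mulrDl lerD//.
  rewrite -[leRHS]mul1r ler_pM// ?hL// ger0_norm ?simplex_ge0//.
  exact: simplex_le1.
rewrite mulrC ler_pM// ?hC//.
by have := coord_le_norm (p - q) x; rewrite !mxE.
Qed.

(** Provides the constant [B] of [curve_young] for curves close to [mu], where only an upper bound
    is asked for. *)
Lemma dirichlet_usc (mu : V) (f : 'I_n.+1 -> R) eta : simplex mu -> (forall x, 0 < mu 0 x) ->
  0 < eta -> exists2 r, 0 < r & forall nu, simplex nu -> `|nu - mu| <= r ->
  dirichlet (weight Q nu) f f <= dirichlet (weight Q mu) f f + eta.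
Proof.
move=> smu mu0 eta0.
pose S := 2^-1 * \sum_x \sum_y (f y - f x) ^+ 2.
have S0 : 0 <= S.
  by rewrite mulr_ge0// sumr_ge0// => x _; rewrite sumr_ge0// => y _; exact: sqr_ge0.
have S1 : 0 < S + 1 by rewrite ltr_wpDl.
have e0 : 0 < eta / (S + 1) by rewrite divr_gt0.
have ex (z : 'I_n.+1 * 'I_n.+1) : exists k, 0 < k /\ (z.1 != z.2 -> forall a' b', 0 <= a' -> 0 <= b' ->
    a' <= mu 0 z.1 * Q mu z.1 z.2 + k -> b' <= mu 0 z.2 * Q mu z.2 z.1 + k ->
    log_mean a' b' <= Lambda Q mu z.1 z.2 + eta / (S + 1)).
  case: z => x y /=; have [->|xy] := eqVneq x y; first by exists 1.
  have [||||k [k0 hk]] := @log_mean_usc R (mu 0 x * Q mu x y) (mu 0 y * Q mu y x) (eta / (S + 1)).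
  - exact: rate_mass_ge0.
  - by apply: rate_mass_ge0 => //; rewrite eq_sym.
  - rewrite !mulf_eq0 (gt_eqF (mu0 x)) (gt_eqF (mu0 y)) /=; have [Q0|Q0] := ltP 0 (Q mu x y).
      by rewrite !gt_eqF// (rate_gt0_sym triple).
    by have [-> ->] := rate_eq0_sym triple smu xy Q0.
  - by [].
  by exists k; split => // _; rewrite mxE.
have [k hk] := choice ex; have [q q0 hq] := positive_min k.
have [M M0 hM] := rate_mass_lipschitz.
exists (q / M) => [|nu snu nr]; first by rewrite divr_gt0.
have mass x y : nu 0 x * Q nu x y <= mu 0 x * Q mu x y + q.
  have := hM _ _ snu smu x y; have : M * `|nu - mu| <= q by rewrite -ler_pdivlMl// mulrC.
  by rewrite ler_norml => h /andP[_]; lra.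
have LL x y : x != y -> Lambda Q nu x y <= Lambda Q mu x y + eta / (S + 1).
  move=> xy; rewrite [leLHS]mxE; have [kx hkx] := hk (x, y); apply: hkx => //.
  - exact: rate_mass_ge0.
  - by apply: rate_mass_ge0 => //; rewrite eq_sym.
  - by apply: (le_trans (mass _ _)); rewrite lerD2l hq.
  - by apply: (le_trans (mass _ _)); rewrite lerD2l hq.
have avg (a b c d u : R) : a <= c + u -> b <= d + u -> (a + b) / 2 <= (c + d) / 2 + u by lra.
have ww x y : weight Q nu x y <= weight Q mu x y + eta / (S + 1).
  rewrite /weight; case: eqVneq => [_|xy]; first by rewrite add0r ltW.
  have yx : y != x by rewrite eq_sym.
  exact: avg (LL _ _ xy) (LL _ _ yx).
apply: (@le_trans _ _ (dirichlet (weight Q mu) f f + eta / (S + 1) * S)); last first.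
  by rewrite lerD2l mulrAC ler_pdivrMr// ler_pM2l// lerDl.
rewrite /dirichlet /S mulrCA -mulrDr ler_pM2l ?invr_gt0// mulr_sumr -big_split/=.
apply: ler_sum => x _; rewrite mulr_sumr -big_split; apply: ler_sum => y _ /=.
by rewrite -expr2 -mulrDl ler_wpM2r// sqr_ge0.
Qed.

Variable lam : R.
Hypothesis lam0 : 0 < lam.
Hypothesis ric : Ric_ge Q K lam.
Notation F := (free_energy K).

Lemma convex_geodesic (p q : V) : simplex p -> simplex q -> exists g : R -> V,
  [/\ forall t, 0 <= t -> t <= 1 -> simplex (g t), g 0 = p, g 1 = q,
      forall t, 0 <= t -> t <= 1 -> wd Q p (g t) = t * wd Q p q &
      forall t, 0 <= t -> t <= 1 ->
        F (g t) <= (1 - t) * F p + t * F q - lam / 2 * t * (1 - t) * wd Q p q ^+ 2].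
Proof.
move=> sp sq; have [g [gg g0 g1]] := geodesic_exists triple sp sq.
have gt (t : R) : 0 <= t -> t <= 1 -> t \in `[0, 1] by move=> t0 t1; rewrite in_itv/= t0 t1.
have sg t : 0 <= t -> t <= 1 -> simplex (g t) by move=> t0 t1; apply: gg.1; exact: gt.
exists g; split => // t t0 t1.
  have := gg.2 0 t (gt 0 (lexx _) ler01) (gt t t0 t1); rewrite g0 g1 !(wdE triple)//; last exact: sg.
  by rewrite sub0r normrN ger0_norm// -EFinM => -[].
by have := ric gg (gt t t0 t1); rewrite g0 g1 (wdE triple).
Qed.

Lemma mlsi_interior (mu nu : V) : simplex mu -> (forall x, 0 < mu 0 x) -> simplex nu ->
  F mu - F nu <= fisher Q mu / (2 * lam).
Proof.
move=> smu mu0 snu; set w := wd Q mu nu; have w0 : 0 <= w by exact: wd_ge0.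
have [C C0 hC] := curve_modulus rQ.
(* [e * M] bounds the errors left after division by [t]: in order, those from the semicontinuity of
   the Dirichlet form, from the excess of the length over [w], from the linearization of [F], and
   from the factor [1 - t] in the convexity defect. *)
pose M := (2 * lam)^-1 + lam / 2 * (2 * w + 1) + C * (w + 1) + lam / 2 * w ^+ 2.
have M0 : 0 < M.
  rewrite /M ltr_pwDl// ?mulr_ge0 ?sqr_ge0 ?divr_ge0 ?(ltW lam0)//.
  rewrite ltr_pwDl// ?mulr_ge0 ?addr_ge0 ?(ltW C0)//.
  by rewrite ltr_pwDl// ?invr_gt0 ?mulr_gt0// !mulr_ge0 ?addr_ge0 ?mulr_ge0 ?(ltW lam0).
apply/ler_addgt0Pr => d d0.
have [e [e0 e1 e2 _ _]] : exists e, [/\ 0 < e, e <= 1, e <= d / M, e <= 1 & e <= 1].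
  by apply: small_param; rewrite ?divr_gt0.
have [r1 r10 usc] := dirichlet_usc (dfree K mu) smu mu0 e0.
have [r2 r20 lin] := free_energy_linearized triple smu mu0 e0.
have we0 : 0 < w + e by rewrite ltr_wpDl.
(* The curve stays within [C * r] of [mu], where [r = t * (w + e)]; these bounds keep it in the
   neighbourhoods of radius [r1] and [r2]. *)
have [t [t0 t1 te tr1 tr2]] : exists t, [/\ 0 < t, t <= 1, t <= e,
    t <= r1 / (C * (w + e)) & t <= r2 / (C * (w + e))].
  by apply: small_param; rewrite ?divr_gt0 ?mulr_gt0.
have [g [sg g0 g1 gw gF]] := convex_geodesic smu snu.
have sgt := sg t (ltW t0) t1.
pose r := t * (w + e); have r0 : 0 < r by rewrite mulr_gt0.
have gr : wd Q mu (g t) < r.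
  by rewrite gw ?(ltW t0)// -/w ltr_pM2l// ltrDl.
have [m [psi [cm m0 m1 /ltW E]]] := wd_lt triple smu sgt gr.
have close s : 0 <= s -> s <= 1 -> `|m s - mu| <= C * r.
  move=> s0 s1; apply: norm_le_coord => [|x]; first by rewrite mulr_ge0// ltW.
  have := hC r m psi r0 cm E 0 s (lexx _) s0 s1 x; by rewrite m0 !mxE.
have Cr1 : C * r <= r1.
  by rewrite /r mulrCA -ler_pdivlMr// mulr_gt0.
have Cr2 : C * r <= r2.
  by rewrite /r mulrCA -ler_pdivlMr// mulr_gt0.
have tl0 : 0 < t / lam by rewrite divr_gt0.
(* The weight [t / lam] in Young's inequality makes the two quadratic terms in
   [w] cancel to first order in [t]. *)
have young := @curve_young _ _ _ rQ 0 1 (r ^+ 2) (t / lam) (fisher Q mu + e) m psi (dfree K mu)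
  ler01 cm E tl0.
have {young} := young _; rewrite m0 m1 subr0 mulr1.
have -> : t / lam * (fisher Q mu + e) + (t / lam)^-1 * r ^+ 2 =
    t * ((fisher Q mu + e) / lam + lam * (w + e) ^+ 2).
  by rewrite /r; field; rewrite !gt_eqF.
move=> young; have {young} : `|\sum_x dfree K mu x * (g t 0 x - mu 0 x)| <=
    t * ((fisher Q mu + e) / lam + lam * (w + e) ^+ 2) / 2.
  apply: young => s; rewrite /= in_itv/= => /andP[s0 s1].
  rewrite -(dirichlet_dfree triple smu mu0); apply: usc.
    by apply: (sc_simplex cm); rewrite /= in_itv/= s0 s1.
  exact: le_trans (close s s0 s1) Cr1.
have gtC : `|g t - mu| <= C * r by rewrite -m1; exact: close.
have := lin (g t) (le_trans gtC Cr2).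
have := gF t (ltW t0) t1; rewrite -/w.
set S := \sum_x _; move: (F mu) (F nu) (F (g t)) (fisher Q mu) => a b c I h1 h2 h3.
have h4 : a - c <= t * ((I + e) / lam + lam * (w + e) ^+ 2) / 2 + e * (C * r).
  have : e * `|g t - mu| <= e * (C * r) by rewrite ler_wpM2l// ltW.
  move: h2 h3; rewrite !ler_norml => /andP[h2 _] /andP[h3 _]; lra.
have h5 : t * (a - b) <= t * (((I + e) / lam + lam * (w + e) ^+ 2) / 2 + e * C * (w + e)
    - lam / 2 * (1 - t) * w ^+ 2).
  by move: h1 h4; rewrite /r; lra.
rewrite (ler_pM2l t0) in h5; apply: (le_trans h5).
have eM : e * M <= d by rewrite -ler_pdivlMr.
apply: (@le_trans _ _ (I / (2 * lam) + e * M)); last by rewrite lerD2l.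
have i1 : I / (2 * lam) = I / lam / 2 by field; rewrite gt_eqF.
have i2 : (2 * lam)^-1 = lam^-1 / 2 by field; rewrite gt_eqF.
have i3 : e * C * (w + e) <= e * C * (w + 1).
  by rewrite ler_wpM2l ?mulr_ge0 ?(ltW e0) ?(ltW C0)// lerD2l.
have i4 : lam / 2 * w ^+ 2 * t <= lam / 2 * w ^+ 2 * e.
  by rewrite ler_wpM2l// mulr_ge0 ?sqr_ge0// divr_ge0// ltW.
have i5 : lam / 2 * (e * e) <= lam / 2 * e.
  by rewrite ler_wpM2l ?divr_ge0 ?(ltW lam0)// ler_piMr// ltW.
have -> : ((I + e) / lam + lam * (w + e) ^+ 2) / 2 + e * C * (w + e)
    - lam / 2 * (1 - t) * w ^+ 2 =
  I / lam / 2 + e * (lam^-1 / 2) + lam / 2 * (2 * w * e) + lam / 2 * (e * e) + e * C * (w + e)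
    + lam / 2 * w ^+ 2 * t by ring.
rewrite /M i1 i2.
have -> : I / lam / 2 + e * (lam^-1 / 2 + lam / 2 * (2 * w + 1) + C * (w + 1) + lam / 2 * w ^+ 2)
  = I / lam / 2 + e * (lam^-1 / 2) + lam / 2 * (2 * w * e) + lam / 2 * e + e * C * (w + 1)
    + lam / 2 * w ^+ 2 * e by ring.
by rewrite !lerD.
Qed.

End ModifiedLogSobolev.

(** Convexity, from [ln u <= u - 1] at [u = b / a]. The tangent is taken at [b], so that [a] may be
    0. *)
Lemma xlnx_tangent (R : realType) (a b : R) : 0 <= a -> 0 < b ->
  b * ln b - a * ln a <= (ln b + 1) * (b - a).
Proof.
move=> a0 b0; have [->|an0] := eqVneq a 0; first by rewrite mul0r !subr0; lra.
have ap : 0 < a by rewrite lt_def an0.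
have := @le_ln1Dx R (b / a - 1); rewrite ltrBrDl subrr divr_gt0// addrC subrK => /(_ isT).
rewrite ln_div ?posrE// -(ler_pM2l ap) !mulrBr mulr1 mulrCA mulfV// mulr1; lra.
Qed.

(** * Existence and positivity of minimizers *)

Section Minimizer.
Variables (R : realType) (n : nat).
Variables (K : 'rV[R]_n.+1 -> 'I_n.+1 -> R) (Q : 'rV[R]_n.+1 -> 'M[R]_n.+1).
Hypothesis triple : nonlinear_markov_triple K Q.
Notation V := 'rV[R]_n.+1.
Notation N := (n.+1%:R : R).
Notation F := (free_energy K).

Lemma uniform_simplex : simplex (const_mx N^-1 : V).
Proof.
split=> [x|]; first by rewrite mxE invr_ge0.
under eq_bigr do rewrite mxE.
by rewrite sumr_const card_ord -[LHS]mulr_natl mulfV// pnatr_eq0.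
Qed.

Lemma minimizer_exists : exists p, minimizer F p.
Proof.
have [||p /set_mem sp hp] := @EVT_min_rV R n.+1 F (@simplex R n) _ (@simplex_compact R n).
- by exists (const_mx N^-1); exact: uniform_simplex.
- by apply: continuous_in_subspaceT => p /set_mem sp; exact: free_energy_continuous triple _ sp.
by exists p; split => // q sq; apply: hp; exact/mem_set.
Qed.

(* A vanishing coordinate receives no flow only if its neighbours vanish too. *)
Lemma support_full (mu : V) : simplex mu ->
  (forall x, mu 0 x = 0 -> (mu *m Q mu) 0 x = 0) -> forall x, 0 < mu 0 x.
Proof.
move=> smu h; have rQ := triple_regular triple.
pose e := [rel u v | 0 < Q mu u v]; pose A := [pred x | 0 < mu 0 x].
have step u v : 0 < Q mu u v -> 0 < mu 0 u -> 0 < mu 0 v.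
  move=> Quv mu0; rewrite lt_def simplex_ge0// andbT; apply/negP => /eqP v0.
  have := h v v0; rewrite mxE.
  have uv := rate_gt0_neq triple smu Quv.
  have T0 z : 0 <= mu 0 z * Q mu z v.
    have [->|zv] := eqVneq z v; first by rewrite v0 mul0r.
    exact: rate_mass_ge0.
  have : 0 < \sum_z mu 0 z * Q mu z v.
    by rewrite (bigD1 u)//= ltr_pwDl ?mulr_gt0// sumr_ge0.
  by move=> /lt0r_neq0/eqP.
have cA : fingraph.closed e A.
  move=> u v Quv; apply/idP/idP; rewrite !inE; first exact: step.
  by apply: step; exact: (rate_gt0_sym triple smu).
have [z zA] : exists z, z \in A.
  apply/existsP; apply: contraT; rewrite negb_exists => /forallP p0.
  have /eqP := proj2 smu; rewrite big1 ?(eq_sym 0) ?oner_eq0// => z _.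
  by apply/eqP; rewrite eq_le simplex_ge0// andbT leNgt; exact: p0.
by move=> x; have := closed_connect cA (triple_irreducible triple smu z x); rewrite zA !inE => <-.
Qed.

(* On the segment from [p] to the uniform vector [u] the entropy has slope [-oo]
   at [p] as soon as some [p 0 x] vanishes, while the potential is linearizable. *)
Lemma minimizer_interior (p : V) : minimizer F p -> forall x, 0 < p 0 x.
Proof.
move=> [sp hp] x0; rewrite lt_def simplex_ge0// andbT; apply/negP => /eqP px0.
have N0 : 0 < N by rewrite ltr0n.
set u : V := const_mx N^-1; have su : simplex u by exact: uniform_simplex.
have u0 x : 0 < u 0 x by rewrite mxE invr_gt0.
have [r r0 hr] := potential_linearized triple sp ltr01.
pose H := hamiltonian K p.
pose C := \sum_x (1 - ln (u 0 x)) + (\sum_x `|H x| * `|u 0 x - p 0 x|) + `|u - p|.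
pose v := `|u - p|.
have v0 : 0 < v + 1 by rewrite /v ltr_wpDl.
(* The exponential bound gives [ln t / N <= - (C + 1)], so that the logarithmic gain outweighs the
   constant [C] of all other terms; the bound with [r] permits linearizing the potential. *)
have [t [t0 t1 te tr _]] : exists t, [/\ 0 < t, t <= 1, t <= expR (- (N * (C + 1))),
    t <= r / (v + 1) & t <= 1].
  by apply: small_param; rewrite ?expR_gt0 ?divr_gt0.
have t0' := ltW t0.
pose q := p + t *: (u - p); have sq : simplex q by exact: simplex_convex.
have qE x : q 0 x = p 0 x + t * (u 0 x - p 0 x) by rewrite !mxE.
have qp : q - p = t *: (u - p) by rewrite /q addrAC subrr add0r.
have qpr : `|q - p| <= r.
  rewrite qp normrZ gtr0_norm//; apply: (@le_trans _ _ (t * (v + 1))).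
    by rewrite ler_wpM2l// lerDl.
  by rewrite -ler_pdivlMr.
have lnt : ln t <= - (N * (C + 1)).
  by rewrite -[leRHS]expRK ler_ln ?posrE ?expR_gt0.
have q0 x : 0 < q 0 x.
  have := mulr_gt0 t0 (u0 x); have : 0 <= (1 - t) * p 0 x by rewrite mulr_ge0 ?subr_ge0 ?simplex_ge0.
  rewrite qE; lra.
have q1 x : ln (q 0 x) <= 0 by rewrite ln_le0// simplex_le1.
have lnu x : ln (u 0 x) <= 0 by rewrite ln_le0// simplex_le1.
have one x : q 0 x * ln (q 0 x) - p 0 x * ln (p 0 x) <= t * (1 - ln (u 0 x)).
  apply: (le_trans (xlnx_tangent (simplex_ge0 x sp) (q0 x))).
  have -> : q 0 x - p 0 x = t * (u 0 x - p 0 x) by rewrite qE; ring.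
  rewrite mulrCA ler_pM2l//; have p0 := simplex_ge0 x sp; have p1 := simplex_le1 x sp.
  have u1 := simplex_le1 x su; have ux := u0 x.
  have [pu|/ltW up] := leP (p 0 x) (u 0 x).
    have : ln (q 0 x) * (u 0 x - p 0 x) <= 0 by rewrite mulr_le0_ge0// subr_ge0.
    have := lnu x; lra.
  have : ln (u 0 x) <= ln (q 0 x).
    rewrite ler_ln ?posrE// qE; have : 0 <= (1 - t) * (p 0 x - u 0 x).
      by rewrite mulr_ge0// subr_ge0.
    lra.
  move=> h1; have : (ln (q 0 x) - ln (u 0 x)) * (u 0 x - p 0 x) <= 0.
    by rewrite mulr_ge0_le0 ?subr_ge0 ?subr_le0.
  have : 0 <= - ln (u 0 x) * (1 - (p 0 x - u 0 x)) by rewrite mulr_ge0 ?oppr_ge0//; lra.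
  lra.
(* At the vanishing coordinate [q 0 x0 = t / N], whose entropy contains the decisive term
   [t * ln t / N]. *)
have spec : q 0 x0 * ln (q 0 x0) - p 0 x0 * ln (p 0 x0) <= t * (1 - ln (u 0 x0)) + t * (ln t / N).
  have := one x0; rewrite px0 mul0r subr0 qE px0 add0r subr0 lnM ?posrE//.
  have -> : u 0 x0 = N^-1 by rewrite mxE.
  move=> _; have := lnu x0; rewrite mxE => l0.
  have -> : t * N^-1 * (ln t + ln N^-1) = t * (ln t / N + ln N^-1 / N) by ring.
  rewrite -mulrDr ler_pM2l// addrC lerD2r.
  have : ln N^-1 / N <= 0 by rewrite mulr_le0_ge0 ?invr_ge0.
  by move: (ln N^-1) l0 => a l0; move: (a / N) => b h; lra.
have ent : \sum_x q 0 x * ln (q 0 x) - \sum_x p 0 x * ln (p 0 x) <=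
    t * (\sum_x (1 - ln (u 0 x))) + t * (ln t / N).
  rewrite -sumrB mulr_sumr (bigD1 x0)//= [in leRHS](bigD1 x0)//= [leRHS]addrAC.
  by apply: lerD; [exact: spec|apply: ler_sum => x _; exact: one].
have pot : potential K q - potential K p <= t * ((\sum_x `|H x| * `|u 0 x - p 0 x|) + `|u - p|).
  have := hr q qpr; rewrite mul1r ler_norml => /andP[_].
  have : \sum_x hamiltonian K p x * (q 0 x - p 0 x) <= t * \sum_x `|H x| * `|u 0 x - p 0 x|.
    rewrite mulr_sumr; apply: ler_sum => x _.
    have -> : q 0 x - p 0 x = t * (u 0 x - p 0 x) by rewrite qE; ring.
    by rewrite mulrCA ler_pM2l// -normrM ler_norm.
  rewrite qp normrZ gtr0_norm//; set S := \sum_x hamiltonian _ _ _ * _.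
  set S' := \sum_x _; lra.
have := hp q sq; rewrite leNgt => /negP; apply; rewrite -subr_lt0.
apply: (@le_lt_trans _ _ (t * (C + ln t / N))).
  rewrite /free_energy /C; move: ent pot.
  set E1 := \sum_x _; set E2 := \sum_x _; set E3 := \sum_x _; set E4 := \sum_x _.
  by move: (potential _ _) (potential _ _) (ln t / N) => U1 U2 l; lra.
rewrite pmulr_rlt0//.
have : ln t / N <= - (C + 1) by rewrite ler_pdivrMr// mulNr mulrC.
by rewrite -ltrBrDl sub0r => /le_lt_trans; apply; rewrite ltrN2 ltrDl.
Qed.

(** The Fisher information is a sum of nonnegative terms; if they all vanish, detailed balance holds
    for [p] itself, and no net mass flows. *)
Lemma fisher_eq0_stationary (p : V) : simplex p -> (forall x, 0 < p 0 x) ->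
  fisher Q p <= 0 -> p *m Q p = 0.
Proof.
move=> sp p0 I0.
have T0 x y : y != x -> 0 <= Theta (p 0 x * Q p x y) (p 0 y * Q p y x).
  move=> yx; have xy : x != y by rewrite eq_sym.
  have rQ := triple_regular triple.
  apply: Theta_ge0; [exact: rate_mass_ge0|exact: rate_mass_ge0|].
  rewrite !mulf_eq0 (gt_eqF (p0 x)) (gt_eqF (p0 y)) /=; have [Q0|Q0] := ltP 0 (Q p x y).
    by rewrite !gt_eqF// (rate_gt0_sym triple).
  by have [-> ->] := rate_eq0_sym triple sp xy Q0.
have db x y : y != x -> p 0 x * Q p x y = p 0 y * Q p y x.
  move=> yx; have xy : x != y by rewrite eq_sym.
  have [Q0|Q0] := ltP 0 (Q p x y); last first.
    by have [-> ->] := rate_eq0_sym triple sp xy Q0; rewrite (mulr0 (p 0 x)) (mulr0 (p 0 y)).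
  apply: Theta_eq0; [by rewrite mulr_gt0|by rewrite mulr_gt0// (rate_gt0_sym triple)|].
  apply/eqP; rewrite eq_le T0// andbT.
  have h2 : 0 < 2^-1 :> R by rewrite invr_gt0.
  rewrite -(pmulr_rle0 _ h2); apply: le_trans I0.
  rewrite /fisher (ler_pM2l h2) (bigD1 x)//= (bigD1 y)//= -addrA lerDl.
  apply: addr_ge0; first by apply: sumr_ge0 => z /andP[zx _]; exact: T0.
  by apply: sumr_ge0 => z _; apply: sumr_ge0 => w wz; exact: T0.
apply/rowP => y; rewrite [RHS]mxE.
have := sum_mulmx_rates triple (fun z => (z == y)%:R) sp.
rewrite (bigD1 y)//= eqxx mul1r big1 ?addr0 => [->|z /negPf ->]; last by rewrite mul0r.
rewrite big1 ?mulr0 ?oppr0// => x _; rewrite big1// => z zx.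
by rewrite (db _ _ zx) subrr mulr0.
Qed.

End Minimizer.

(** * The chain rule along differentiable curves *)

Section RowCurve.
Variables (R : realType) (n : nat).
Notation V := 'rV[R]_n.+1.

Lemma is_derive_row_cvg (m : R -> V) (t : R) (d : V) : is_derive t 1 m d ->
  h^-1 *: (m (h + t) - m t) @[h --> (0 : R)^'] --> d.
Proof.
move=> [dm Dm]; have E : (fun h : R => h^-1 *: ((m \o shift t) (h *: 1) - m t)) =
    (fun h => h^-1 *: (m (h + t) - m t)).
  by apply/funext => h /=; rewrite -[h *: 1]/(h * 1) mulr1.
by move: dm; rewrite /derivable /cvg_ex -Dm /derive E.
Qed.

Lemma is_derive_row_coord (m : R -> V) (t : R) (d : V) x : is_derive t 1 m d ->
  is_derive t (1 : R) (fun s => m s 0 x) (d 0 x).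
Proof.
move=> /is_derive_row_cvg h.
have hx : (fun h : R => h^-1 *: (((fun s => m s 0 x) \o shift t) (h *: 1) - m t 0 x)) @ 0^'
    --> d 0 x.
  have -> : (fun h : R => h^-1 *: (((fun s => m s 0 x) \o shift t) (h *: 1) - m t 0 x)) =
      (fun p : V => p 0 x) \o (fun h => h^-1 *: (m (h + t) - m t)).
    by apply/funext => h' /=; rewrite -[h' *: 1]/(h' * 1) mulr1 !mxE.
  by apply: continuous_cvg h; exact: coord_continuous.
by split; [apply/cvg_ex; eexists; exact: hx|exact/cvg_lim].
Qed.

Lemma is_derive_linearized (f : V -> R) g (m : R -> V) (t : R) (d : V) :
  linearized f (m t) g -> is_derive t 1 m d ->
  is_derive t (1 : R) (fun s => f (m s)) (\sum_x g x * d 0 x).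
Proof.
move=> fl dm; have hq := is_derive_row_cvg dm.
have cm : m h @[h --> t] --> m t.
  by have [h _] := dm; exact/differentiable_continuous/derivable1_diffP.
suff h : h^-1 * (f (m (h + t)) - f (m t)) @[h --> (0 : R)^'] --> \sum_x g x * d 0 x.
  have E : (fun h : R => h^-1 *: (((fun s => f (m s)) \o shift t) (h *: 1) - f (m t))) =
      (fun h => h^-1 * (f (m (h + t)) - f (m t))).
    by apply/funext => h' /=; rewrite -[h' *: 1]/(h' * 1) mulr1.
  by split; [apply/cvg_ex; eexists; rewrite E; exact: h|rewrite /derive E; exact/cvg_lim].
apply/cvgrPdist_le => e e0.
pose S := \sum_x `|g x|; have S1 : 0 < S + 1 by rewrite ltr_wpDl// sumr_ge0.
have D1 : 0 < `|d| + 1 by rewrite ltr_wpDl.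
(* The difference quotients of [m] are eventually bounded by [|d| + 1], so this tolerance leaves an
   error of [e / 2]. *)
have [r r0 hr] := fl (e / 2 / (`|d| + 1)) (divr_gt0 (divr_gt0 e0 (ltr0n _ 2)) D1).
have d0 : 0 < Num.min 1 (e / 2 / (S + 1)) by rewrite lt_min ltr01 !divr_gt0.
have cm0 : m (h + t) @[h --> (0 : R)^'] --> m t.
  have c0 : h + t @[h --> (0 : R)] --> 0 + t by apply: cvgD; [exact: cvg_id|exact: cvg_cst].
  rewrite add0r in c0; apply: (@cvg_comp _ _ _ (fun h => h + t) m (0 : R)^' (nbhs t) _ _ cm).
  by apply: cvg_trans c0; apply: cvg_app; exact: cvg_within.
near=> h.
have h0 : h != 0 by near: h; exact: nbhs_dnbhs_neq.
set q := h^-1 *: (m (h + t) - m t).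
have hqd : `|d - q| <= Num.min 1 (e / 2 / (S + 1)).
  by rewrite /q; near: h; have /cvgrPdist_le/(_ _ d0) := hq; exact.
have mr : `|m (h + t) - m t| <= r.
  by rewrite distrC; near: h; have /cvgrPdist_le/(_ _ r0) := cm0; exact.
have := hr _ mr; set T := \sum_x _ => hT.
have TE : T = h * \sum_x g x * q 0 x.
  rewrite /T mulr_sumr; apply: eq_bigr => x _; rewrite !mxE mulrCA; congr (_ * _).
  by rewrite mulVKf.
have qE : `|m (h + t) - m t| = `|h| * `|q|.
  by rewrite -normrZ /q scalerA mulfV// scale1r.
move: hqd; rewrite le_min => /andP[hq1 hq2].
have q1 : `|q| <= `|d| + 1.
  by have := ler_normB d (d - q); rewrite opprB addrC subrK; lra.
have -> : \sum_x g x * d 0 x - h^-1 * (f (m (h + t)) - f (m t)) =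
   \sum_x g x * (d - q) 0 x - h^-1 * (f (m (h + t)) - f (m t) - T).
  have -> : \sum_x g x * (d - q) 0 x = \sum_x g x * d 0 x - \sum_x g x * q 0 x.
    by rewrite -sumrB; apply: eq_bigr => x _; rewrite !mxE mulrBr.
  by rewrite TE; field.
apply: (le_trans (ler_normB _ _)).
have p1 : `|\sum_x g x * (d - q) 0 x| <= e / 2.
  apply: (le_trans (ler_norm_sum _ _ _)); apply: (@le_trans _ _ (S * (e / 2 / (S + 1)))).
    rewrite /S mulr_suml; apply: ler_sum => x _; rewrite normrM ler_wpM2l//.
    exact: le_trans (coord_le_norm _ _) hq2.
  by rewrite mulrCA ler_piMr ?divr_ge0 ?(ltW e0)// ler_pdivrMr// mul1r lerDl.
have p2 : `|h^-1 * (f (m (h + t)) - f (m t) - T)| <= e / 2.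
  rewrite normrM normfV ler_pdivrMl ?normr_gt0//; apply: (le_trans hT).
  by rewrite qE mulrCA ler_wpM2l// mulrAC ler_pdivrMr// ler_wpM2l// divr_ge0// ltW.
have ee : e / 2 + e / 2 = e by field.
by rewrite -ee; exact: lerD.
Unshelve. all: by end_near. Qed.

End RowCurve.

(** * Stationary points, entropy-transport inequality and decay *)

Section Conclusions.
Variables (R : realType) (n : nat).
Variables (K : 'rV[R]_n.+1 -> 'I_n.+1 -> R) (Q : 'rV[R]_n.+1 -> 'M[R]_n.+1).
Hypothesis triple : nonlinear_markov_triple K Q.
Notation V := 'rV[R]_n.+1.
Notation F := (free_energy K).

Lemma stationary_interior (p : V) : stationary Q p -> forall x, 0 < p 0 x.
Proof. by move=> [sp pQ]; apply: (support_full triple sp) => x _; rewrite pQ mxE. Qed.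

(** Were the Fisher information positive at the interior point [p], a short step along [p *m Q p]
    would lower [F], whose slope in that direction is minus the Fisher information. *)
Lemma minimizer_stationary (p : V) : minimizer F p -> stationary Q p.
Proof.
move=> pmin; have p0 := minimizer_interior triple pmin; have [sp hp] := pmin.
split => //; apply: (fisher_eq0_stationary triple sp p0); rewrite leNgt; apply/negP => I0.
set I := fisher Q p in I0; pose v := p *m Q p.
have v1 : 0 < `|v| + 1 by rewrite ltr_wpDl.
(* With this tolerance the linearization error of the step [t *: v] is at most half of the expected
   decrease [t * I]. *)
have e0 : 0 < I / 2 / (`|v| + 1) by rewrite divr_gt0// divr_gt0.
have [r r0 hr] := free_energy_linearized triple sp p0 e0.
have [c c0 hc] := positive_min (fun x => p 0 x).
have [t [t0 t1 tr tc _]] : exists t, [/\ 0 < t, t <= 1, t <= r / (`|v| + 1),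
    t <= c / (`|v| + 1) & t <= 1].
  by apply: small_param; rewrite ?divr_gt0.
have tv s : 0 < s -> t <= s / (`|v| + 1) -> `|t *: v| <= s.
  move=> s0 ts; rewrite normrZ gtr0_norm//; apply: (@le_trans _ _ (t * (`|v| + 1))).
    by rewrite ler_pM2l// lerDl.
  by rewrite -ler_pdivlMr.
pose q := p + t *: v.
have sq : simplex q.
  split=> [x|].
    have := tv _ c0 tc; have := coord_le_norm (t *: v) x; have := hc x (p0 x).
    by rewrite /q !mxE; set u := t * _; have := ler_norm (- u); rewrite normrN; lra.
  have hv : \sum_y v 0 y = 0.
    transitivity (\sum_y (fun=> 1 : R) y * v 0 y); first by apply: eq_bigr => y _; rewrite mul1r.
    rewrite (sum_mulmx_rates triple (fun=> 1) sp) big1 ?mulr0 ?oppr0// => x _.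
    by rewrite big1// => y _; rewrite subrr mul0r.
  rewrite /q; under eq_bigr do rewrite mxE [X in _ + X]mxE.
  by rewrite big_split/= -mulr_sumr hv mulr0 addr0; case: sp.
have qp : q - p = t *: v by rewrite /q addrAC subrr add0r.
have := hr q; rewrite qp => /(_ (tv _ r0 tr)).
have -> : \sum_x dfree K p x * (q 0 x - p 0 x) = - (t * I).
  rewrite /I -mulrN -(dfree_flow triple sp p0) mulr_sumr; apply: eq_bigr => x _.
  have -> : q 0 x - p 0 x = t * v 0 x by have := congr1 (fun M : V => M 0 x) qp; rewrite !mxE.
  by rewrite mulrCA.
have : I / 2 / (`|v| + 1) * `|t *: v| <= t * (I / 2).
  rewrite normrZ gtr0_norm// mulrCA ler_pM2l// mulrAC ler_pdivrMr//.
  by rewrite ler_pM2l ?divr_gt0// lerDl.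
move=> h1 h2; have := le_trans h2 h1; rewrite ler_norml => /andP[_].
have := hp q sq; have := mulr_gt0 t0 I0; rewrite (mulrA t I).
by move: (F q) (F p) (t * I) => a b w; lra.
Qed.

Variable lam : R.
Hypothesis lam0 : 0 < lam.
Hypothesis ric : Ric_ge Q K lam.

(** At the midpoint of a geodesic between them [F] would drop below its minimum by [lam / 8] times
    the squared distance. *)
Lemma minimizer_unique (p q : V) : minimizer F p -> minimizer F q -> p = q.
Proof.
move=> [sp hp] [sq hq]; have [g [sg _ _ _ gF]] := convex_geodesic triple ric sp sq.
have h0 : 0 <= 2^-1 :> R by [].
have h1 : 2^-1 <= 1 :> R by rewrite invf_le1// ler1n.
have Fpq : F p = F q by apply/eqP; rewrite eq_le hp// hq.
apply: (wd0_eq triple sp sq); apply/eqP; rewrite -sqrf_eq0 eq_le sqr_ge0 andbT.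
have := gF _ h0 h1; have := hp _ (sg _ h0 h1); rewrite -Fpq.
move=> a b; have l8 : 0 < lam / 8 by rewrite divr_gt0.
rewrite -(pmulr_rle0 _ l8); move: a b; move: (wd Q p q ^+ 2) (F p) (F _) => w a b; lra.
Qed.

Lemma stationary_minimizer (p : V) : stationary Q p -> minimizer F p.
Proof.
move=> st; have p0 := stationary_interior st; have [sp pQ] := st; split => // q sq.
have I0 : fisher Q p = 0.
  have := dfree_flow triple sp p0; rewrite big1 => [/eqP|x _]; last by rewrite pQ mxE mulr0.
  by rewrite eq_sym oppr_eq0 => /eqP.
by have := mlsi_interior triple lam0 ric sp p0 sq; rewrite I0 mul0r subr_le0.
Qed.

(** Near the minimizer [p] the geodesic cannot lower [F]; dividing the convexity inequality by [t]
    leaves [(1 - t) * w <= 2 / lam * (F q - F p)], and [t] is then taken small. *)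
Lemma entropy_transport (p q : V) : minimizer F p -> simplex q ->
  wd Q q p <= Num.sqrt (2 / lam * (F q - F p)).
Proof.
move=> [sp hp] sq; have [g [sg _ _ _ gF]] := convex_geodesic triple ric sp sq.
rewrite -(wd_sym triple) -[leLHS](ger0_norm (wd_ge0 Q p q)) -sqrtr_sqr.
have Fpq : 0 <= F q - F p by rewrite subr_ge0 hp.
have nn : 0 <= 2 / lam * (F q - F p).
  by apply: mulr_ge0 => //; apply: divr_ge0 => //; exact: ltW.
rewrite (ler_sqrt _ nn).
move: gF; set w := wd Q p q ^+ 2 => gF; have w0 : 0 <= w by exact: sqr_ge0.
apply/ler_addgt0Pr => e e0; have w1 : 0 < w + 1 by rewrite ltr_wpDl.
have [t [t0 t1 te _ _]] : exists t, [/\ 0 < t, t <= 1, t <= e / (w + 1), t <= 1 & t <= 1].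
  by apply: small_param; rewrite ?divr_gt0.
have tw : t * w <= e.
  by apply: (@le_trans _ _ (t * (w + 1))); [rewrite ler_pM2l// lerDl|rewrite -ler_pdivlMr].
have h1 := gF t (ltW t0) t1; have h2 := hp _ (sg t (ltW t0) t1).
have h3 : t * (lam / 2 * ((1 - t) * w)) <= t * (F q - F p).
  by move: h1 h2; move: (F p) (F q) (F _) => a b c; lra.
rewrite (ler_pM2l t0) in h3.
have : (1 - t) * w <= 2 / lam * (F q - F p).
  have l2 : 0 < lam / 2 by rewrite divr_gt0.
  have l3 : lam / 2 * (2 / lam) = 1 by field; rewrite gt_eqF.
  by rewrite -(ler_pM2l l2) (le_trans h3)// mulrA l3 mul1r.
lra.
Qed.

(** A coordinate vanishing at a positive time has a minimum there, so its derivative, the net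
    inflow, is 0, which is what [support_full] asks for. The initial point may lie on the
    boundary. *)
Lemma evolution_interior (m : R -> V) (t : R) : evolution_solution Q m -> 0 < t ->
  forall x, 0 < m t 0 x.
Proof.
move=> [sm _ dm] t0; apply: (support_full triple (sm t (ltW t0))) => x mx0.
have dc (s : R) : 0 < s -> is_derive s (1 : R) (fun s => m s 0 x) ((m s *m Q (m s)) 0 x).
  by move=> s0; exact: is_derive_row_coord (dm s s0).
have h : is_derive t (1 : R) (fun s => m s 0 x) 0.
  apply: (@derive1_at_min R (fun s => m s 0 x) 0 (t + 1) t).
  - by rewrite addr_ge0// ltW.
  - by move=> s; rewrite in_itv/= => /andP[s0 _]; case: (dc s s0).
  - by rewrite in_itv/= t0 ltrDl ltr01.
  - move=> s; rewrite in_itv/= => /andP[s0 _]; rewrite mx0.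
    exact: simplex_ge0 (sm s (ltW s0)).
by have [_ <-] := dc t t0; case: h.
Qed.

(** The mean value theorem is applied to [G], whose derivative is nonpositive at positive times by
    the logarithmic Sobolev inequality. At time 0 the curve may be on the boundary, so only the
    continuity of [F] is used there. *)
Lemma free_energy_decay (m : R -> V) (p : V) (t : R) : minimizer F p ->
  evolution_solution Q m -> 0 <= t ->
  F (m t) - F p <= expR (- 2 * lam * t) * (F (m 0) - F p).
Proof.
move=> pmin ev; have [sm cm dm] := ev; have [sp hp] := pmin.
rewrite le_eqVlt => /predU1P[<-|t0]; first by rewrite mulr0 expR0 mul1r.
pose G (s : R) := expR (2 * lam * s) * (F (m s) - F p).
pose dG (s : R) := expR (2 * lam * s) * (2 * lam * (F (m s) - F p) - fisher Q (m s)).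
have dGs (s : R) : 0 < s -> is_derive s 1 G (dG s).
  move=> s0; have ms := sm s (ltW s0); have m0 := evolution_interior ev s0.
  have h1 := is_derive_linearized (free_energy_linearized triple ms m0) (dm s s0).
  rewrite (dfree_flow triple ms m0) in h1.
  have h2 : is_derive s (1 : R) (fun s => expR (2 * lam * s)) (2 * lam * expR (2 * lam * s)).
    have h : is_derive s (1 : R) (fun s => 2 * lam * s) (2 * lam).
      have h := is_deriveZ (2 * lam) (is_derive_id s (1 : R)).
      by apply: (is_derive_eq (h : is_derive s 1 (fun s => 2 * lam * s) _)); rewrite -[_ *: _]/(_ * _) mulr1.
    have h' := @is_derive1_comp R expR (fun s => 2 * lam * s) s _ _ (is_derive_expR _) h.
    by apply: (is_derive_eq (h' : is_derive s 1 (fun s => expR (2 * lam * s)) _)); rewrite mulrC.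
  have h3 := is_deriveM h2 (is_deriveB h1 (is_derive_cst (F p) s 1)).
  by apply: (is_derive_eq (h3 : is_derive s 1 G _)); rewrite -![_ *: _]/(_ * _) /dG !fctE /cst /=; ring.
have cG : {within `[0, t], continuous G}.
  have cm' : {within `[0, t], continuous m}.
    apply: continuous_subspaceW cm => s /=; rewrite !in_itv/= => /andP[-> _].
    by [].
  move/subspace_continuousP : cm' => cm'; apply/subspace_continuousP => s st.
  have s0 : 0 <= s by move: st; rewrite /= in_itv/= => /andP[].
  apply: cvgM.
    apply: (@cvg_trans _ ((fun s => expR (2 * lam * s)) @ nbhs s)); first by apply: cvg_app; exact: cvg_within.
    apply: (@continuous_comp _ _ _ (fun s => 2 * lam * s) expR); last exact: continuous_expR.
    exact: mulrl_continuous.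
  apply: cvgB; last exact: cvg_cst.
  apply: (@cvg_comp _ _ _ m F _ (nbhs (m s))); first exact: cm'.
  exact: free_energy_continuous triple _ (sm s s0).
have [s|c] := @MVT R G dG 0 t t0 _ cG.
  by rewrite in_itv/= => /andP[s0 _]; exact: dGs.
rewrite in_itv/= subr0 => /andP[c0 ct] GE.
have : G t <= G 0.
  rewrite -subr_le0 GE pmulr_lle0// /dG pmulr_rle0 ?expR_gt0//.
  have mc := sm c (ltW c0).
  have := mlsi_interior triple lam0 ric mc (evolution_interior ev c0) sp.
  by rewrite ler_pdivlMr ?mulr_gt0//; lra.
rewrite /G mulr0 expR0 mul1r => h.
have -> : - 2 * lam * t = - (2 * lam * t) by ring.
by rewrite expRN ler_pdivlMl ?expR_gt0.
Qed.

End Conclusions.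

Unset Implicit Arguments.

Theorem theorem1p2 (R : realType) (n : nat)
    (K : 'rV[R]_n.+1 -> 'I_n.+1 -> R) (Q : 'rV[R]_n.+1 -> 'M[R]_n.+1)
    (lambda : R) (lambda_gt0 : 0 < lambda)
    (triple : nonlinear_markov_triple K Q)
    (ric : Ric_ge Q K lambda) :
  exists pistar : 'rV[R]_n.+1,
    let Fstar (mu : 'rV[R]_n.+1) := free_energy K mu - free_energy K pistar in
    [/\ unique (stationary Q) pistar /\ unique (minimizer (free_energy K)) pistar,
        (forall mu, simplex mu ->
          ((Fstar mu)%:E <= (1 / (2 * lambda))%R%:E * fisher_information Q mu)%E),
        (forall mu : R -> 'rV[R]_n.+1, evolution_solution Q mu ->
          forall t : R, 0 <= t ->
            Fstar (mu t) <= expR (- 2 * lambda * t) * Fstar (mu 0)) &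
        (forall mu, simplex mu ->
          (Wdist Q mu pistar <= (Num.sqrt (2 / lambda * Fstar mu))%R%:E)%E)].
Proof.
have [p pmin] := minimizer_exists triple; have [sp hp] := pmin.
exists p => Fstar; split.
- split; split => //; first exact: (minimizer_stationary triple).
    move=> q /(stationary_minimizer triple lambda_gt0 ric).
    exact: (minimizer_unique triple lambda_gt0 ric).
  move=> q; exact: (minimizer_unique triple lambda_gt0 ric).
- move=> mu smu; rewrite /fisher_information; case: ifP => [/forallP mu0|_].
    rewrite -EFinM lee_fin mulrC mulrA mulr1.
    exact: (mlsi_interior triple lambda_gt0 ric).
  by rewrite gt0_muley ?leey// lte_fin divr_gt0// mulr_gt0.
- by move=> mu ev t t0; exact: (free_energy_decay triple lambda_gt0 ric).
- move=> mu smu; rewrite (wdE triple)// lee_fin.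
  exact: (entropy_transport triple lambda_gt0 ric).
Qed.
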